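(* Assume that there are positive constants such that for all $x,y\in\mathbb{R}^d$: (i) $\mathbb{E}_\xi\|\tilde\nabla f(x,\xi)-\tilde\nabla f(y,\xi)\|^2\le\tilde L_{\nabla f}^2\|x-y\|^2$, $\mathbb{E}_\zeta\|\tilde\nabla c(x,\zeta)-\tilde\nabla c(y,\zeta)\|^2\le\tilde L_{\nabla c}^2\|x-y\|^2$, $\mathbb{E}_\zeta\|\tilde c(x,\zeta)-\tilde c(y,\zeta)\|^2\le\tilde L_c^2\|x-y\|^2$; (ii) $\mathbb{E}\|\tilde\nabla f(x,\xi)-\nabla f(x)\|^2\le\sigma_f^2$, $\mathbb{E}\|\tilde\nabla c(x,\zeta)-\nabla c(x)\|^2\le\sigma_{\nabla c}^2$, $\mathbb{E}\|\tilde c(x,\zeta)-c(x)\|^2\le\sigma_c^2$; (iii) $\|\nabla c(x)\|\le C_{\nabla c}$, $\|c(x)\|\le C_c$, $\|\tilde\nabla c(x,\zeta)\|\le\tilde C_{\nabla c}$, $\|\tilde c(x,\zeta)\|\le\tilde C_c$, $\|\nabla f(x)\|\le C_{\nabla f}$, $|f(x_k)|\le B_f$ for all iterates $x_k$, and $f(x)+\frac{\rho}{2}\sum_{i=1}^m c_i(x)^2\ge\underline Q>-\infty$ for all $\rho>0$ and all $x$; (iv) there is $\delta>0$ with $\mathrm{dist}(\nabla c(x_k)^\top c(x_k),-N_X(x_k))\ge\delta\|c(x_k)\|$ for all iterates $x_k$. Run the algorithm with dual updates described in the context with $$\eta_k=\frac{1}{9\tilde L\rho(k+1)^{3/5}},\quad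 \rho_k=\rho k^{1/5},\quad \gamma_{k,i}=\frac{\gamma}{k(\log(k+1))^2|\tilde c_i(x_k,\zeta_k^2)|},\quad \alpha_{k+1}=\frac{72}{81(k+1)^{4/5}},$$ for some constants $\rho>1$, $\gamma>0$, where $$\tilde L^2=\tfrac34\tilde L_{\nabla f}^2+\tfrac34m^2(\|\lambda_1\|+4\gamma)^2\tilde L_{\nabla c}^2+\tfrac32m^2(\tilde C_c^2\tilde L_{\nabla c}^2+\tilde C_{\nabla c}^2\tilde L_c^2).$$ Then there are constants $C,p>0$ independent of $\varepsilon$ such that for every $\varepsilon\in(0,1/2]$ there is an integer $K\le C\varepsilon^{-5}(\log(1/\varepsilon))^p$ (that is, $K=\widetilde O(\varepsilon^{-5})$ iterations) such that, with $\hat k$ selected uniformly at random from $\{1,\dots,K\}$ (independently of the run), there exists a (random) $\lambda\in\mathbb{R}^m$ with $$\mathbb{E}\,\mathrm{dist}\big(\nabla f(x_{\hat k+1})+\nabla c(x_{\hat k+1})^\top\lambda,\,-N_X(x_{\hat k+1})\big)\le\varepsilon,$$ and moreover $\mathbb{E}\|c(x_{\hat k+1})\|\le\varepsilon$.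
   Context: Problem: $\min_{x\in X}f(x)$ subject to $c(x)=0$, where $X\subseteq\mathbb{R}^d$ is closed and convex, $f:\mathbb{R}^d\to\mathbb{R}$ and $c=(c_1,\dots,c_m)^\top:\mathbb{R}^d\to\mathbb{R}^m$ are smooth (Lipschitz gradients, possibly nonconvex), $f(x)=\mathbb{E}_\xi[\tilde f(x,\xi)]$, $c(x)=\mathbb{E}_\zeta[\tilde c(x,\zeta)]$. $\nabla c(x)\in\mathbb{R}^{m\times d}$ is the Jacobian. Unbiased oracles $\tilde\nabla f(x,\xi)$ and $\tilde\nabla c(x,\zeta)$ (rows $\tilde\nabla c_i$) are given: $\mathbb{E}_\xi\tilde\nabla f(x,\xi)=\nabla f(x)$, $\mathbb{E}_\zeta\tilde\nabla c_i(x,\zeta)=\nabla c_i(x)$. $N_X(x)$ is the normal cone to $X$ at $x$, $P_X$ is projection onto $X$, $\mathrm{dist}(x,S)=\min_{y\in S}\|x-y\|$. For $B=(\xi^0,\zeta^1,\zeta^2)$ with $\zeta^1,\zeta^2$ i.i.d., set $\tilde\nabla Q_\rho(x,\lambda,B)=\tilde\nabla f(x,\xi^0)+\sum_{i=1}^m\lambda_i\tilde\nabla c_i(x,\zeta^1)+\rho\sum_{i=1}^m\tilde\nabla c_i(x,\zeta^1)\tilde c_i(x,\zeta^2)$. Algorithm: $x_1\in X$ and $\lambda_1\in\mathbb{R}^m$ arbitrary (deterministic), $B_1$ sampled, $g_1=\tilde\nabla Q_{\rho_1}(x_1,\lambda_1,B_1)$, and $\lambda_{2,i}=\lambda_{1,i}+\gamma_{1,i}\tilde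 c_i(x_1,\zeta_1^2)$. For $k=1,2,\dots$: $x_{k+1}=P_X(x_k-\eta_kg_k)$; draw a fresh independent sample $B_{k+1}=(\xi^0_{k+1},\zeta^1_{k+1},\zeta^2_{k+1})$; $g_{k+1}=\tilde\nabla Q_{\rho_{k+1}}(x_{k+1},\lambda_{k+1},B_{k+1})+(1-\alpha_{k+1})\big(g_k-\tilde\nabla Q_{\rho_k}(x_k,\lambda_k,B_{k+1})\big)$; and $\lambda_{k+2,i}=\lambda_{k+1,i}+\gamma_{k+1,i}\tilde c_i(x_{k+1},\zeta^2_{k+1})$ for $i=1,\dots,m$. Convention: the increment $\gamma_{k,i}\tilde c_i(x_k,\zeta^2_k)$ is $0$ when $\tilde c_i(x_k,\zeta^2_k)=0$. *)

(* Defs.v *)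
From HB Require Import structures.
From mathcomp Require Import all_boot all_order all_algebra.
From mathcomp Require Import finmap.
From mathcomp Require Import all_classical all_reals all_analysis.

Set Implicit Arguments.
Unset Strict Implicit.
Unset Printing Implicit Defensive.
Import Order.TTheory GRing.Theory Num.Theory.
Import numFieldNormedType.Exports.
Local Open Scope classical_set_scope.
Local Open Scope ring_scope.

(* Points of R^n and multipliers are row vectors.  The library norm on          *)
(* matrices is the sup norm, hence the Euclidean and spectral norms below.      *)
Section euclidean.
Context {R : realType} {n : nat}.
Implicit Types (v w x y : 'rV[R]_n) (X S : set 'rV[R]_n).

Definition dotp v w : R := \sum_(j < n) v 0 j * w 0 j.

Definition enorm v : R := Num.sqrt (dotp v v).

Definition euclid_dist_to v S : R := inf [set enorm (v - s) | s in S].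

Definition normal_cone X x : set 'rV[R]_n :=
  [set v | forall y, X y -> dotp v (y - x) <= 0].

Definition neg_normal_cone X x : set 'rV[R]_n :=
  [set - v | v in normal_cone X x].

Definition euclid_proj X y : 'rV[R]_n :=
  xget 0 [set z | X z /\ forall u, X u -> enorm (y - z) <= enorm (y - u)].

Definition grad (f : 'rV[R]_n -> R) x : 'rV[R]_n :=
  \row_(j < n) 'D_(delta_mx 0 j) f x.

End euclidean.

(* The operator norm of the m x n matrix A acting on columns: A v is the        *)
(* transpose of v^T A^T.                                                        *)
Definition opnorm {R : realType} {m n : nat} (A : 'M[R]_(m, n)) : R :=
  sup [set enorm (v *m A^T) | v in [set v : 'rV[R]_n | enorm v <= 1]].

(* The library jacobian acts on row vectors from the right; the transpose has   *)
(* the gradients of the components of c as rows, so that lam *m Jac c x is the  *)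
(* row form of (Jac c x)^T lam.                                                 *)
Definition Jac {R : realType} {n m : nat} (c : 'rV[R]_n -> 'rV[R]_m)
    (x : 'rV[R]_n) : 'M[R]_(m, n) :=
  (jacobian c x)^T.

Definition jointly_measurable {R : realType} {n : nat} {d} {T : measurableType d}
    (h : 'rV[R]_n -> T -> R) : Prop :=
  measurable_fun [set: g_sigma_algebraType (@open 'rV[R]_n) * T]
    (fun p => h p.1 p.2).

Definition mutually_independent {d d'} {T : measurableType d}
    {T' : measurableType d'} {R : realType} (P : probability T R)
    {I : choiceType} (D : set I) (Y : I -> {RV P >-> T'}) : Prop :=
  forall (J : {fset I}) (A : I -> set T'),
    [set` J] `<=` D -> (forall k, k \in J -> measurable (A k)) ->
    P (\bigcap_(k in [set` J]) (Y k @^-1` A k)) =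
      (\prod_(k <- J) P (Y k @^-1` A k))%E.

(* A sample is b = ((xi0, zeta1), zeta2). *)
Section algorithm.
Context {R : realType} {d m : nat} {Xi Z : Type}.
Variables (gft : 'rV[R]_d -> Xi -> 'rV[R]_d) (ct : 'rV[R]_d -> Z -> 'rV[R]_m)
  (gct : 'rV[R]_d -> Z -> 'M[R]_(m, d)).

Definition Qgrad (rho : R) (x : 'rV[R]_d) (lam : 'rV[R]_m) (b : Xi * Z * Z) :
    'rV[R]_d :=
  gft x b.1.1
  + \sum_(i < m) lam 0 i *: row i (gct x b.1.2)
  + rho *: \sum_(i < m) ct x b.2 0 i *: row i (gct x b.1.2).

(* gam k t is the dual step size at iteration k when the sampled constraint     *)
(* value is t.  Indices start at 1; the values at index 0 are irrelevant.       *)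
Record algorithm_run {Omega : Type} (X : set 'rV[R]_d) (eta rho alpha : nat -> R)
    (gam : nat -> R -> R) (x1 : 'rV[R]_d) (lam1 : 'rV[R]_m)
    (B : nat -> Omega -> Xi * Z * Z) (x : nat -> Omega -> 'rV[R]_d)
    (lam : nat -> Omega -> 'rV[R]_m) (g : nat -> Omega -> 'rV[R]_d) : Prop :=
  AlgorithmRun {
    run_x1 : forall w, x 1%N w = x1 ;
    run_lam1 : forall w, lam 1%N w = lam1 ;
    run_g1 : forall w, g 1%N w = Qgrad (rho 1%N) x1 lam1 (B 1%N w) ;
    run_lam : forall k w i, (0 < k)%N ->
      lam k.+1 w 0 i =
        lam k w 0 i
        + gam k (ct (x k w) (B k w).2 0 i) * ct (x k w) (B k w).2 0 i ;
    run_x : forall k w, (0 < k)%N ->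
      x k.+1 w = euclid_proj X (x k w - eta k *: g k w) ;
    run_g : forall k w, (0 < k)%N ->
      g k.+1 w =
        Qgrad (rho k.+1) (x k.+1 w) (lam k.+1 w) (B k.+1 w)
        + (1 - alpha k.+1) *:
            (g k w - Qgrad (rho k) (x k w) (lam k w) (B k.+1 w)) }.

End algorithm.

Section schedule.
Context {R : realType}.

Definition Ltilde (m : nat) (Lgf Lgc Lc Cgct Cct gamma nlam1 : R) : R :=
  Num.sqrt (3 / 4 * Lgf ^+ 2
            + 3 / 4 * m%:R ^+ 2 * (nlam1 + 4 * gamma) ^+ 2 * Lgc ^+ 2
            + 3 / 2 * m%:R ^+ 2 * (Cct ^+ 2 * Lgc ^+ 2 + Cgct ^+ 2 * Lc ^+ 2)).

Definition eta_sched (L rho : R) (k : nat) : R :=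
  1 / (9 * L * rho * k.+1%:R `^ (3 / 5)).

Definition rho_sched (rho : R) (k : nat) : R := rho * k%:R `^ (1 / 5).

(* Division by zero is zero, so the increment gamma_sched gamma k t * t         *)
(* vanishes when t = 0.                                                         *)
Definition gamma_sched (gamma : R) (k : nat) (t : R) : R :=
  gamma / (k%:R * ln k.+1%:R ^+ 2 * `|t|).

Definition alpha_sched (k : nat) : R := 72 / (81 * k%:R `^ (4 / 5)).

End schedule.

(* Main.v *)
(* Let s_k = k^(1/5), let Q_k be the augmented Lagrangian with the multiplier   *)
(* and the penalty of step k, e_k = g_k - grad Q_k(x_k), D_k = |x_{k+1} - x_k|. *)
(* The multipliers stay bounded because sum_k 1 / (k ln^2 (k+1)) <= 4.  A       *)
(* projected step decreases Q_k by D_k^2 / (2 eta_k) up to eta_k |e_k|^2 / 2,   *)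
(* and passing from Q_k to Q_{k+1} costs O(1/k) for the multiplier plus         *)
(* (rho_{k+1} - rho_k) |c(x_{k+1})|^2 / 2; by (iv) the latter is at most        *)
(* O(1/s_k) (D_k^2 / eta_k + eta_k |e_k|^2) + O(1/k).  Conditionally on the     *)
(* first k samples, the momentum recursion gives                                *)
(* E|e_{k+1}|^2 <= (1 - alpha_{k+1}) E|e_k|^2 + 16 L^2 rho_k^2 E D_k^2          *)
(*                 + O(s_{k+1}^-6).                                             *)
(* The potential E Q_k + c_k E|e_k|^2 with c_k proportional to s_k therefore    *)
(* yields sum_{k <= K} (E D_k^2 / eta_k + eta_k E|e_k|^2) = O(ln K).  With the  *)
(* multiplier lam_k + rho_k c(x_{k+1}) the stationarity residual is             *)
(* O(D_k / eta_k + |e_k|), and |c(x_{k+1})| is at most that plus O(1/rho_k).    *)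
(* AM-GM with weight s_K^4 bounds both averages over k <= K by                  *)
(* O(K^(-1/5) ln K), which is below eps for K of order eps^-5 ln^5 (1/eps).     *)
Require Import Defs.
From HB Require Import structures.
From mathcomp Require Import all_boot all_order all_algebra.
From mathcomp Require Import finmap.
From mathcomp Require Import all_classical all_reals all_analysis.
From mathcomp Require Import measurable_realfun.
From mathcomp Require Import ring lra.

Set Implicit Arguments.
Unset Strict Implicit.
Unset Printing Implicit Defensive.
Import Order.TTheory GRing.Theory Num.Theory.
Import numFieldNormedType.Exports.
Local Open Scope classical_set_scope.
Local Open Scope ring_scope.

(** * Euclidean geometry and projections *)

(** One Lyapunov function controls the run: the mean of the augmented Lagrangian Q_k of step k,
    shifted to be nonnegative, plus a multiple of order s_k = k^(1/5) of E|e_k|^2, where e_k = g_k -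
    grad Q_k(x_k) is the error of the momentum estimator. Write D_k = |x_{k+1} - x_k|.

    Descent. The gradient of Q_k has a Lipschitz constant of order s_k, well below 1 / eta_k, which
    is of order s_k^3. A projected step therefore lowers Q_k by about D_k^2 / (2 eta_k), up to eta_k
    |e_k|^2 / 2 ([step_descent]). Raising the penalty costs (rho_{k+1} - rho_k) |c(x_{k+1})|^2 / 2,
    too much if c is merely bounded. Regularity (iv) repairs this: approximate stationarity for Q_k,
    divided by rho_k, bounds |c(x_{k+1})| ([step_constraint]), so the cost is a fraction O(1/s_k) of
    terms already in the balance plus O(1/k) ([sqr_constraint_le]). The multiplier moves by O(1/k)
    and its coordinates stay below |lam_1| + 4 gamma ([sum_inv_log2_le]).

    Variance. The points x_k, x_{k+1}, the multipliers lam_k, lam_{k+1} and g_k depend on the first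
    k samples only, so the next sample can be integrated with them frozen ([independent_fubini]).
    The oracle is unbiased because zeta1 and zeta2 are independent, the cross term with e_k vanishes
    ([momentum_variance]), and E|e_k|^2 contracts by 1 - alpha_{k+1} up to a multiple of rho_k^2
    D_k^2 and O(s_{k+1}^-6) ([step_variance]).

    Balance. The weight of E|e_k|^2 lets the contraction pay for the eta_k |e_k|^2 of the descent
    while its D_k^2 term is paid by the descent ([potential_decrease]). Telescoping bounds the sum
    over k <= K of E D_k^2 / eta_k + eta_k E|e_k|^2 by O(ln K) ([sum_potential]).

    Conclusion. The stationarity residual at x_{k+1} with multiplier lam_k + rho_k c(x_{k+1}), and
    |c(x_{k+1})|, share one majorant of order D_k / eta_k + |e_k| + 1 / rho_k. By a weighted AM-GM
    its means sum to O(s_K^4 ln K) ([run_residual_bound]); dividing by K = s_K^5 leaves O(K^(-1/5)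
    ln K). [iteration_count] picks K, and [expectation_uniform_le] reads the average as an
    expectation at a uniform index. *)

Section euclidean_norm.
Context {R : realType} {n : nat}.
Implicit Types (u v w : 'rV[R]_n) (a : R).

Lemma dotpC v w : dotp v w = dotp w v.
Proof. by apply: eq_bigr => j _; rewrite mulrC. Qed.

Lemma dotpDl u v w : dotp (u + v) w = dotp u w + dotp v w.
Proof.
by rewrite /dotp -big_split; apply: eq_bigr => j _; rewrite mxE mulrDl.
Qed.

Lemma dotpDr u v w : dotp u (v + w) = dotp u v + dotp u w.
Proof. by rewrite dotpC dotpDl !(dotpC u). Qed.

Lemma dotpZl a v w : dotp (a *: v) w = a * dotp v w.
Proof.
by rewrite /dotp mulr_sumr; apply: eq_bigr => j _; rewrite mxE mulrA.
Qed.

Lemma dotpZr a v w : dotp v (a *: w) = a * dotp v w.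
Proof. by rewrite dotpC dotpZl dotpC. Qed.

Lemma dotpNl v w : dotp (- v) w = - dotp v w.
Proof. by rewrite -scaleN1r dotpZl mulN1r. Qed.

Lemma dotpNr v w : dotp v (- w) = - dotp v w.
Proof. by rewrite dotpC dotpNl dotpC. Qed.

Lemma dotpBl u v w : dotp (u - v) w = dotp u w - dotp v w.
Proof. by rewrite dotpDl dotpNl. Qed.

Lemma dotpBr u v w : dotp u (v - w) = dotp u v - dotp u w.
Proof. by rewrite dotpDr dotpNr. Qed.

Lemma dotp0l v : dotp 0 v = 0.
Proof. by rewrite -(scale0r 0) dotpZl mul0r. Qed.

Lemma dotp0r v : dotp v 0 = 0.
Proof. by rewrite dotpC dotp0l. Qed.

Lemma dotp_ge0 v : 0 <= dotp v v.
Proof. by apply: sumr_ge0 => j _; rewrite -expr2 sqr_ge0. Qed.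

Lemma enorm_ge0 v : 0 <= enorm v.
Proof. exact: sqrtr_ge0. Qed.

Lemma sqr_enorm v : enorm v ^+ 2 = dotp v v.
Proof. by rewrite sqr_sqrtr ?dotp_ge0. Qed.

Lemma sqr_enorm_sum v : enorm v ^+ 2 = \sum_(j < n) v 0 j ^+ 2.
Proof. by rewrite sqr_enorm; apply: eq_bigr => j _; rewrite expr2. Qed.

Lemma enorm0 : enorm (0 : 'rV[R]_n) = 0.
Proof. by rewrite /enorm dotp0l sqrtr0. Qed.

Lemma enormZ a v : enorm (a *: v) = `|a| * enorm v.
Proof.
by rewrite /enorm dotpZl dotpZr mulrA -expr2 sqrtrM ?sqr_ge0// sqrtr_sqr.
Qed.

Lemma enormN v : enorm (- v) = enorm v.
Proof. by rewrite -scaleN1r enormZ normrN1 mul1r. Qed.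

Lemma enormBC v w : enorm (v - w) = enorm (w - v).
Proof. by rewrite -enormN opprB. Qed.

Lemma coord_le_enorm v j : `|v 0 j| <= enorm v.
Proof.
rewrite -(@ler_pXn2r _ 2) ?nnegrE ?normr_ge0 ?enorm_ge0//.
rewrite sqr_enorm_sum real_normK ?num_real//.
by rewrite (bigD1 j)//= lerDl sumr_ge0// => i _; rewrite sqr_ge0.
Qed.

Lemma enorm_eq0 v : enorm v = 0 -> v = 0.
Proof.
move=> v0; apply/rowP => j; rewrite mxE; apply/eqP.
by rewrite -normr_le0 -v0 coord_le_enorm.
Qed.

Lemma CauchySchwarz_dotp v w : dotp v w <= enorm v * enorm w.
Proof.
have [/enorm_eq0 ->|v0] := eqVneq (enorm v) 0.
  by rewrite dotp0l enorm0 mul0r.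
have vp : 0 < enorm v by rewrite lt_def v0 enorm_ge0.
have := dotp_ge0 (enorm w *: v - enorm v *: w).
rewrite dotpBl !dotpBr !(dotpZl, dotpZr) (dotpC w v) -!sqr_enorm.
set a := enorm v in v0 vp *; set b := enorm w; set t := dotp _ _ => h.
have b0 : 0 <= b := enorm_ge0 w.
have [b0'|bN0] := eqVneq b 0.
  by rewrite b0' mulr0 /t (enorm_eq0 b0') dotp0r.
have bp : 0 < b by rewrite lt_def bN0 b0.
rewrite -(ler_pM2l (mulr_gt0 vp bp)); nra.
Qed.

Lemma CauchySchwarz_dotp_norm v w : `|dotp v w| <= enorm v * enorm w.
Proof.
rewrite ler_norml lerNl -dotpNl -{1}(enormN v) !CauchySchwarz_dotp//.
Qed.

Lemma enormD v w : enorm (v + w) <= enorm v + enorm w.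
Proof.
rewrite -(@ler_pXn2r _ 2) ?nnegrE ?addr_ge0 ?enorm_ge0//.
rewrite sqr_enorm dotpDl !dotpDr (dotpC w v) sqrrD !sqr_enorm.
by have := CauchySchwarz_dotp v w; lra.
Qed.

Lemma enormB v w : enorm (v - w) <= enorm v + enorm w.
Proof. by rewrite -(enormN w) enormD. Qed.

Lemma enorm_sum (I : Type) (s : seq I) (F : I -> 'rV[R]_n) :
  enorm (\sum_(i <- s) F i) <= \sum_(i <- s) enorm (F i).
Proof.
elim: s => [|i s ih]; first by rewrite !big_nil enorm0.
by rewrite !big_cons (le_trans (enormD _ _))// lerD2l.
Qed.

Lemma sqr_enormD v w : enorm (v + w) ^+ 2 <= 2 * enorm v ^+ 2 + 2 * enorm w ^+ 2.
Proof.
have := enormD v w; have := enorm_ge0 (v + w).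
by have := sqr_ge0 (enorm v - enorm w); nra.
Qed.

Lemma norm_le_enorm v : `|v| <= enorm v.
Proof.
rewrite [leLHS]/Num.norm /= mx_normrE; apply/bigmax_leP; split.
  exact: enorm_ge0.
by case=> i j _ /=; rewrite ord1 coord_le_enorm.
Qed.

Lemma coord_le_norm v j : `|v 0 j| <= `|v|.
Proof.
rewrite [leRHS]/Num.norm /= mx_normrE; apply/bigmax_geP; right => /=.
by exists (0, j).
Qed.

Lemma enorm_le_sum v : enorm v <= \sum_(j < n) `|v 0 j|.
Proof.
rewrite -(@ler_pXn2r _ 2) ?nnegrE ?enorm_ge0 ?sumr_ge0//.
rewrite sqr_enorm_sum expr2 mulr_suml; apply: ler_sum => j _.
rewrite -real_normK ?num_real// expr2 ler_wpM2l//.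
by rewrite (bigD1 j)//= lerDl sumr_ge0.
Qed.

Lemma enorm_le_norm v : enorm v <= n%:R * `|v|.
Proof.
rewrite (le_trans (enorm_le_sum v))//.
rewrite (le_trans (ler_sum _ (fun j _ => coord_le_norm v j)))//.
by rewrite sumr_const card_ord mulr_natl.
Qed.

(** The topology on row vectors comes from the sup norm, so a Euclidean Lipschitz bound is
    transported with the factor n of [enorm_le_norm]. *)
Lemma lipschitz_enorm_continuous k (h : 'rV[R]_n -> 'rV[R]_k) (L : R) :
  (forall v w, enorm (h v - h w) <= L * enorm (v - w)) -> continuous h.
Proof.
move=> hL v; have FF := nbhs_filter v; apply/cvgrPdist_lt => e e0.
set M := `|L| * n%:R + 1.
have M0 : 0 < M by rewrite ltr_wpDl ?mulr_ge0.
near=> w.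
have : `|v - w| < e / M.
  near: w; apply: (@cvgr_dist_lt _ _ _ (nbhs v)); first exact: cvg_id.
  by rewrite divr_gt0.
rewrite ltr_pdivlMr// => lt.
apply: le_lt_trans lt.
have nn : enorm (v - w) <= n%:R * `|v - w| := enorm_le_norm _.
apply: (le_trans (le_trans _ (hL v w))).
  rewrite [leLHS]/Num.norm /= mx_normrE; apply/bigmax_leP; split.
    exact: sqrtr_ge0.
  case=> i j _ /=; rewrite ord1.
  rewrite -(@ler_pXn2r _ 2) ?nnegrE ?normr_ge0 ?sqrtr_ge0//.
  rewrite sqr_sqrtr; last first.
    by apply: sumr_ge0 => l _; rewrite -expr2 sqr_ge0.
  rewrite real_normK ?num_real// /dotp (bigD1 j)//= -expr2 lerDl.
  by apply: sumr_ge0 => l _; rewrite -expr2 sqr_ge0.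
apply: (@le_trans _ _ (`|L| * enorm (v - w))).
  by rewrite ler_wpM2r ?enorm_ge0// ler_norm.
apply: (@le_trans _ _ (`|L| * (n%:R * `|v - w|))).
  by rewrite ler_wpM2l.
by have -> : `|v - w| * M = `|L| * (n%:R * `|v - w|) + `|v - w|; [rewrite /M; ring|rewrite lerDl].
Unshelve. all: by end_near.
Qed.

Lemma continuous_enorm : continuous (@enorm R n).
Proof.
move=> v; have FF := nbhs_filter v; apply/cvgrPdist_lt => e e0.
near=> w.
have lt : `|v - w| < e / (n%:R + 1).
  near: w; apply: (@cvgr_dist_lt _ _ _ (nbhs v)); first exact: cvg_id.
  by rewrite divr_gt0// ltr_wpDl.
move: lt; rewrite ltr_pdivlMr ?ltr_wpDl// => lt.
apply: le_lt_trans lt.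
apply: (@le_trans _ _ (enorm (v - w))).
  rewrite ler_norml.
  have h1 := enormD (v - w) w; rewrite subrK in h1.
  have h2 := enormD (w - v) v; rewrite subrK enormBC in h2.
  by apply/andP; split; lra.
by rewrite (le_trans (enorm_le_norm _))// mulrDr mulr1 mulrC lerDl.
Unshelve. all: by end_near.
Qed.

End euclidean_norm.

(** * The operator norm and its adjoint form *)

Section operator_norm.
Context {R : realType}.

Lemma has_sup_opnorm m n (A : 'M[R]_(m, n)) :
  has_sup [set enorm (v *m A^T) | v in [set v : 'rV[R]_n | enorm v <= 1]].
Proof.
split.
  by exists (enorm (0 *m A^T)), 0 => //=; rewrite enorm0.
exists (\sum_(i < m) \sum_(j < n) `|A i j|) => _ [v /= v1 <-].
apply: (le_trans (enorm_le_sum _)); apply: ler_sum => i _.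
rewrite mxE (le_trans (ler_norm_sum _ _ _))//; apply: ler_sum => j _.
rewrite normrM mxE ler_piMl// (le_trans (coord_le_enorm _ _))//.
Qed.

Lemma enorm_mul_trmx m n (A : 'M[R]_(m, n)) (v : 'rV[R]_n) :
  enorm (v *m A^T) <= opnorm A * enorm v.
Proof.
have [/enorm_eq0 ->|v0] := eqVneq (enorm v) 0.
  by rewrite mul0mx !enorm0 mulr0.
have vp : 0 < enorm v by rewrite lt_def v0 enorm_ge0.
rewrite -ler_pdivrMr// mulrC -[(enorm v)^-1]gtr0_norm ?invr_gt0//.
rewrite -enormZ scalemxAl; apply: ub_le_sup.
  by have [] := has_sup_opnorm A.
exists ((enorm v)^-1 *: v) => //=.
by rewrite enormZ gtr0_norm ?invr_gt0// mulVf.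
Qed.

Lemma opnorm_ge0 m n (A : 'M[R]_(m, n)) : 0 <= opnorm A.
Proof.
apply: ub_le_sup; first by have [] := has_sup_opnorm A.
by exists 0 => /=; rewrite ?mul0mx enorm0.
Qed.

Lemma dotp_mulmx m n (A : 'M[R]_(m, n)) (l : 'rV[R]_m) (v : 'rV[R]_n) :
  dotp (l *m A) v = dotp l (v *m A^T).
Proof.
rewrite /dotp; under eq_bigr do rewrite mxE mulr_suml.
rewrite exchange_big /=; apply: eq_bigr => i _.
by rewrite mxE mulr_sumr; apply: eq_bigr => j _; rewrite mxE mulrAC mulrA.
Qed.

(** [opnorm] is defined by the action on columns; the action on rows is its adjoint, and |lA|^2 =
    (l, (lA)A^T) carries the bound over. *)
Lemma enorm_mulmx m n (A : 'M[R]_(m, n)) (l : 'rV[R]_m) :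
  enorm (l *m A) <= opnorm A * enorm l.
Proof.
have [->|v0] := eqVneq (enorm (l *m A)) 0.
  by rewrite mulr_ge0 ?opnorm_ge0 ?enorm_ge0.
have vp : 0 < enorm (l *m A) by rewrite lt_def v0 enorm_ge0.
rewrite -(ler_pM2r vp) -expr2 sqr_enorm dotp_mulmx.
rewrite (le_trans (CauchySchwarz_dotp _ _))//.
rewrite (mulrC (opnorm A)) -mulrA ler_wpM2l ?enorm_ge0//.
exact: enorm_mul_trmx.
Qed.

Lemma enorm_row_le_opnorm m n (A : 'M[R]_(m, n)) i :
  enorm (row i A) <= opnorm A.
Proof.
rewrite rowE (le_trans (enorm_mulmx _ _))//.
suff -> : enorm (delta_mx 0 i : 'rV[R]_m) = 1 by rewrite mulr1.
rewrite /enorm /dotp (bigD1 i)//= big1 ?addr0; last first.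
  by move=> j /negbTE ji; rewrite !mxE/= ji mulr0.
by rewrite !mxE !eqxx/= mulr1 sqrtr1.
Qed.

End operator_norm.

(** * Projection onto a closed convex set *)

Section projection.
Context {R : realType} {n : nat} (X : set 'rV[R]_n).
Hypotheses (clX : closed X) (cvX : convex_set X) (X0 : X !=set0).
Implicit Types x y z u : 'rV[R]_n.

(** A minimiser exists because X may be cut by the closed ball around y through a point of X, which
    leaves a compact set; hence [xget] never returns its default. *)
Lemma euclid_projP y :
  X (euclid_proj X y) /\ forall u, X u -> enorm (y - euclid_proj X y) <= enorm (y - u).
Proof.
have [x0 Xx0] := X0.
pose A := X `&` [set u | enorm (y - u) <= enorm (y - x0)].
have clA : closed A.
  apply: closedI => //.
  rewrite (_ : [set _ | _] = (fun u => enorm (y - u)) @^-1` [set t | t <= enorm (y - x0)])//.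
  apply: closed_comp => [u _|]; last exact: closed_le.
  apply: (continuous_comp (f := fun u => y - u) (g := @enorm R n)).
    by apply: continuousB; [exact: cst_continuous|exact].
  exact: continuous_enorm.
have bA : bounded_set A.
  exists (enorm y + enorm (y - x0)); split; first by rewrite num_real.
  move=> M ltM u [_ /= uy]; apply: (le_trans (norm_le_enorm u)).
  apply: le_trans (ltW ltM).
  have := enormB y (y - u); rewrite opprB addrC subrK.
  by move=> /le_trans; apply; rewrite lerD2l.
have A0 : A !=set0 by exists x0; split => //=.
have [c cA cmin] := EVT_min_rV A0 (bounded_closed_compact bA clA)
  (continuous_subspaceT (fun u => continuous_comp
    (f := fun u => y - u) (g := @enorm R n) (x := u)
    (continuousB (@cst_continuous _ _ y u) (fun A => id))
    (@continuous_enorm _ _ _))).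
apply: (@xgetPex _ 0 [set z | X z /\ forall u, X u -> enorm (y - z) <= enorm (y - u)]).
move: cA; rewrite inE => -[Xc cy].
exists c; split => // u Xu.
have [le|gt] := leP (enorm (y - u)) (enorm (y - x0)).
  by apply: cmin; rewrite inE.
by rewrite (le_trans cy)// ltW.
Qed.

Lemma euclid_proj_in y : X (euclid_proj X y).
Proof. by have [] := euclid_projP y. Qed.

Lemma convex_set_segment x y (t : R) : X x -> X y -> 0 <= t -> t <= 1 ->
  X (x + t *: (y - x)).
Proof.
move=> Xx Xy t0 t1.
(* Convexity is stated for scalars typed in the unit interval, so t is packed with its bounds. *)
have t01 : Itv.spec (Itv.num_sem (R:=R)) (Itv.Real `[0%Z, 1%Z]) t.
  by rewrite /Itv.spec/= /Itv.num_sem num_real/= in_itv/= t0 t1.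
have := @cvX y x (Itv.mk t01) (mem_set Xy) (mem_set Xx).
rewrite inE /conv /=; congr X.
by rewrite /unstable.onem scalerBl scale1r scalerBr addrCA.
Qed.

(** Obtuse angle criterion: were the inner product positive, a small move from the projection
    towards u would come closer to y. *)
Lemma euclid_proj_normal y u : X u ->
  dotp (y - euclid_proj X y) (u - euclid_proj X y) <= 0.
Proof.
move=> Xu; have [Xp pmin] := euclid_projP y.
set p := euclid_proj X y in Xp pmin *.
rewrite leNgt; apply/negP => a0.
set a := dotp _ _ in a0; set b := dotp (u - p) (u - p).
have b0 : 0 <= b := dotp_ge0 _.
have h (t : R) : 0 <= t -> t <= 1 -> 2 * t * a <= t ^+ 2 * b.
  move=> t0 t1.
  have := pmin _ (convex_set_segment Xp Xu t0 t1).
  rewrite -(@ler_pXn2r _ 2) ?nnegrE ?enorm_ge0// !sqr_enorm opprD addrA.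
  rewrite [leRHS]dotpBl (dotpBr (y - p) (y - p)) (dotpBr (t *: _)) !dotpZl !dotpZr.
  rewrite (dotpC (u - p) (y - p)) -/a -/b; nra.
have ab : 0 < a + b by rewrite ltr_wpDr.
(* Any t in (0, 1] with t b < 2 a contradicts [h]; this one stays valid when b = 0. *)
set t := a / (a + b).
have tE : t * (a + b) = a by rewrite divfK// gt_eqF.
have tp : 0 < t by rewrite divr_gt0.
have t1 : t <= 1 by rewrite ler_pdivrMr// mul1r lerDl.
have := h t (ltW tp) t1.
rewrite [2 * t]mulrC -mulrA expr2 -mulrA ler_pM2l// => h'.
by move: (mulr_gt0 tp a0); lra.
Qed.

Lemma euclid_proj_nonexpansive y z :
  enorm (euclid_proj X y - euclid_proj X z) <= enorm (y - z).
Proof.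
have h1 := euclid_proj_normal y (euclid_proj_in z).
have h2 := euclid_proj_normal z (euclid_proj_in y).
set p := euclid_proj X y in h1 h2 *; set q := euclid_proj X z in h1 h2 *.
have [->|v0] := eqVneq (enorm (p - q)) 0; first exact: enorm_ge0.
have vp : 0 < enorm (p - q) by rewrite lt_def v0 enorm_ge0.
rewrite -(ler_pM2r vp) -expr2 sqr_enorm.
apply: le_trans (CauchySchwarz_dotp _ _).
move: h1 h2; rewrite !(dotpBl, dotpBr); lra.
Qed.

Lemma continuous_euclid_proj : continuous (euclid_proj X).
Proof.
by apply: (@lipschitz_enorm_continuous _ _ _ _ 1) => v w; rewrite mul1r euclid_proj_nonexpansive.
Qed.

Lemma euclid_proj_id x : X x -> euclid_proj X x = x.
Proof.
move=> Xx; have [_ /(_ x Xx)] := euclid_projP x.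
rewrite subrr enorm0 => h.
apply/esym/subr0_eq/enorm_eq0/eqP; by rewrite eq_le h enorm_ge0.
Qed.

End projection.

(** * Distance to the normal cone *)

Section normal_cones.
Context {R : realType} {n : nat}.
Implicit Types (X : set 'rV[R]_n) (x v s : 'rV[R]_n).

Lemma euclid_dist_to_le v s S : S s -> euclid_dist_to v S <= enorm (v - s).
Proof.
move=> Ss; apply: ge_inf; last by exists s.
by exists 0 => _ [t _ <-]; exact: enorm_ge0.
Qed.

Lemma euclid_dist_to_ge0 v S : 0 <= euclid_dist_to v S.
Proof.
have [->|/set0P S0] := eqVneq S set0; first by rewrite /euclid_dist_to image_set0 inf0.
apply: lb_le_inf; first by have [s Ss] := S0; exists (enorm (v - s)), s.
by move=> _ [t _ <-]; exact: enorm_ge0.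
Qed.

Lemma neg_normal_cone0 X x : neg_normal_cone X x 0.
Proof. by exists 0; [move=> y _; rewrite dotp0l|rewrite oppr0]. Qed.

Lemma neg_normal_coneZ X x s (a : R) : 0 <= a ->
  neg_normal_cone X x s -> neg_normal_cone X x (a *: s).
Proof.
move=> a0 [v Nv <-]; exists (a *: v); last by rewrite scalerN.
by move=> y Xy; rewrite dotpZl mulr_ge0_le0// Nv.
Qed.

Lemma dist_neg_normal_coneZ X x v w (a : R) : 0 < a ->
  a * euclid_dist_to v (neg_normal_cone X x) <=
  euclid_dist_to (w + a *: v) (neg_normal_cone X x) + enorm w.
Proof.
move=> a0; rewrite -lerBlDr; apply: lb_le_inf.
  by exists (enorm (w + a *: v - 0)), 0 => //; exact: neg_normal_cone0.
move=> _ [s Ns <-]; rewrite lerBlDr.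
have Ns' : neg_normal_cone X x (a^-1 *: s).
  by apply: neg_normal_coneZ => //; rewrite invr_ge0 ltW.
apply: (le_trans (ler_wpM2l (ltW a0) (euclid_dist_to_le v Ns'))).
rewrite -[X in X * _]gtr0_norm// -enormZ scalerBr scalerA divff ?gt_eqF// scale1r.
have -> : a *: v - s = (w + a *: v - s) - w by rewrite -[w + _ - s]addrA addrAC subrr add0r.
exact: enormB.
Qed.

End normal_cones.

(** * First-order expansions along segments *)

Section mean_value.
Context {R : realType} {n : nat}.
Implicit Types (h : 'rV[R]_n -> R) (G : 'rV[R]_n -> 'rV[R]_n) (x y z : 'rV[R]_n).

(** One-variable mean value theorem on the segment. The gradient is a parameter G so that the lemma
    also serves the components of c, whose gradients are the rows of [Jac c]. *)
Lemma line_mean_value h G x y :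
  (forall z, differentiable h z) -> (forall z v, 'D_v h z = dotp (G z) v) ->
  exists t : R, [/\ 0 <= t, t <= 1 &
    h y - h x = dotp (G (x + t *: (y - x))) (y - x)].
Proof.
move=> dh dG; pose p (t : R) := x + t *: (y - x).
have dp t : is_derive t (1 : R) (h \o p : R -> R) (dotp (G (p t)) (y - x)).
  have pE : (fun s : R => s^-1 *: (((h \o p : R -> R) \o shift t) (s *: (1 : R)) - (h \o p) t)) =
            (fun s : R => s^-1 *: ((h \o shift (p t)) (s *: (y - x)) - h (p t))).
    apply/funext => s; congr (_ *: (h _ - _)).
    by rewrite /p /= [_%:A]mulr1 scalerDl addrCA.
  split; first by rewrite /derivable pE; exact: diff_derivable.
  by rewrite /derive pE; exact: dG.
have cp : {within `[0 : R, 1], continuous (h \o p : R -> R)}.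
  apply: continuous_subspaceT => t; apply: differentiable_continuous.
  by apply/derivable1_diffP; case: (dp t).
have [t] := @MVT_segment R (h \o p) (fun t => dotp (G (p t)) (y - x)) 0 1 ler01 (fun t _ => dp t) cp.
rewrite in_itv/= => /andP[t0 t1] ht; exists t; split => //.
by move: ht; rewrite /p scale1r scale0r addr0 subr0 mulr1 (addrC x) subrK.
Qed.

(** The mean value point lies within |y - x| of x, which gives the constant L instead of the sharp L
    / 2; only the order matters later. *)
Lemma lipschitz_gradient_expansion h G (L : R) x y : 0 <= L ->
  (forall z, differentiable h z) -> (forall z v, 'D_v h z = dotp (G z) v) ->
  (forall y z, enorm (G y - G z) <= L * enorm (y - z)) ->
  `|h y - h x - dotp (G x) (y - x)| <= L * enorm (y - x) ^+ 2.
Proof.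
move=> L0 dh dG GL; have [t [t0 t1 ->]] := line_mean_value x y dh dG.
rewrite -dotpBl (le_trans (CauchySchwarz_dotp_norm _ _))//.
rewrite expr2 mulrA ler_wpM2r ?enorm_ge0// (le_trans (GL _ _))//.
rewrite ler_wpM2l// addrC addKr enormZ ger0_norm//.
by rewrite ler_piMl ?enorm_ge0.
Qed.

Lemma bounded_gradient_lipschitz h G (M : R) x y :
  (forall z, differentiable h z) -> (forall z v, 'D_v h z = dotp (G z) v) ->
  (forall z, enorm (G z) <= M) ->
  `|h y - h x| <= M * enorm (y - x).
Proof.
move=> dh dG GM; have [t [t0 t1 ->]] := line_mean_value x y dh dG.
rewrite (le_trans (CauchySchwarz_dotp_norm _ _))//.
by rewrite ler_wpM2r ?enorm_ge0.
Qed.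

Lemma derive_grad h z v : differentiable h z -> 'D_v h z = dotp (grad h z) v.
Proof.
move=> dh; rewrite deriveE// [X in 'd h z X]row_sum_delta linear_sum /dotp /=.
by apply: eq_bigr => j _; rewrite linearZ/= -deriveE// mxE mulrC.
Qed.

Lemma derive_coord_Jac m (c : 'rV[R]_n -> 'rV[R]_m) z v i : differentiable c z ->
  'D_v (fun y => c y 0 i) z = dotp (row i (Jac c z)) v.
Proof.
move=> dc.
have dcoord : differentiable (fun M : 'rV[R]_m => M 0 i) (c z).
  exact: differentiable_coord.
rewrite (_ : (fun y => c y 0 i) = (fun M : 'rV[R]_m => M 0 i) \o c)//.
rewrite deriveE; last exact: differentiable_comp.
pose ci (M : 'rV[R]_m) : R := M 0 i.
have ci_lin : linear ci by move=> k u w; rewrite /ci !mxE.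
pose L : {linear 'rV[R]_m -> R} := HB.pack ci (GRing.isLinear.Build _ _ _ _ _ ci_lin).
rewrite diff_comp// [X in _ \o X]/= (_ : (fun M : 'rV[R]_m => M 0 i) = L)// diff_lin; last exact: coord_continuous.
rewrite /= -deriveE// deriveEjacobian// /ci mxE; apply: eq_bigr => j _.
by rewrite !mxE mulrC.
Qed.

End mean_value.

(** * Measurability and independence *)

Section measurable_vectors.
Context {R : realType}.
Local Notation borel n := (g_sigma_algebraType (@open 'rV[R]_n)).

Definition coord_measurable {d} {T : measurableType d} {n} (u : T -> 'rV[R]_n) :=
  forall j, measurable_fun setT (fun t => u t 0 j).

Context {d} {T : measurableType d}.

(* Every open set is a countable union of boxes with rational centers. *)
Lemma coord_measurable_borel n (u : T -> 'rV[R]_n) : coord_measurable u ->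
  measurable_fun setT (u : T -> borel n).
Proof.
move=> mu; apply: (@measurability _ _ _ (borel n) setT u (@open 'rV[R]_n)) => //.
move=> _ [U oU <-]; rewrite setTI.
pose box (q : 'rV[rat]_n * nat) :=
  [set v : 'rV[R]_n | forall j, `|ratr (q.1 0 j) - v 0 j| < q.2.+1%:R^-1].
(* Boxes not contained in U contribute nothing, so the union may range over the whole countable type
   of centers and radii. *)
pose F q := if `[< box q `<=` U >] then u @^-1` box q else set0.
rewrite (_ : _ @^-1` U = \bigcup_q F q).
  apply: countable_bigcupT_measurable; first exact: countableP.
  move=> q; rewrite /F; case: asboolP => // _.
  rewrite (_ : _ @^-1` _ = \bigcap_(j in [set: 'I_n])
      ((fun t => `|ratr (q.1 0 j) - u t 0 j|) @^-1` `]-oo, q.2.+1%:R^-1[)).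
    apply: fin_bigcap_measurable => // j _.
    rewrite -[X in measurable X]setTI.
    have mf : measurable_fun setT (fun t => `|ratr (q.1 0 j) - u t 0 j|).
      by apply: measurableT_comp => //; exact: measurable_funB.
    by apply: mf => //; exact: measurable_itv.
  apply/seteqP; split => t /= h j; first by move=> _; rewrite /= in_itv/=; exact: h.
  by have := h j I; rewrite /= in_itv.
apply/seteqP; split => [t /= Ut|t [q _]]; last first.
  by rewrite /F; case: asboolP => // + h; apply.
have /nbhs_ballP[e /= e0 eU] : nbhs (u t) U by exact: open_nbhs_nbhs.
have [k ke] : exists k : nat, k.+1%:R^-1 < e / 2.
  exists (Num.truncn (e / 2)^-1); rewrite invf_plt ?posrE ?divr_gt0//.
  exact: truncnS_gt.
have rate j : exists r : rat, `|ratr r - u t 0 j| < k.+1%:R^-1.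
  have : u t 0 j - k.+1%:R^-1 < u t 0 j + k.+1%:R^-1.
    by rewrite ltrD2l (@lt_trans _ _ 0)// ?oppr_lt0 invr_gt0.
  move=> /rat_in_itvoo[r]; rewrite in_itv/= => /andP[r1 r2].
  by exists r; rewrite ltr_distl r1 r2.
pose q := \row_j (projT1 (cid (rate j))) : 'rV[rat]_n.
have qP j : `|ratr (q 0 j) - u t 0 j| < k.+1%:R^-1.
  by rewrite mxE; case: cid.
exists (q, k) => //; rewrite /F; case: asboolP => [_|]; first exact: qP.
case => v /= vb; apply: eU; split => // i j; rewrite ord1 /ball/=.
rewrite -(subrKA (ratr (q 0 j))) (le_lt_trans (ler_normD _ _))//.
rewrite [ltRHS](splitr e); apply: ltrD; apply: lt_trans ke; last exact: vb.
by rewrite distrC; exact: qP.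
Qed.

Lemma continuous_borel n (h : 'rV[R]_n -> R) : continuous h ->
  measurable_fun [set: borel n] h.
Proof.
move=> ch; apply: (measurability _ (RGenOpens.measurableE R)).
move=> _ [_ [a [b ->]] <-]; rewrite setTI; apply: sub_sigma_algebra.
by move/continuousP: ch; apply; exact: interval_open.
Qed.

Lemma measurable_comp_continuous n (h : 'rV[R]_n -> R) (u : T -> 'rV[R]_n) :
  continuous h -> coord_measurable u -> measurable_fun setT (fun t => h (u t)).
Proof.
by move=> ch mu; apply: (measurableT_comp (continuous_borel ch)); exact: coord_measurable_borel.
Qed.

Lemma coord_measurable_continuous n k (h : 'rV[R]_n -> 'rV[R]_k) (u : T -> 'rV[R]_n) :
  continuous h -> coord_measurable u -> coord_measurable (fun t => h (u t)).
Proof.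
move=> ch mu j; apply: (measurable_comp_continuous (h := fun y => h y 0 j)) => // y.
by apply: (continuous_comp (f := h) (g := fun M : 'rV[R]_k => M 0 j)); [exact: ch|exact: coord_continuous].
Qed.

Lemma jointly_measurable_comp n d' (S : measurableType d') (h : 'rV[R]_n -> S -> R)
    (u : T -> 'rV[R]_n) (s : T -> S) :
  jointly_measurable h -> coord_measurable u -> measurable_fun setT s ->
  measurable_fun setT (fun t => h (u t) (s t)).
Proof.
move=> mh mu ms.
apply: (measurableT_comp (f := fun p : borel n * S => h p.1 p.2) (g := fun t => (u t : borel n, s t))) => //.
by apply: measurable_fun_pair => //; exact: coord_measurable_borel.
Qed.

Lemma jointly_measurable_section n (h : 'rV[R]_n -> T -> R) (y : 'rV[R]_n) :
  jointly_measurable h -> measurable_fun setT (h y).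
Proof.
move=> mh; apply: (measurableT_comp (f := fun p : borel n * T => h p.1 p.2) (g := fun t => (y : borel n, t))) => //.
exact: measurable_fun_pair.
Qed.

Lemma coord_measurable_cst n (v : 'rV[R]_n) : coord_measurable (fun _ : T => v).
Proof. by move=> j; exact: measurable_cst. Qed.

Lemma coord_measurableD n (u v : T -> 'rV[R]_n) :
  coord_measurable u -> coord_measurable v -> coord_measurable (fun t => u t + v t).
Proof.
move=> mu mv j; under eq_fun do rewrite mxE.
exact: measurable_funD.
Qed.

Lemma coord_measurableZ n (a : T -> R) (u : T -> 'rV[R]_n) :
  measurable_fun setT a -> coord_measurable u -> coord_measurable (fun t => a t *: u t).
Proof.
move=> ma mu j; under eq_fun do rewrite mxE.
exact: measurable_funM.
Qed.

Lemma coord_measurableN n (u : T -> 'rV[R]_n) :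
  coord_measurable u -> coord_measurable (fun t => - u t).
Proof.
move=> mu j; under eq_fun do rewrite mxE.
exact: measurable_funN.
Qed.

Lemma coord_measurableB n (u v : T -> 'rV[R]_n) :
  coord_measurable u -> coord_measurable v -> coord_measurable (fun t => u t - v t).
Proof. by move=> mu mv; apply: coord_measurableD => //; exact: coord_measurableN. Qed.

Lemma coord_measurable_sum n (I : Type) (s : seq I) (u : I -> T -> 'rV[R]_n) :
  (forall i, coord_measurable (u i)) -> coord_measurable (fun t => \sum_(i <- s) u i t).
Proof.
move=> mu j; under eq_fun do rewrite summxE.
by apply: measurable_sum => i; exact: mu.
Qed.

Lemma measurable_sqr_enorm n (u : T -> 'rV[R]_n) :
  coord_measurable u -> measurable_fun setT (fun t => enorm (u t) ^+ 2).
Proof.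
move=> mu; under eq_fun do rewrite sqr_enorm_sum.
by apply: measurable_sum => j; exact: measurable_funX.
Qed.

Lemma measurable_enorm n (u : T -> 'rV[R]_n) :
  coord_measurable u -> measurable_fun setT (fun t => enorm (u t)).
Proof. exact/measurable_comp_continuous/continuous_enorm. Qed.

End measurable_vectors.

Section lower_integral.
Local Open Scope ereal_scope.
Context {d} {T : measurableType d} {R : realType} (mu : {measure set T -> \bar R}).

(* The integral of a nonnegative function is a supremum over simple functions,
   so no measurability is needed here. *)
Lemma ge0_le_lower_integral (f g : T -> \bar R) :
  (forall t, 0 <= f t) -> (forall t, f t <= g t) ->
  \int[mu]_t f t <= \int[mu]_t g t.
Proof.
move=> f0 fg; rewrite !ge0_integralTE//; last by move=> t; exact: le_trans (fg t).
apply: le_ereal_sup => _ [h /= hf <-].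
by exists h => //= t; exact: le_trans (fg t).
Qed.

End lower_integral.

(** * Integrating a fresh sample with the past frozen *)

Section independent_fubini.
Context {dO dT} {Omega : measurableType dO} {T : measurableType dT} {R : realType}
  (P : probability Omega R) (Y : {RV P >-> T}) (G : set (set Omega)).
Hypotheses (Gm : G `<=` measurable) (GI : setI_closed G) (GT : G setT).
Hypothesis indep : forall A D, G A -> measurable D ->
  P (A `&` Y @^-1` D) = (P A * P (Y @^-1` D))%E.
Local Notation Omega_G := (g_sigma_algebraType G).

Let measurable_G (A : set Omega) : @measurable _ Omega_G A -> measurable A.
Proof. exact: (smallest_sub (sigma_algebra_measurable Omega) Gm). Qed.

(** For fixed D both sides are finite measures in A that agree on the intersection-stable family G,
    hence on the sigma-algebra it generates. *)
Lemma independent_sigma (A : set Omega) D :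
  @measurable _ Omega_G A -> measurable D ->
  P (A `&` Y @^-1` D) = (P A * P (Y @^-1` D))%E.
Proof.
move=> mA mD.
have mYD : measurable (Y @^-1` D) by rewrite -[X in measurable X]setTI; exact: measurable_funPT.
have PYD : P (Y @^-1` D) \is a fin_num by exact: fin_num_measure.
have r0 : 0 <= fine (P (Y @^-1` D)) by exact: fine_ge0.
pose m1 := mrestr P mYD.
pose m2 := mscale (NngNum r0) P.
have /= := @g_sigma_algebra_measure_unique _ _ _ G Gm (fun=> setT) (fun=> GT) _ m1 m2 GI _ _ A mA.
rewrite /m1 /m2 /mrestr /mscale/= fineK// => ->//.
- by rewrite muleC.
- by rewrite bigcup_const.
- by move=> D' GD'; rewrite indep// muleC.
- by move=> k; rewrite setTI ltey_eq PYD.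
Qed.

(** This replaces conditional expectation: by independence the joint law of the identity, seen as a
    map into the coarser space [Omega_G], and Y is a product measure, and Tonelli applies. *)
Lemma independent_fubini (h : Omega_G * T -> \bar R) :
  measurable_fun [set: Omega_G * T] h -> (forall p, (0 <= h p)%E) ->
  (\int[P]_w h (w, Y w) = \int[P]_w \int[distribution P Y]_b h (w, b))%E.
Proof.
move=> mh h0.
have midG : measurable_fun setT (id : Omega -> Omega_G).
  by move=> _ A mA; rewrite setTI; exact: measurable_G.
pose idG : {mfun Omega >-> Omega_G} := HB.pack (id : Omega -> Omega_G) (isMeasurableFun.Build _ _ _ _ _ midG).
have mphi : measurable_fun setT (fun w => (idG w, Y w)).
  by apply: measurable_fun_pair => //; exact: measurable_funPT.
pose phi : {mfun Omega >-> (Omega_G * T)%type} := HB.pack (fun w => (idG w, Y w)) (isMeasurableFun.Build _ _ _ _ _ mphi).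
transitivity (\int[distribution P phi]_p h p)%E.
  by rewrite [RHS]ge0_integral_distribution.
transitivity (\int[(distribution P idG \x distribution P Y)%E]_p h p)%E.
  apply: eq_measure_integral => A mA _; apply/esym.
  apply: product_measure_unique => // A1 A2 mA1 mA2.
  exact: independent_sigma.
rewrite fubini_tonelli1//.
rewrite [LHS]ge0_integral_distribution//; first exact: measurable_fun_fubini_tonelli_F.
by move=> w; exact: integral_ge0.
Qed.

End independent_fubini.

(** * Means and second moments *)

Section nonnegative_expectation.
Context {d} {T : measurableType d} {R : realType} (mu : probability T R).
Implicit Types (h k : T -> R).

Definition nnL1 h := [/\ measurable_fun setT h, forall t, 0 <= h t &
  (\int[mu]_t (h t)%:E < +oo)%E].

(** Real valued, so that the estimates below are real arithmetic; [nnL1] is what makes [fine]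
    lossless. *)
Definition mean h : R := fine (\int[mu]_t (h t)%:E)%E.

Lemma nnL1_integrable h : nnL1 h -> mu.-integrable setT (EFin \o h).
Proof.
move=> [mh h0 hoo]; apply/integrableP; split; first exact/measurable_EFinP.
by under eq_integral do rewrite /= ger0_norm//.
Qed.

Lemma meanE h : nnL1 h -> (\int[mu]_t (h t)%:E = (mean h)%:E)%E.
Proof.
move=> [mh h0 hoo]; rewrite /mean fineK// ge0_fin_numE//.
by apply: integral_ge0 => t _; rewrite lee_fin.
Qed.

Lemma mean_ge0 h : (forall t, 0 <= h t) -> 0 <= mean h.
Proof.
by move=> h0; apply: fine_ge0; apply: integral_ge0 => t _; rewrite lee_fin.
Qed.

Lemma nnL1_le h (r : R) : measurable_fun setT h -> (forall t, 0 <= h t) ->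
  (\int[mu]_t (h t)%:E <= r%:E)%E -> nnL1 h.
Proof. by move=> mh h0 hr; split => //; rewrite (le_lt_trans hr)// ltry. Qed.

Lemma mean_le h (r : R) : nnL1 h -> (\int[mu]_t (h t)%:E <= r%:E)%E -> mean h <= r.
Proof. by move=> nh; rewrite meanE// lee_fin. Qed.

Lemma nnL1D h k : nnL1 h -> nnL1 k -> nnL1 (fun t => h t + k t).
Proof.
move=> nh nk; have [mh h0 hoo] := nh; have [mk k0 koo] := nk; split.
- exact: measurable_funD.
- by move=> t; rewrite addr_ge0.
- under eq_integral do rewrite EFinD.
  rewrite ge0_integralD//; last 4 first.
  + by move=> t _; rewrite lee_fin.
  + exact/measurable_EFinP.
  + by move=> t _; rewrite lee_fin.
  + exact/measurable_EFinP.
  exact: lte_add_pinfty.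
Qed.

Lemma meanD h k : nnL1 h -> nnL1 k -> mean (fun t => h t + k t) = mean h + mean k.
Proof.
move=> nh nk; exact: (RintegralD measurableT (nnL1_integrable nh) (nnL1_integrable nk)).
Qed.

Lemma nnL1Z h (a : R) : 0 <= a -> nnL1 h -> nnL1 (fun t => a * h t).
Proof.
move=> a0 nh; have [mh h0 hoo] := nh; split.
- exact: measurable_funM.
- by move=> t; rewrite mulr_ge0.
- under eq_integral do rewrite EFinM.
  rewrite ge0_integralZl_EFin//; last 2 first.
  + by move=> t _; rewrite lee_fin.
  + exact/measurable_EFinP.
  by rewrite meanE// -EFinM ltry.
Qed.

Lemma meanZ h (a : R) : nnL1 h -> mean (fun t => a * h t) = a * mean h.
Proof. by move=> nh; exact: (RintegralZl a measurableT (nnL1_integrable nh)). Qed.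

Lemma nnL1_cst (a : R) : 0 <= a -> nnL1 (fun=> a).
Proof.
by move=> a0; split => //; rewrite integral_cst//= probability_setT mule1 ltry.
Qed.

Lemma mean_cst (a : R) : mean (fun=> a) = a.
Proof. by rewrite /mean integral_cst//= probability_setT mule1. Qed.

Lemma nnL1_mono h k : measurable_fun setT h -> (forall t, 0 <= h t) ->
  {ae mu, forall t, h t <= k t} -> nnL1 k -> nnL1 h.
Proof.
move=> mh h0 hk [mk k0 koo]; split => //; apply: le_lt_trans koo.
apply: ae_ge0_le_integral => //.
- by move=> t _; rewrite lee_fin.
- exact/measurable_EFinP.
- by move=> t _; rewrite lee_fin.
- exact/measurable_EFinP.
- by apply: filterS hk => t htk _; rewrite lee_fin.
Qed.

Lemma ae_le_mean h k : nnL1 h -> nnL1 k -> {ae mu, forall t, h t <= k t} ->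
  mean h <= mean k.
Proof.
move=> nh nk hk; rewrite -lee_fin -!meanE//.
have [mh h0 hoo] := nh; have [mk k0 koo] := nk.
apply: ae_ge0_le_integral => //.
- by move=> t _; rewrite lee_fin.
- exact/measurable_EFinP.
- by move=> t _; rewrite lee_fin.
- exact/measurable_EFinP.
- by apply: filterS hk => t htk _; rewrite lee_fin.
Qed.

Lemma le_mean h k : nnL1 h -> nnL1 k -> (forall t, h t <= k t) -> mean h <= mean k.
Proof. by move=> nh nk hk; apply: ae_le_mean => //; exact: aeW. Qed.

Lemma nnL1_sum (I : Type) (s : seq I) (h : I -> T -> R) :
  (forall i, nnL1 (h i)) -> nnL1 (fun t => \sum_(i <- s) h i t).
Proof.
move=> nh; elim: s => [|i s ih].
  by under eq_fun do rewrite big_nil; exact: nnL1_cst.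
by under eq_fun do rewrite big_cons; exact: nnL1D.
Qed.

Lemma mean_sum (I : Type) (s : seq I) (h : I -> T -> R) :
  (forall i, nnL1 (h i)) ->
  mean (fun t => \sum_(i <- s) h i t) = \sum_(i <- s) mean (h i).
Proof.
move=> nh; elim: s => [|i s ih].
  by under eq_fun do rewrite big_nil; rewrite mean_cst big_nil.
under eq_fun do rewrite big_cons.
by rewrite meanD ?ih ?big_cons//; exact: nnL1_sum.
Qed.

End nonnegative_expectation.

Section mean_square.
Context {d} {T : measurableType d} {R : realType} (mu : probability T R) {n : nat}.
Implicit Types (U V W : T -> 'rV[R]_n) (u v a g : 'rV[R]_n).

Definition sqL2 U := coord_measurable U /\ nnL1 mu (fun t => enorm (U t) ^+ 2).

Definition mean_sq U : R := mean mu (fun t => enorm (U t) ^+ 2).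

Definition has_mean U u := forall j, (\int[mu]_t (U t 0 j)%:E = (u 0 j)%:E)%E.

Lemma sqL2_dom U h : coord_measurable U ->
  {ae mu, forall t, enorm (U t) ^+ 2 <= h t} -> nnL1 mu h -> sqL2 U.
Proof.
move=> mU Uh nh; split => //; apply: nnL1_mono Uh nh; first exact: measurable_sqr_enorm.
by move=> t; exact: sqr_ge0.
Qed.

Lemma mean_sq_dom U h : sqL2 U -> nnL1 mu h ->
  {ae mu, forall t, enorm (U t) ^+ 2 <= h t} -> mean_sq U <= mean mu h.
Proof. by move=> [_ nU] nh Uh; exact: ae_le_mean. Qed.

Lemma mean_sq_ge0 U : 0 <= mean_sq U.
Proof. by apply: mean_ge0 => t; exact: sqr_ge0. Qed.

Lemma sqL2D U V : sqL2 U -> sqL2 V -> sqL2 (fun t => U t + V t).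
Proof.
move=> [mU nU] [mV nV].
apply: (@sqL2_dom _ (fun t => 2 * enorm (U t) ^+ 2 + 2 * enorm (V t) ^+ 2)).
- exact: coord_measurableD.
- by apply: aeW => t; exact: sqr_enormD.
- by apply: nnL1D; exact: nnL1Z.
Qed.

Lemma mean_sqD U V : sqL2 U -> sqL2 V ->
  mean_sq (fun t => U t + V t) <= 2 * mean_sq U + 2 * mean_sq V.
Proof.
move=> lU lV; have [_ nU] := lU; have [_ nV] := lV.
rewrite /mean_sq -!meanZ// -meanD//; [|exact: nnL1Z..].
apply: le_mean; [by have [] := sqL2D lU lV|by apply: nnL1D; exact: nnL1Z|].
by move=> t; exact: sqr_enormD.
Qed.

Lemma sqL2Z (c : R) U : sqL2 U -> sqL2 (fun t => c *: U t).
Proof.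
move=> [mU nU]; split; first by apply: coord_measurableZ.
under eq_fun do rewrite enormZ exprMn.
by apply: nnL1Z => //; exact: sqr_ge0.
Qed.

Lemma mean_sqZ (c : R) U : sqL2 U -> mean_sq (fun t => c *: U t) = c ^+ 2 * mean_sq U.
Proof.
move=> [mU nU]; rewrite /mean_sq -meanZ//; congr mean; apply/funext => t.
by rewrite enormZ exprMn real_normK ?num_real.
Qed.

Lemma sqL2N U : sqL2 U -> sqL2 (fun t => - U t).
Proof.
by move=> lU; under eq_fun do rewrite -scaleN1r; exact: sqL2Z.
Qed.

Lemma sqL2B U V : sqL2 U -> sqL2 V -> sqL2 (fun t => U t - V t).
Proof. by move=> lU lV; apply: sqL2D => //; exact: sqL2N. Qed.

Lemma sqL2_cst a : sqL2 (fun=> a).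
Proof. by split; [exact: coord_measurable_cst|apply: nnL1_cst; exact: sqr_ge0]. Qed.

Lemma sqL2_sum (I : Type) (s : seq I) (U : I -> T -> 'rV[R]_n) :
  (forall i, sqL2 (U i)) -> sqL2 (fun t => \sum_(i <- s) U i t).
Proof.
move=> lU; elim: s => [|i s ih].
  by under eq_fun do rewrite big_nil; exact: sqL2_cst.
by under eq_fun do rewrite big_cons; exact: sqL2D.
Qed.

(** Cauchy-Schwarz against the constant 1, by induction on the list. *)
Lemma sqr_sum_le (I : Type) (s : seq I) (a : I -> R) :
  (\sum_(i <- s) a i) ^+ 2 <= (size s)%:R * \sum_(i <- s) a i ^+ 2.
Proof.
elim: s => [|i s ih]; first by rewrite !big_nil expr0n/= mulr0.
rewrite !big_cons /=; set A := \sum_(_ <- s) a _ in ih *; set S := \sum_(_ <- s) _ in ih *.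
have [sz|sn0] := eqVneq (size s)%:R (0 : R); first rewrite sz in ih.
  have A0 : A = 0 by apply/eqP; rewrite -sqrf_eq0 eq_le sqr_ge0 andbT (le_trans ih)// mul0r.
  have S0 : 0 <= S by apply: sumr_ge0 => j _; exact: sqr_ge0.
  rewrite A0 addr0.
  have : 1 <= (size s).+1%:R :> R by rewrite ler1n.
  by have := sqr_ge0 (a i); nra.
have sp : 0 < (size s)%:R :> R by rewrite lt_def sn0 ler0n.
rewrite -natr1 sqrrD.
have h : 2 * a i * A <= (size s)%:R * a i ^+ 2 + S.
  rewrite -(ler_pM2l sp).
  by have := sqr_ge0 ((size s)%:R * a i - A); move: ih; nra.
by rewrite -[a i * A *+ 2]mulr_natl; move: ih h; nra.
Qed.

Lemma mean_sq_sum (I : Type) (s : seq I) (U : I -> T -> 'rV[R]_n) (r : R) :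
  (forall i, sqL2 (U i)) -> (forall i, mean_sq (U i) <= r) ->
  mean_sq (fun t => \sum_(i <- s) U i t) <= (size s)%:R ^+ 2 * r.
Proof.
move=> lU Ur.
have nU i : nnL1 mu (fun t => enorm (U i t) ^+ 2) by case: (lU i).
have nS : nnL1 mu (fun t => (size s)%:R * \sum_(i <- s) enorm (U i t) ^+ 2).
  by apply: nnL1Z => //; exact: nnL1_sum.
apply: (@le_trans _ _ (mean mu (fun t => (size s)%:R * \sum_(i <- s) enorm (U i t) ^+ 2))).
  apply: le_mean => //; first by case: (sqL2_sum s lU).
  move=> t; apply: le_trans (sqr_sum_le _ _).
  by rewrite lerXn2r ?nnegrE ?enorm_ge0 ?sumr_ge0 ?enorm_sum// => i _; exact: enorm_ge0.
rewrite meanZ; last exact: nnL1_sum.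
rewrite mean_sum// expr2 -mulrA ler_wpM2l//.
rewrite (le_trans (ler_sum _ (fun i _ => Ur i)))//.
by rewrite big_const_seq count_predT iter_addr_0 mulr_natl.
Qed.

Lemma mean_sq_sum_ord k (U : 'I_k -> T -> 'rV[R]_n) (r : R) :
  (forall i, sqL2 (U i)) -> (forall i, mean_sq (U i) <= r) ->
  mean_sq (fun t => \sum_(i < k) U i t) <= k%:R ^+ 2 * r.
Proof.
move=> lU Ur; have := mean_sq_sum (index_enum 'I_k) lU Ur.
suff -> : size (index_enum 'I_k) = k by [].
by rewrite -sum1_size sum1_card card_ord.
Qed.

Lemma mean_sqD3 U V W : sqL2 U -> sqL2 V -> sqL2 W ->
  mean_sq (fun t => U t + V t + W t) <= 3 * (mean_sq U + mean_sq V + mean_sq W).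
Proof.
move=> lU lV lW; have [_ nU] := lU; have [_ nV] := lV; have [_ nW] := lW.
have nUV : nnL1 mu (fun t => enorm (U t) ^+ 2 + enorm (V t) ^+ 2) by exact: nnL1D.
have nUVW : nnL1 mu (fun t => enorm (U t) ^+ 2 + enorm (V t) ^+ 2 + enorm (W t) ^+ 2) by exact: nnL1D.
rewrite /mean_sq -!meanD// -meanZ//.
apply: le_mean; [by have [] := sqL2D (sqL2D lU lV) lW|exact: nnL1Z|] => t.
have h1 := enormD (U t + V t) (W t); have h2 := enormD (U t) (V t).
have h3 := enorm_ge0 (U t + V t + W t).
apply: (@le_trans _ _ ((enorm (U t) + enorm (V t) + enorm (W t)) ^+ 2)).
  by rewrite lerXn2r ?nnegrE ?addr_ge0 ?enorm_ge0//; lra.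
move: (enorm (U t)) (enorm (V t)) (enorm (W t)) => p q r.
have := sqr_ge0 (p - q); have := sqr_ge0 (q - r); have := sqr_ge0 (p - r); nra.
Qed.

Lemma sqL2_coord_integrable U j : sqL2 U -> mu.-integrable setT (fun t => (U t 0 j)%:E).
Proof.
move=> [mU nU].
have n1 : nnL1 mu (fun t => 1 + enorm (U t) ^+ 2) by apply: nnL1D => //; exact: nnL1_cst.
apply: (le_integrable _ _ _ (nnL1_integrable n1)) => //.
  by apply/measurable_EFinP; exact: mU.
move=> t _ /=; rewrite lee_fin [leRHS]ger0_norm; last by rewrite addr_ge0 ?sqr_ge0.
have := coord_le_enorm (U t) j; have := enorm_ge0 (U t).
by have := sqr_ge0 (enorm (U t) - 1); nra.
Qed.

Lemma has_meanD U V u v : sqL2 U -> sqL2 V -> has_mean U u -> has_mean V v ->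
  has_mean (fun t => U t + V t) (u + v).
Proof.
move=> lU lV hU hV j; under eq_integral do rewrite mxE EFinD.
by rewrite integralD ?hU ?hV ?mxE//; exact: sqL2_coord_integrable.
Qed.

Lemma has_meanZ U u (c : R) : sqL2 U -> has_mean U u ->
  has_mean (fun t => c *: U t) (c *: u).
Proof.
move=> lU hU j; under eq_integral do rewrite mxE EFinM.
by rewrite integralZl ?hU ?mxE//; exact: sqL2_coord_integrable.
Qed.

Lemma has_meanB U V u v : sqL2 U -> sqL2 V -> has_mean U u -> has_mean V v ->
  has_mean (fun t => U t - V t) (u - v).
Proof.
move=> lU lV hU hV; apply: has_meanD => //; first exact: sqL2N.
have := has_meanZ (-1) lV hV; rewrite scaleN1r.
by rewrite (_ : (fun t => -1 *: V t) = (fun t => - V t))//; apply/funext => t; rewrite scaleN1r.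
Qed.

Lemma has_mean_sum (I : Type) (s : seq I) (U : I -> T -> 'rV[R]_n) (u : I -> 'rV[R]_n) :
  (forall i, sqL2 (U i)) -> (forall i, has_mean (U i) (u i)) ->
  has_mean (fun t => \sum_(i <- s) U i t) (\sum_(i <- s) u i).
Proof.
move=> lU hU; elim: s => [|i s ih].
  under [X in has_mean X]eq_fun do rewrite big_nil.
  by move=> j; rewrite big_nil mxE integral0_eq.
rewrite big_cons; under [X in has_mean X]eq_fun do rewrite big_cons.
by apply: has_meanD => //; exact: sqL2_sum.
Qed.

(** Pythagoras: the cross term 2 (a, U - u) integrates to zero coordinate by coordinate. *)
Lemma mean_sq_center U u a : sqL2 U -> has_mean U u ->
  mean_sq (fun t => a + (U t - u)) = enorm a ^+ 2 + mean_sq (fun t => U t - u).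
Proof.
move=> lU hU.
have lc : sqL2 (fun t => U t - u) by apply: sqL2B => //; exact: sqL2_cst.
have nc : nnL1 mu (fun t => enorm (U t - u) ^+ 2) by case: lc.
have icoord j : mu.-integrable setT (fun t => ((a 0 j) * (U t - u) 0 j)%:E).
  by under eq_fun do rewrite EFinM; apply: integrableZl => //; exact: sqL2_coord_integrable.
have icross : mu.-integrable setT (EFin \o (fun t => dotp a (U t - u))).
  rewrite (_ : _ \o _ = fun t => (\sum_(j < n) ((a 0 j) * (U t - u) 0 j)%:E)%E); last first.
    by apply/funext => t; rewrite /= sumEFin.
  exact: integrable_sum.
have zcross : (\int[mu]_t (dotp a (U t - u))%:E)%E = 0%E.
  under eq_integral do rewrite /dotp -sumEFin.
  rewrite integral_sum// big1// => j _.
  under eq_integral do rewrite EFinM.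
  rewrite integralZl//; last exact: sqL2_coord_integrable.
  rewrite (has_meanB lU (sqL2_cst u) hU (_ : has_mean _ u)).
    by rewrite subrr mxE mule0.
  by move=> i; rewrite integral_cst//= probability_setT mule1.
rewrite /mean_sq.
have -> : (fun t => enorm (a + (U t - u)) ^+ 2) =
  (fun t => (enorm a ^+ 2 + enorm (U t - u) ^+ 2) + 2 * dotp a (U t - u)).
  apply/funext => t; move: (U t - u) => y.
  by rewrite sqr_enorm dotpDl !dotpDr -!sqr_enorm (dotpC y a); ring.
have nac : nnL1 mu (fun t => enorm a ^+ 2 + enorm (U t - u) ^+ 2).
  by apply: nnL1D => //; apply: nnL1_cst; exact: sqr_ge0.
rewrite /mean [X in fine X](_ : _ = (\int[mu]_t ((enorm a ^+ 2 + enorm (U t - u) ^+ 2)%:E + (2 * dotp a (U t - u))%:E))%E); last first.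
  by apply: eq_integral => t _; rewrite EFinD.
have i2 : mu.-integrable setT (fun t => (2 * dotp a (U t - u))%:E).
  by under eq_fun do rewrite EFinM; exact: integrableZl.
rewrite integralD//; last exact: (nnL1_integrable nac).
have -> : (\int[mu]_t (2 * dotp a (U t - u))%:E)%E = 0%E.
  under eq_integral do rewrite EFinM.
  by rewrite integralZl// zcross mule0.
rewrite adde0 -/(mean mu (fun t => enorm a ^+ 2 + enorm (U t - u) ^+ 2)) meanD ?mean_cst//.
by apply: nnL1_cst; exact: sqr_ge0.
Qed.

Lemma mean_sq_variance U u : sqL2 U -> has_mean U u ->
  mean_sq (fun t => U t - u) <= mean_sq U.
Proof.
move=> lU hU; have := mean_sq_center u lU hU.
have -> : (fun t => u + (U t - u)) = U by apply/funext => t; rewrite addrC subrK.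
by move=> ->; rewrite lerDr sqr_ge0.
Qed.

(* The recursive-momentum (STORM) estimator [U + (1 - al) (g - V)] of [u]: the
   fluctuation is centered, so the cross term with the old error vanishes. *)
Lemma momentum_variance U V u v g (al : R) : 0 <= al -> al <= 1 ->
  sqL2 U -> sqL2 V -> has_mean U u -> has_mean V v ->
  mean_sq (fun t => U t + (1 - al) *: (g - V t) - u) <=
  (1 - al) * enorm (g - v) ^+ 2 + 2 * al ^+ 2 * mean_sq (fun t => U t - u)
  + 2 * mean_sq (fun t => U t - V t).
Proof.
move=> al0 al1 lU lV hU hV.
have lUV : sqL2 (fun t => U t - V t) by exact: sqL2B.
have hUV : has_mean (fun t => U t - V t) (u - v) by exact: has_meanB.
pose W t := al *: U t + (1 - al) *: (U t - V t).
pose w := al *: u + (1 - al) *: (u - v).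
have lW : sqL2 W by apply: sqL2D; exact: sqL2Z.
have hW : has_mean W w by apply: has_meanD; [exact: sqL2Z..|exact: has_meanZ|exact: has_meanZ].
have -> : (fun t => U t + (1 - al) *: (g - V t) - u) =
          (fun t => (1 - al) *: (g - v) + (W t - w)).
  by apply/funext => t; apply/rowP => j; rewrite /W /w !mxE; ring.
rewrite mean_sq_center// enormZ exprMn real_normK ?num_real// -addrA lerD//.
  by rewrite ler_wpM2r ?sqr_ge0// expr2 ler_piMr ?subr_ge0// gerBl.
have -> : (fun t => W t - w) =
    (fun t => al *: (U t - u) + (1 - al) *: ((U t - V t) - (u - v))).
  by apply/funext => t; apply/rowP => j; rewrite /W /w !mxE; ring.
have lUu : sqL2 (fun t => U t - u) by apply: sqL2B => //; exact: sqL2_cst.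
have lUVu : sqL2 (fun t => U t - V t - (u - v)) := sqL2B lUV (sqL2_cst (u - v)).
apply: (le_trans (mean_sqD _ _)); [exact: sqL2Z..|].
rewrite !mean_sqZ// mulrA lerD// ler_pM2l//.
apply: le_trans (mean_sq_variance lUV hUV).
by rewrite ler_piMl ?mean_sq_ge0// expr_le1 ?subr_ge0// gerBl.
Qed.

End mean_square.

(** * Moments of the stochastic gradient oracle *)

Section marginal_law.
Context {d d'} {T : measurableType d} {S : measurableType d'} {R : realType}
  (mu : probability T R) (nu : probability S R) (phi : T -> S).
Hypotheses (mphi : measurable_fun setT phi)
  (law : forall A, measurable A -> mu (phi @^-1` A) = nu A).

Lemma ge0_integral_law (h : S -> \bar R) : measurable_fun setT h ->
  (forall s, (0 <= h s)%E) -> (\int[mu]_t h (phi t) = \int[nu]_s h s)%E.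
Proof.
move=> mh h0; pose phi' : {mfun T >-> S} := HB.pack phi (isMeasurableFun.Build _ _ _ _ _ mphi).
transitivity (\int[distribution mu phi']_s h s)%E.
  by rewrite [RHS]ge0_integral_distribution.
by apply: eq_measure_integral => A mA _; exact: law.
Qed.

Lemma integrable_law (h : S -> R) : nu.-integrable setT (EFin \o h) ->
  mu.-integrable setT (EFin \o (h \o phi)).
Proof.
move=> /integrableP[mh hoo]; apply/integrableP; split.
  exact: (measurableT_comp mh).
rewrite (@ge0_integral_law (fun s => `|(h s)%:E|%E))//.
exact: measurableT_comp.
Qed.

Lemma integral_law (h : S -> R) : nu.-integrable setT (EFin \o h) ->
  (\int[mu]_t (h (phi t))%:E = \int[nu]_s (h s)%:E)%E.
Proof.
move=> ih; pose phi' : {mfun T >-> S} := HB.pack phi (isMeasurableFun.Build _ _ _ _ _ mphi).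
transitivity (\int[distribution mu phi']_s (h s)%:E)%E.
  rewrite [RHS]integral_distribution//; last exact: integrable_law.
  by have /integrableP[] := ih.
by apply: eq_measure_integral => A mA _; exact: law.
Qed.

Lemma ae_law (Q : S -> Prop) : {ae nu, forall s, Q s} -> {ae mu, forall t, Q (phi t)}.
Proof.
move=> [N [mN N0 QN]]; exists (phi @^-1` N); split.
- by rewrite -[X in measurable X]setTI; exact: mphi.
- by rewrite -N0; exact: law.
- by move=> t /= h; apply: QN.
Qed.

Lemma nnL1_law (h : S -> R) : nnL1 nu h -> nnL1 mu (h \o phi).
Proof.
move=> [mh h0 hoo]; split => [|t|].
- exact: measurableT_comp.
- exact: h0.
- by rewrite (ge0_integral_law (h := EFin \o h))//; exact/measurable_EFinP.
Qed.

Lemma mean_law (h : S -> R) : nnL1 nu h -> mean mu (h \o phi) = mean nu h.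
Proof.
move=> [mh h0 hoo]; rewrite /mean (ge0_integral_law (h := EFin \o h))//.
exact/measurable_EFinP.
Qed.

End marginal_law.

(** * Products of independent samples *)

Section product_law.
Context {d d'} {T : measurableType d} {S : measurableType d'} {R : realType}
  (mu : probability T R) (nu : probability S R) (phi1 phi2 : T -> S).
Hypotheses (mphi1 : measurable_fun setT phi1) (mphi2 : measurable_fun setT phi2)
  (law : forall A1 A2, measurable A1 -> measurable A2 ->
    mu [set t | A1 (phi1 t) /\ A2 (phi2 t)] = (nu A1 * nu A2)%E).

(** The joint law of the two variables is nu x nu, so Fubini factorises the integral. This is what
    two independent copies of zeta buy: the penalty term of the oracle multiplies a gradient sample
    by a value sample. *)
Lemma integral_independent_prod (h1 h2 : S -> R) :
  nu.-integrable setT (EFin \o h1) -> nu.-integrable setT (EFin \o h2) ->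
  (\int[mu]_t (h1 (phi1 t) * h2 (phi2 t))%:E =
   \int[nu]_s (h1 s)%:E * \int[nu]_s (h2 s)%:E)%E.
Proof.
move=> i1 i2; have /integrableP[m1 oo1] := i1; have /integrableP[m2 oo2] := i2.
have mphi : measurable_fun setT (fun t => (phi1 t, phi2 t)) by exact: measurable_fun_pair.
pose phi : {mfun T >-> (S * S)%type} := HB.pack (fun t => (phi1 t, phi2 t))
  (isMeasurableFun.Build _ _ _ _ _ mphi).
have lawphi A : measurable A -> distribution mu phi A = (nu \x nu)%E A.
  by move=> mA; apply/esym; apply: product_measure_unique.
pose h (p : S * S) := h1 p.1 * h2 p.2.
have mh : measurable_fun setT h.
  apply: measurable_funM.
  + by apply: (measurableT_comp (f := h1)) => //; exact/measurable_EFinP.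
  + by apply: (measurableT_comp (f := h2)) => //; exact/measurable_EFinP.
have meh : measurable_fun setT (EFin \o h) by exact/measurable_EFinP.
have fin2 : (\int[nu]_s `|(h2 s)%:E| \is a fin_num)%E.
  by rewrite ge0_fin_numE//; exact: integral_ge0.
have ih : (nu \x nu)%E.-integrable setT (EFin \o h).
  apply/(integrable12ltyP _ _ meh).
  have step s1 : (\int[nu]_s2 `|(h (s1, s2))%:E| = `|(h1 s1)%:E| * \int[nu]_s2 `|(h2 s2)%:E|)%E.
    rewrite -ge0_integralZl//; last exact: measurableT_comp.
    by apply: eq_integral => s2 _; rewrite -abseM.
  rewrite (eq_integral _ _ (fun s1 _ => step s1)) ge0_integralZr//; [|exact: measurableT_comp|exact: integral_ge0].
  by rewrite lte_mul_pinfty// ?integral_ge0// ge0_fin_numE// integral_ge0.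
transitivity (\int[distribution mu phi]_p (EFin \o h) p)%E.
  rewrite integral_distribution//; apply/integrableP; split.
    by apply: measurableT_comp => //; exact: measurable_funPT.
  have /integrableP[_] := ih; apply: le_lt_trans.
  rewrite -(@ge0_integral_distribution _ _ _ _ _ mu phi (fun p => `|(h p)%:E|%E))//.
    by rewrite (eq_measure_integral (nu \x nu)%E)// => A mA _; exact: lawphi.
  exact: measurableT_comp.
rewrite (eq_measure_integral (nu \x nu)%E); last by move=> A mA _; exact: lawphi.
rewrite -integral12_prod_meas1//.
have step s1 : fubini_F nu (EFin \o h) s1 = ((h1 s1)%:E * \int[nu]_s2 (h2 s2)%:E)%E.
  by rewrite -integralZl//; apply: eq_integral => s2 _; rewrite -EFinM.
rewrite (eq_integral _ _ (fun s1 _ => step s1)); have -> : (\int[nu]_s (h2 s)%:E = (fine (\int[nu]_s (h2 s)%:E))%:E)%E.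
  by rewrite fineK//; exact: integrable_fin_num.
by rewrite integralZr.
Qed.

End product_law.

(** * Bias, noise and Lipschitz bounds of the oracle for a fixed point and multiplier *)

Section oracle.
Context {R : realType} {d m : nat} {dXi dZ : measure_display}
  {Xi : measurableType dXi} {Z : measurableType dZ}
  (Pxi : probability Xi R) (Pzeta : probability Z R)
  (mu : probability (Xi * Z * Z)%type R)
  (F : 'rV[R]_d -> 'rV[R]_d) (c : 'rV[R]_d -> 'rV[R]_m) (J : 'rV[R]_d -> 'M[R]_(m, d))
  (gft : 'rV[R]_d -> Xi -> 'rV[R]_d) (ct : 'rV[R]_d -> Z -> 'rV[R]_m)
  (gct : 'rV[R]_d -> Z -> 'M[R]_(m, d))
  (Lgf Lgc Lc sigma_f Cgct Cct : R).
Implicit Types (rho : R) (lam : 'rV[R]_m).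
Hypotheses (Cgct0 : 0 <= Cgct) (Cct0 : 0 <= Cct).
Hypotheses
  (law_xi : forall A, measurable A -> mu [set b | A b.1.1] = Pxi A)
  (law_zeta : forall A1 A2, measurable A1 -> measurable A2 ->
     mu [set b | A1 b.1.2 /\ A2 b.2] = (Pzeta A1 * Pzeta A2)%E)
  (mct : forall i, jointly_measurable (fun y z => ct y z 0 i))
  (mgft : forall j, jointly_measurable (fun y xi => gft y xi 0 j))
  (mgct : forall i j, jointly_measurable (fun y z => gct y z i j))
  (Ect : forall y i, (\int[Pzeta]_z (ct y z 0 i)%:E = (c y 0 i)%:E)%E)
  (Egft : forall y j, (\int[Pxi]_xi (gft y xi 0 j)%:E = (F y 0 j)%:E)%E)
  (Egct : forall y i j, (\int[Pzeta]_z (gct y z i j)%:E = (J y i j)%:E)%E)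
  (gft_lip : forall y z, (\int[Pxi]_xi (enorm (gft y xi - gft z xi) ^+ 2)%:E
     <= (Lgf ^+ 2 * enorm (y - z) ^+ 2)%:E)%E)
  (gct_lip : forall i y z, (\int[Pzeta]_t (enorm (row i (gct y t) - row i (gct z t)) ^+ 2)%:E
     <= (Lgc ^+ 2 * enorm (y - z) ^+ 2)%:E)%E)
  (ct_lip : forall i y z, (\int[Pzeta]_t ((ct y t 0 i - ct z t 0 i) ^+ 2)%:E
     <= (Lc ^+ 2 * enorm (y - z) ^+ 2)%:E)%E)
  (gft_var : forall y, (\int[Pxi]_xi (enorm (gft y xi - F y) ^+ 2)%:E <= (sigma_f ^+ 2)%:E)%E)
  (gct_bd : forall i y, {ae Pzeta, forall t, enorm (row i (gct y t)) <= Cgct})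
  (ct_bd : forall i y, {ae Pzeta, forall t, `|ct y t 0 i| <= Cct}).

Let mxi : measurable_fun setT (fun b : Xi * Z * Z => b.1.1).
Proof. exact: (measurableT_comp measurable_fst measurable_fst). Qed.

Let mz1 : measurable_fun setT (fun b : Xi * Z * Z => b.1.2).
Proof. exact: (measurableT_comp measurable_snd measurable_fst). Qed.

Let mz2 : measurable_fun setT (fun b : Xi * Z * Z => b.2).
Proof. exact: measurable_snd. Qed.

Let law_z1 A : measurable A -> mu ((fun b => b.1.2) @^-1` A) = Pzeta A.
Proof.
move=> mA; have := law_zeta mA measurableT.
rewrite probability_setT mule1 => <-; congr (mu _).
by apply/seteqP; split => [t|t []].
Qed.

Let law_z2 A : measurable A -> mu ((fun b => b.2) @^-1` A) = Pzeta A.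
Proof.
move=> mA; have := law_zeta measurableT mA.
rewrite probability_setT mul1e => <-; congr (mu _).
by apply/seteqP; split => [t|t []].
Qed.

Let mct1 y i : measurable_fun setT (fun t => ct y t 0 i).
Proof. exact: (jointly_measurable_section y (mct i)). Qed.

Let mgft1 y : coord_measurable (gft y).
Proof. move=> j; exact: (jointly_measurable_section y (mgft j)). Qed.

Let mgct1 y i : coord_measurable (fun t => row i (gct y t)).
Proof.
move=> j; under eq_fun do rewrite mxE.
exact: (jointly_measurable_section y (mgct i j)).
Qed.

Let gft_b y (b : Xi * Z * Z) := gft y b.1.1.
Let row_b y i (b : Xi * Z * Z) := row i (gct y b.1.2).
Let ct_b y i (b : Xi * Z * Z) := ct y b.2 0 i.

Let mgft_b y : coord_measurable (gft_b y).
Proof. by move=> j; apply: (measurableT_comp (mgft1 y j) mxi). Qed.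

Let mrow_b y i : coord_measurable (row_b y i).
Proof. by move=> j; apply: (measurableT_comp (mgct1 y i j) mz1). Qed.

Let mct_b y i : measurable_fun setT (ct_b y i).
Proof. by apply: (measurableT_comp (mct1 y i) mz2). Qed.

Let row_b_bd y i : {ae mu, forall b, enorm (row_b y i b) <= Cgct}.
Proof. exact: (ae_law mz1 law_z1 (gct_bd i y)). Qed.

Let ct_b_bd y i : {ae mu, forall b, `|ct_b y i b| <= Cct}.
Proof. exact: (ae_law mz2 law_z2 (ct_bd i y)). Qed.

Let sqL2_gftB y z : sqL2 mu (fun b => gft_b y b - gft_b z b) /\
  mean_sq mu (fun b => gft_b y b - gft_b z b) <= Lgf ^+ 2 * enorm (y - z) ^+ 2.
Proof.
have mh : coord_measurable (fun xi => gft y xi - gft z xi) by exact: coord_measurableB.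
have nh : nnL1 Pxi (fun xi => enorm (gft y xi - gft z xi) ^+ 2).
  apply: nnL1_le (gft_lip y z); first exact: measurable_sqr_enorm.
  by move=> t; exact: sqr_ge0.
split; first split; first exact: coord_measurableB.
- exact: (nnL1_law mxi law_xi nh).
- rewrite /mean_sq (mean_law mxi law_xi nh); exact: mean_le (gft_lip y z).
Qed.

Let sqL2_gft_center y : sqL2 mu (fun b => gft_b y b - F y) /\
  mean_sq mu (fun b => gft_b y b - F y) <= sigma_f ^+ 2.
Proof.
have mh : coord_measurable (fun xi => gft y xi - F y).
  by apply: coord_measurableB => //; exact: coord_measurable_cst.
have nh : nnL1 Pxi (fun xi => enorm (gft y xi - F y) ^+ 2).
  apply: nnL1_le (gft_var y); first exact: measurable_sqr_enorm.
  by move=> t; exact: sqr_ge0.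
split; first split.
- by apply: coord_measurableB => //; exact: coord_measurable_cst.
- exact: (nnL1_law mxi law_xi nh).
- rewrite /mean_sq (mean_law mxi law_xi nh); exact: mean_le (gft_var y).
Qed.

Let sqL2_rowB i y z : sqL2 mu (fun b => row_b y i b - row_b z i b) /\
  mean_sq mu (fun b => row_b y i b - row_b z i b) <= Lgc ^+ 2 * enorm (y - z) ^+ 2.
Proof.
have mh : coord_measurable (fun t => row i (gct y t) - row i (gct z t)).
  by apply: coord_measurableB.
have nh : nnL1 Pzeta (fun t => enorm (row i (gct y t) - row i (gct z t)) ^+ 2).
  apply: nnL1_le (gct_lip i y z); first exact: measurable_sqr_enorm.
  by move=> t; exact: sqr_ge0.
split; first split; first exact: coord_measurableB.
- exact: (nnL1_law mz1 law_z1 nh).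
- rewrite /mean_sq (mean_law mz1 law_z1 nh); exact: mean_le (gct_lip i y z).
Qed.

Let nnL1_ctB i y z : nnL1 mu (fun b => (ct_b y i b - ct_b z i b) ^+ 2) /\
  mean mu (fun b => (ct_b y i b - ct_b z i b) ^+ 2) <= Lc ^+ 2 * enorm (y - z) ^+ 2.
Proof.
have nh : nnL1 Pzeta (fun t => (ct y t 0 i - ct z t 0 i) ^+ 2).
  apply: nnL1_le (ct_lip i y z); first exact/measurable_funX/measurable_funB.
  by move=> t; exact: sqr_ge0.
split; first exact: (nnL1_law mz2 law_z2 nh).
rewrite (mean_law mz2 law_z2 nh); exact: mean_le (ct_lip i y z).
Qed.

Let sqL2_gft y : sqL2 mu (gft_b y).
Proof.
have -> : gft_b y = (fun b => (gft_b y b - F y) + F y).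
  by apply/funext => b; rewrite subrK.
by apply: sqL2D; [case: (sqL2_gft_center y)|exact: sqL2_cst].
Qed.

Let sqL2_bounded (U : Xi * Z * Z -> 'rV[R]_d) (M : R) : 0 <= M -> coord_measurable U ->
  {ae mu, forall b, enorm (U b) <= M} -> sqL2 mu U /\ mean_sq mu U <= M ^+ 2.
Proof.
move=> M0 mU UM.
have UM2 : {ae mu, forall b, enorm (U b) ^+ 2 <= M ^+ 2}.
  by apply: filterS UM => b h; rewrite lerXn2r ?nnegrE ?enorm_ge0.
have nM : nnL1 mu (fun=> M ^+ 2) by apply: nnL1_cst; exact: sqr_ge0.
have lU : sqL2 mu U by exact: sqL2_dom UM2 nM.
by split => //; rewrite -(mean_cst mu (M ^+ 2)); exact: mean_sq_dom.
Qed.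

(** Multiplier and penalty parts use the same row sample; merged this way, the oracle is affine in
    (lam, rho). *)
Let term (rho : R) y (lam : 'rV[R]_m) i (b : Xi * Z * Z) :=
  (lam 0 i + rho * ct_b y i b) *: row_b y i b.

Let mterm rho y lam i : coord_measurable (term rho y lam i).
Proof.
apply: coord_measurableZ => //; apply: measurable_funD => //.
exact: measurable_funM.
Qed.

Let term_bd rho y lam i (M : R) : 0 <= rho -> `|lam 0 i| <= M ->
  sqL2 mu (term rho y lam i) /\
  mean_sq mu (term rho y lam i) <= ((M + rho * Cct) * Cgct) ^+ 2.
Proof.
move=> r0 lM; have M0 : 0 <= M := le_trans (normr_ge0 _) lM.
apply: sqL2_bounded => //; first by rewrite mulr_ge0// addr_ge0// mulr_ge0.
apply: filterS2 (ct_b_bd y i) (row_b_bd y i) => b h1 h2.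
rewrite enormZ ler_pM// ?enorm_ge0// (le_trans (ler_normD _ _))// lerD//.
by rewrite normrM (ger0_norm r0) ler_wpM2l.
Qed.

Let QgradE rho y lam b :
  Qgrad gft ct gct rho y lam b = gft_b y b + \sum_(i < m) term rho y lam i b.
Proof.
rewrite /Qgrad -addrA; congr (_ + _).
by rewrite scaler_sumr -big_split /=; apply: eq_bigr => i _; rewrite scalerA -scalerDl.
Qed.

Let sqL2_term_sum rho y lam : 0 <= rho -> sqL2 mu (fun b => \sum_(i < m) term rho y lam i b).
Proof.
by move=> r0; apply: sqL2_sum => i; case: (@term_bd rho y lam i `|lam 0 i|).
Qed.

Lemma sqL2_Qgrad rho y lam : 0 <= rho -> sqL2 mu (Qgrad gft ct gct rho y lam).
Proof.
move=> r0; rewrite (_ : Qgrad _ _ _ _ _ _ = fun b => gft_b y b + \sum_(i < m) term rho y lam i b).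
  by apply: sqL2D => //; exact: sqL2_term_sum.
by apply/funext => b; exact: QgradE.
Qed.

(** The gradient of the augmented Lagrangian when F and J are the gradient of f and the Jacobian of
    c. *)
Definition mean_Qgrad (rho : R) y (lam : 'rV[R]_m) := F y + (lam + rho *: c y) *m J y.

Let integrable_bounded (h : Z -> R) (M : R) : measurable_fun setT h ->
  {ae Pzeta, forall t, `|h t| <= M} -> Pzeta.-integrable setT (EFin \o h).
Proof.
move=> mh hM.
have n1 : nnL1 Pzeta (fun t => `|h t|).
  have M0 : 0 <= Num.max 0 M by rewrite le_max lexx.
  apply: (@nnL1_mono _ _ _ _ _ (fun=> Num.max 0 M)) => //; first exact: measurableT_comp.
    by apply: filterS hM => t ht; rewrite le_max ht orbT.
  exact: nnL1_cst.
apply: (le_integrable _ _ _ (nnL1_integrable n1)) => //; first exact/measurable_EFinP.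
by move=> t _ /=; rewrite lee_fin normr_id.
Qed.

Let igct y i j : Pzeta.-integrable setT (EFin \o (fun t => gct y t i j)).
Proof.
apply: (@integrable_bounded _ Cgct).
  by have := mgct1 y i j; under eq_fun do rewrite mxE.
by apply: filterS (gct_bd i y) => t h; have := le_trans (coord_le_enorm _ j) h; rewrite mxE.
Qed.

Let has_mean_term rho y lam i :
  has_mean mu (term rho y lam i) ((lam 0 i + rho * c y 0 i) *: row i (J y)).
Proof.
move=> j.
have ict : Pzeta.-integrable setT (EFin \o (fun t => ct y t 0 i)).
  exact: (integrable_bounded (mct1 y i) (ct_bd i y)).
have igct_b := integrable_law mz1 law_z1 (igct y i j).
have mprod : mu.-integrable setT (fun b => ((gct y b.1.2 i j) * (ct y b.2 0 i))%:E).
  have n1 : nnL1 mu (fun b => `|gct y b.1.2 i j * ct y b.2 0 i|).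
    apply: (@nnL1_mono _ _ _ _ _ (fun=> Cgct * Cct)) => //.
    - apply: measurableT_comp => //; apply: measurable_funM => //.
        by have := mrow_b y i j; under eq_fun do rewrite mxE.
      exact: mct_b.
    - apply: filterS2 (ct_b_bd y i) (row_b_bd y i) => b h1 h2.
      rewrite normrM ler_pM//.
      by have := le_trans (coord_le_enorm _ j) h2; rewrite mxE.
    - by apply: nnL1_cst; rewrite mulr_ge0.
  apply: (le_integrable _ _ _ (nnL1_integrable n1)) => //.
    apply/measurable_EFinP; apply: measurable_funM => //; last exact: mct_b.
    by have := mrow_b y i j; under eq_fun do rewrite mxE.
  by move=> t _ /=; rewrite lee_fin normr_id.
transitivity (\int[mu]_b ((lam 0 i)%:E * (gct y b.1.2 i j)%:E + rho%:E * (gct y b.1.2 i j * ct y b.2 0 i)%:E))%E.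
  apply: eq_integral => b _; rewrite /term /row_b /ct_b !mxE -!EFinM -EFinD; congr (_%:E); ring.
rewrite integralD//; [|exact: integrableZl|exact: integrableZl].
rewrite !integralZl//.
rewrite (integral_law mz1 law_z1 (igct y i j)) Egct.
rewrite (integral_independent_prod mz1 mz2 law_zeta (igct y i j) ict) Egct Ect.
by rewrite !mxE -!EFinM -EFinD; congr (_%:E); ring.
Qed.

Lemma has_mean_Qgrad rho y lam : 0 <= rho ->
  has_mean mu (Qgrad gft ct gct rho y lam) (mean_Qgrad rho y lam).
Proof.
move=> r0; rewrite (_ : Qgrad _ _ _ _ _ _ = fun b => gft_b y b + \sum_(i < m) term rho y lam i b); last first.
  by apply/funext => b; exact: QgradE.
have -> : mean_Qgrad rho y lam = F y + \sum_(i < m) ((lam 0 i + rho * c y 0 i) *: row i (J y)).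
  rewrite /mean_Qgrad; congr (_ + _); rewrite mulmx_sum_row.
  by apply: eq_bigr => i _; rewrite !mxE.
apply: has_meanD => //; first exact: sqL2_term_sum.
- move=> j; have i1 : Pxi.-integrable setT (EFin \o (fun xi => gft y xi 0 j)).
    have lF : sqL2 Pxi (gft y).
      have -> : gft y = (fun xi => (gft y xi - F y) + F y).
        by apply/funext => xi; rewrite subrK.
      apply: sqL2D; last exact: sqL2_cst.
      have mg : coord_measurable (fun xi => gft y xi - F y).
        by apply: coord_measurableB => //; exact: coord_measurable_cst.
      split => //; apply: nnL1_le (gft_var y); first exact: measurable_sqr_enorm.
      by move=> t; exact: sqr_ge0.
    exact: sqL2_coord_integrable.
  by rewrite (integral_law mxi law_xi i1) Egft.
- apply: has_mean_sum => i; last exact: has_mean_term.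
  by case: (@term_bd rho y lam i `|lam 0 i|).
Qed.

(** The source of the constant [Ltilde]: the objective, multiplier and penalty parts are split with
    a factor 3, the m summands with m^2, and the product in the penalty part with a factor 2. For M
    = |lam_1| + 4 gamma the bound is 4 Ltilde^2 rho^2 |y - z|^2. *)
Lemma Qgrad_lipschitz (rho : R) y z lam (M : R) : 1 <= rho -> (forall i, `|lam 0 i| <= M) -> 0 <= M ->
  mean_sq mu (fun b => Qgrad gft ct gct rho y lam b - Qgrad gft ct gct rho z lam b) <=
  4 * (3 / 4 * Lgf ^+ 2 + 3 / 4 * m%:R ^+ 2 * M ^+ 2 * Lgc ^+ 2
       + 3 / 2 * m%:R ^+ 2 * (Cct ^+ 2 * Lgc ^+ 2 + Cgct ^+ 2 * Lc ^+ 2))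
    * rho ^+ 2 * enorm (y - z) ^+ 2.
Proof.
move=> r1 lM M0.
pose D := enorm (y - z) ^+ 2.
have D0 : 0 <= D by exact: sqr_ge0.
have [lU eU] := sqL2_gftB y z.
pose V b := \sum_(i < m) (lam 0 i *: (row_b y i b - row_b z i b)).
(* Discrete product rule for the difference of value times row. *)
pose Wi i b := ct_b y i b *: (row_b y i b - row_b z i b) + (ct_b y i b - ct_b z i b) *: row_b z i b.
pose W b := rho *: \sum_(i < m) Wi i b.
have lVi i : sqL2 mu (fun b => lam 0 i *: (row_b y i b - row_b z i b)).
  by apply: sqL2Z; case: (sqL2_rowB i y z).
have lV : sqL2 mu V by exact: sqL2_sum.
have eV : mean_sq mu V <= m%:R ^+ 2 * (M ^+ 2 * (Lgc ^+ 2 * D)).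
  apply: (mean_sq_sum_ord lVi) => i.
  have [lr er] := sqL2_rowB i y z.
  rewrite mean_sqZ// ler_pM ?sqr_ge0 ?mean_sq_ge0//.
  by rewrite -[leLHS]real_normK ?num_real// lerXn2r ?nnegrE.
have lWi i : sqL2 mu (Wi i) /\ mean_sq mu (Wi i) <= 2 * (Cct ^+ 2 * (Lgc ^+ 2 * D)) + 2 * (Cgct ^+ 2 * (Lc ^+ 2 * D)).
  have [[mr nr] er] := sqL2_rowB i y z; have [nc ec] := nnL1_ctB i y z.
  have n1 : nnL1 mu (fun b => Cct ^+ 2 * enorm (row_b y i b - row_b z i b) ^+ 2).
    by apply: nnL1Z => //; exact: sqr_ge0.
  have n2 : nnL1 mu (fun b => Cgct ^+ 2 * (ct_b y i b - ct_b z i b) ^+ 2).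
    by apply: nnL1Z => //; exact: sqr_ge0.
  have m1 : coord_measurable (fun b => ct_b y i b *: (row_b y i b - row_b z i b)).
    exact: coord_measurableZ.
  have m2 : coord_measurable (fun b => (ct_b y i b - ct_b z i b) *: row_b z i b).
    by apply: coord_measurableZ => //; exact: measurable_funB.
  have a1 : {ae mu, forall b, enorm (ct_b y i b *: (row_b y i b - row_b z i b)) ^+ 2 <=
      Cct ^+ 2 * enorm (row_b y i b - row_b z i b) ^+ 2}.
    apply: filterS (ct_b_bd y i) => b h.
    by rewrite enormZ exprMn ler_wpM2r ?sqr_ge0// lerXn2r ?nnegrE.
  have a2 : {ae mu, forall b, enorm ((ct_b y i b - ct_b z i b) *: row_b z i b) ^+ 2 <=
      Cgct ^+ 2 * (ct_b y i b - ct_b z i b) ^+ 2}.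
    apply: filterS (row_b_bd z i) => b h.
    rewrite enormZ exprMn mulrC real_normK ?num_real// ler_wpM2r ?sqr_ge0//.
    by rewrite lerXn2r ?nnegrE ?enorm_ge0.
  have l1 := sqL2_dom m1 a1 n1; have l2 := sqL2_dom m2 a2 n2.
  split; first exact: sqL2D.
  apply: (le_trans (mean_sqD l1 l2)); apply: lerD; rewrite ler_pM2l//.
    apply: (le_trans (mean_sq_dom l1 n1 a1)).
    by rewrite meanZ// ler_wpM2l ?sqr_ge0.
  apply: (le_trans (mean_sq_dom l2 n2 a2)).
  by rewrite meanZ// ler_wpM2l ?sqr_ge0.
have lsW : sqL2 mu (fun b => \sum_(i < m) Wi i b) by apply: sqL2_sum => i; case: (lWi i).
have lW : sqL2 mu W by exact: sqL2Z.
have eW : mean_sq mu W <= rho ^+ 2 * (m%:R ^+ 2 * (2 * (Cct ^+ 2 * (Lgc ^+ 2 * D)) + 2 * (Cgct ^+ 2 * (Lc ^+ 2 * D)))).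
  rewrite mean_sqZ// ler_wpM2l ?sqr_ge0//.
  by apply: mean_sq_sum_ord => i; case: (lWi i).
have -> : (fun b => Qgrad gft ct gct rho y lam b - Qgrad gft ct gct rho z lam b) =
          (fun b => (gft_b y b - gft_b z b) + V b + W b).
  apply/funext => b; rewrite !QgradE opprD addrACA -[RHS]addrA; congr (_ + _).
  rewrite /V /W scaler_sumr -sumrB -big_split /=; apply: eq_bigr => i _.
  by apply/rowP => j; rewrite /term /Wi !mxE; ring.
apply: (le_trans (mean_sqD3 lU lV lW)).
have r2 : 1 <= rho ^+ 2 by rewrite expr_ge1// (le_trans ler01).
rewrite -/D in eU *.
apply: (@le_trans _ _ (3 * (rho ^+ 2 * (Lgf ^+ 2 * D) + rho ^+ 2 * (m%:R ^+ 2 * (M ^+ 2 * (Lgc ^+ 2 * D)))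
  + rho ^+ 2 * (m%:R ^+ 2 * (2 * (Cct ^+ 2 * (Lgc ^+ 2 * D)) + 2 * (Cgct ^+ 2 * (Lc ^+ 2 * D))))))).
  rewrite ler_pM2l//; apply: lerD eW; apply: lerD.
    by apply: (le_trans eU); rewrite ler_peMl// mulr_ge0 ?sqr_ge0.
  apply: (le_trans eV); rewrite ler_peMl//; apply: mulr_ge0; first exact: sqr_ge0.
  by apply: mulr_ge0; [exact: sqr_ge0|apply: mulr_ge0 => //; exact: sqr_ge0].
by rewrite le_eqVlt; apply/orP; left; apply/eqP; field.
Qed.

(** The objective part contributes its variance; the constraint part is bounded almost surely, and
    its variance is at most its second moment. *)
Lemma Qgrad_noise (rho : R) y lam (M : R) : 1 <= rho -> (forall i, `|lam 0 i| <= M) -> 0 <= M ->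
  mean_sq mu (fun b => Qgrad gft ct gct rho y lam b - mean_Qgrad rho y lam) <=
  2 * (sigma_f ^+ 2 + (m%:R * ((M + Cct) * Cgct)) ^+ 2) * rho ^+ 2.
Proof.
move=> r1 lM M0; have r0 : 0 <= rho := le_trans ler01 r1.
have [l1 e1] := sqL2_gft_center y.
pose V b := \sum_(i < m) term rho y lam i b.
pose v := \sum_(i < m) ((lam 0 i + rho * c y 0 i) *: row i (J y)).
have lVi i : sqL2 mu (term rho y lam i) by case: (term_bd y r0 (lM i)).
have lV : sqL2 mu V by exact: sqL2_sum.
have hV : has_mean mu V v by apply: has_mean_sum => // i; exact: has_mean_term.
have -> : (fun b => Qgrad gft ct gct rho y lam b - mean_Qgrad rho y lam) =
    (fun b => (gft_b y b - F y) + (V b - v)).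
  apply/funext => b; rewrite QgradE /mean_Qgrad opprD addrACA; congr (_ + (_ - _)).
  by rewrite mulmx_sum_row; apply: eq_bigr => i _; rewrite !mxE.
have lVv : sqL2 mu (fun b => V b - v) := sqL2B lV (sqL2_cst _ v).
apply: (le_trans (mean_sqD l1 lVv)).
rewrite mulrDr mulrDl lerD//.
  rewrite -mulrA ler_pM2l// (le_trans e1)// ler_peMr ?sqr_ge0//.
  by rewrite expr_ge1.
rewrite -mulrA ler_pM2l// (le_trans (mean_sq_variance lV hV))//.
have hr i : mean_sq mu (term rho y lam i) <= ((M + rho * Cct) * Cgct) ^+ 2 by case: (term_bd y r0 (lM i)).
rewrite (le_trans (mean_sq_sum_ord lVi hr))//.
rewrite -!exprMn lerXn2r ?nnegrE ?mulr_ge0 ?addr_ge0 ?mulr_ge0//.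
rewrite -!mulrA ler_wpM2l// mulrCA [leRHS]mulrCA [X in X <= _]mulrC [leRHS]mulrC.
rewrite mulrC [leRHS]mulrC.
rewrite (mulrC Cgct) mulrA ler_wpM2r//; nra.
Qed.

(** By affinity in (lam, rho), changing both at a fixed point leaves a sum of [term]s with the
    increments as parameters. *)
Lemma Qgrad_drift rho rho' y lam lam' (dl dr : R) : 0 <= rho -> 0 <= dl -> 0 <= dr ->
  rho' = rho + dr -> (forall i, `|lam' 0 i - lam 0 i| <= dl) ->
  mean_sq mu (fun b => Qgrad gft ct gct rho' y lam' b - Qgrad gft ct gct rho y lam b) <=
  (m%:R * ((dl + dr * Cct) * Cgct)) ^+ 2.
Proof.
move=> r0 dl0 dr0 r'E hl.
have hl' i : `|(lam' - lam) 0 i| <= dl by rewrite !mxE.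
have -> : (fun b => Qgrad gft ct gct rho' y lam' b - Qgrad gft ct gct rho y lam b) =
    (fun b => \sum_(i < m) term dr y (lam' - lam) i b).
  apply/funext => b; rewrite !QgradE opprD addrACA subrr add0r -sumrB.
  by apply: eq_bigr => i _; apply/rowP => j; rewrite /term r'E !mxE; ring.
by rewrite exprMn; apply: mean_sq_sum_ord => i; case: (term_bd y dr0 (hl' i)).
Qed.

End oracle.

(** * The step-size schedule and the Lyapunov recursion *)

Section logarithms.
Context {R : realType}.

Lemma expRN_ge_exp (x : R) n : x <= 1 -> (1 - x) ^+ n <= expR (- (n%:R * x)).
Proof.
move=> x1; rewrite -mulrN expRM_natl lerXn2r ?nnegrE ?subr_ge0 ?expR_ge0//.
exact: expR_ge1Dx.
Qed.

(** Reduces a numerical lower bound on a logarithm to a rational inequality, through (1 - x)^n <=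
    exp(-n x); with n = 16 four squarings suffice. *)
Lemma ln_ge_exp (a x y : R) n : x <= 1 -> 0 < a -> y = n%:R * x -> a^-1 <= (1 - x) ^+ n -> y <= ln a.
Proof.
move=> x1 a0 -> h; rewrite -ler_expR lnK ?posrE//.
have := le_trans h (expRN_ge_exp n x1).
by rewrite expRN lef_pV2 ?posrE ?expR_gt0.
Qed.

Lemma ln2_ge : 2 / 3 <= ln 2 :> R.
Proof.
apply: (@ln_ge_exp 2 (1 / 24) _ 16); [lra|lra|lra|].
rewrite (_ : (1 - 1 / 24 : R) ^+ 16 = (((((1 - 1 / 24) ^+ 2) ^+ 2) ^+ 2) ^+ 2)); last by rewrite -!exprM.
have h1 : 918 / 1000 <= (1 - 1 / 24 : R) ^+ 2 by rewrite expr2; lra.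
have h2 : 842 / 1000 <= ((1 - 1 / 24 : R) ^+ 2) ^+ 2 by rewrite [leRHS]expr2; nra.
have h3 : 708 / 1000 <= (((1 - 1 / 24 : R) ^+ 2) ^+ 2) ^+ 2 by rewrite [leRHS]expr2; nra.
by rewrite [leRHS]expr2; nra.
Qed.

Lemma ln3_ge : 21 / 20 <= ln 3 :> R.
Proof.
apply: (@ln_ge_exp 3 (21 / 320) _ 16); [lra|lra|lra|].
rewrite (_ : (1 - 21 / 320 : R) ^+ 16 = (((((1 - 21 / 320) ^+ 2) ^+ 2) ^+ 2) ^+ 2)); last by rewrite -!exprM.
have h1 : 873 / 1000 <= (1 - 21 / 320 : R) ^+ 2 by rewrite expr2; lra.
have h2 : 762 / 1000 <= ((1 - 21 / 320 : R) ^+ 2) ^+ 2 by rewrite [leRHS]expr2; nra.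
have h3 : 580 / 1000 <= (((1 - 21 / 320 : R) ^+ 2) ^+ 2) ^+ 2 by rewrite [leRHS]expr2; nra.
by rewrite [leRHS]expr2; nra.
Qed.

Lemma ln_succ_ge (k : nat) : (0 < k)%N -> (k.+1%:R)^-1 <= ln k.+1%:R - ln k%:R :> R.
Proof.
move=> k0; have kp : 0 < k%:R :> R by rewrite ltr0n.
have k1p : 0 < k.+1%:R :> R by [].
have := @le_ln1Dx R (- (k.+1%:R)^-1).
rewrite ltrN2 invf_lt1// ltr1n ltnS k0 => /(_ isT).
have -> : 1 + - k.+1%:R^-1 = k%:R / k.+1%:R :> R.
  by rewrite -natr1; field; rewrite natr1.
by rewrite ln_div ?posrE// lerNr opprB.
Qed.

(* The telescoping majorant is 4/3 (1 / ln k - 1 / ln k.+1), valid from k = 3 on. *)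
Lemma sum_inv_log2_le n :
  \sum_(1 <= k < n.+1) (k%:R * ln k.+1%:R ^+ 2)^-1 <= 4 :> R.
Proof.
have ln2p := ln2_ge; have ln3p := ln3_ge.
(* The two leading terms and the tail bound sum to 2.25 + 0.4536 + 1.27, just below 4. *)
have base1 : (1%:R * ln 2 ^+ 2)^-1 <= 9 / 4 :> R.
  rewrite mul1r -[leRHS]invrK lef_pV2 ?posrE; [|by rewrite exprn_gt0//; lra|lra].
  by rewrite invf_div expr2; nra.
have base2 : (2%:R * ln 3 ^+ 2)^-1 <= 4536 / 10000 :> R.
  rewrite -[leRHS]invrK lef_pV2 ?posrE; [|by rewrite mulr_gt0// exprn_gt0//; lra|lra].
  apply: (@le_trans _ _ (2 * (21 / 20) ^+ 2)); first by rewrite expr2; lra.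
  by rewrite ler_pM2l// lerXn2r ?nnegrE//; lra.
have base3 : 4 / 3 / ln 3 <= 127 / 100 :> R.
  by rewrite ler_pdivrMr; lra.
case: n => [|[|n]].
- by rewrite big_geq.
- by rewrite big_nat1; apply: (le_trans base1); lra.
suff h : \sum_(1 <= k < n.+3) (k%:R * ln k.+1%:R ^+ 2)^-1 <= 4 - 4 / 3 / ln n.+3%:R :> R.
  apply: (le_trans h); rewrite gerBl divr_ge0// ln_ge0//.
  by rewrite ler1n.
elim: n => [|n ih].
  by rewrite big_nat_recr//= big_nat1; lra.
rewrite big_nat_recr//=.
have l0 : 0 < ln n.+3%:R :> R by rewrite ln_gt0// ltr1n.
have l1 : 0 < ln n.+4%:R :> R by rewrite ln_gt0// ltr1n.
have step := @ln_succ_ge n.+3 isT.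
have l01 : ln n.+3%:R <= ln n.+4%:R :> R by rewrite ler_ln ?posrE// ler_nat.
set a : R := ln n.+3%:R in ih l0 step l01 *; set b : R := ln n.+4%:R in l1 step l01 *.
suff h : (n.+3%:R * b ^+ 2)^-1 <= 4 / 3 * (a^-1 - b^-1).
  by apply: (le_trans (lerD ih h)); rewrite le_eqVlt; apply/orP; left; apply/eqP; ring.
have n3 : 3 <= n.+3%:R :> R by rewrite ler_nat.
have -> : a^-1 - b^-1 = (b - a) / (a * b) by field; rewrite !gt_eqF.
apply: (@le_trans _ _ (4 / 3 * (n.+4%:R^-1 / (b * b)))); last first.
  rewrite ler_pM2l//.
  apply: ler_pM; rewrite ?invr_ge0 ?mulr_ge0//; try exact: ltW.
  by rewrite lef_pV2 ?posrE ?mulr_gt0// ler_pM2r.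
rewrite invfM expr2 [leRHS]mulrA ler_wpM2r ?invr_ge0 ?mulr_ge0//; try exact: ltW.
rewrite -[n.+4%:R]natr1 -[leLHS]div1r ler_pdivrMr; last lra.
rewrite mulrAC ler_pdivlMr; lra.
Qed.

Lemma sum_inv_le n : (0 < n)%N -> \sum_(1 <= k < n.+1) (k%:R)^-1 <= 1 + ln n%:R :> R.
Proof.
case: n => // n _; elim: n => [|n ih]; first by rewrite big_nat1 invr1 ln1 addr0.
rewrite big_nat_recr//=.
by apply: (le_trans (lerD ih (@ln_succ_ge n.+1 isT))); rewrite -addrA subrKC.
Qed.

End logarithms.

Section fifth_root.
Context {R : realType}.
Implicit Type k : nat.

(** All schedules are integer powers of this quantity, so their comparison becomes polynomial
    arithmetic. *)
Definition root5 k : R := k%:R `^ (1 / 5).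

Lemma root5X k n : root5 k ^+ n = k%:R `^ (n%:R / 5).
Proof.
by rewrite -powR_mulrn ?powR_ge0// -powRrM; congr (_ `^ _); lra.
Qed.

Lemma root5_5 k : root5 k ^+ 5 = k%:R.
Proof. by rewrite root5X divff ?powRr1. Qed.

Lemma root5_ge1 k : (0 < k)%N -> 1 <= root5 k.
Proof.
move=> k0; have -> : 1 = (1 : R) `^ (1 / 5) by rewrite powR1.
by rewrite ge0_ler_powR ?nnegrE ?ler1n//; lra.
Qed.

Lemma root5_gt0 k : (0 < k)%N -> 0 < root5 k.
Proof. by move=> /root5_ge1; lra. Qed.

Lemma root5_le k l : (k <= l)%N -> root5 k <= root5 l.
Proof. by move=> kl; rewrite ge0_ler_powR ?nnegrE// ?ler_nat//; lra. Qed.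

Lemma root5_succ_le2 k : (0 < k)%N -> root5 k.+1 <= 2 * root5 k.
Proof.
move=> k0; have s0 := root5_gt0 k0.
rewrite -(@ler_pXn2r _ 5)// ?nnegrE ?powR_ge0 ?mulr_ge0 ?powR_ge0//.
rewrite exprMn !root5_5 -natr1.
have : 1 <= k%:R :> R by rewrite ler1n.
by rewrite (_ : (2 : R) ^+ 5 = 32); [lra|ring].
Qed.

(** For s = root5 k and t = root5 (k+1): t^5 - s^5 = 1 and s^4 <= t^4 give t^4 (t - s) <= 1. *)
Lemma root5_succB k : (0 < k)%N ->
  root5 k.+1 - root5 k <= (root5 k.+1 ^+ 4)^-1.
Proof.
move=> k0; have s0 := root5_gt0 k0; have t0 := root5_gt0 (ltn0Sn k).
have st := root5_le (leqnSn k).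
have e : root5 k.+1 ^+ 5 - root5 k ^+ 5 = 1 by rewrite !root5_5 -natr1 addrC addKr.
set s := root5 k in s0 st e *; set t := root5 k.+1 in t0 st e *.
rewrite -[leRHS]div1r ler_pdivlMr ?exprn_gt0// -e.
have : s ^+ 4 * s <= t ^+ 4 * s.
  by rewrite ler_pM2r// lerXn2r ?nnegrE// ltW.
by rewrite mulrBl -exprS (mulrC s (t ^+ 4)) -exprSr; lra.
Qed.

Lemma root5_unbounded (M : R) : exists k0 : nat, (0 < k0)%N /\ forall k, (k0 <= k)%N -> M <= root5 k.
Proof.
exists (Num.truncn (`|M| ^+ 5)).+1; split => // k hk.
rewrite (le_trans (ler_norm M))// -(@ler_pXn2r _ 5)// ?nnegrE ?powR_ge0//.
rewrite root5_5 (le_trans (ltW (Num.Theory.truncnS_gt _)))// ler_nat//.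
Qed.

End fifth_root.

(** * The Lyapunov recursion for abstract sequences *)

Section lyapunov.
Context {R : realType} (L rho T N b : R) (q E D : nat -> R).
Local Notation s := (@root5 R).
Let eta k := 1 / (9 * L * rho * s k.+1 ^+ 3).
Let al k := 8 / (9 * s k ^+ 4).
Hypotheses (L0 : 0 < L) (rho0 : 0 < rho) (N0 : 0 <= N) (b0 : 0 <= b).
Hypotheses (q0 : forall k, (0 < k)%N -> 0 <= q k) (E0 : forall k, (0 < k)%N -> 0 <= E k)
  (D0 : forall k, (0 < k)%N -> 0 <= D k).
Hypothesis descent : forall k, (0 < k)%N ->
  q k.+1 <= q k - (1 / 2 - T / s k) * (D k / eta k) + (1 / 2 + T / s k) * (eta k * E k) + b / k%:R.
Hypothesis variance : forall k, (0 < k)%N ->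
  E k.+1 <= (1 - al k.+1) * E k + 16 * (L ^+ 2 * (rho * s k) ^+ 2) * D k + N / s k.+1 ^+ 6.

Let c k := 9 / (64 * L * rho) * s k.
Let Phi k := q k + c k * E k.
Let B := b + 9 / (64 * L * rho) * N.

(* The potential is q + c E with c_k = 9 s_k / (64 L rho): this makes
   16 c_{k+1} L^2 rho_k^2 <= 1 / (4 eta_k) and c_{k+1} al_{k+1} = 9/8 eta_k. *)
Lemma potential_decrease k : (0 < k)%N -> 8 * T <= s k -> 81 / 8 <= s k ->
  1 / 8 * (D k / eta k + eta k * E k) <= Phi k - Phi k.+1 + B / k%:R.
Proof.
move=> k0 hT hs.
have s0 := root5_gt0 (R := R) k0; have t0 := root5_gt0 (R := R) (ltn0Sn k).
have st := root5_le (R := R) (leqnSn k).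
have stB := root5_succB (R := R) k0.
have kE := root5_5 (R := R) k; have k1E := root5_5 (R := R) k.+1.
have hq := descent k0; have hv := variance k0.
have hE := E0 k0; have hD := D0 k0.
rewrite /Phi /c; rewrite /al in hv; rewrite /B.
have etaE : eta k = 1 / (9 * L * rho * s k.+1 ^+ 3) by [].
have etap : 0 < eta k by rewrite etaE divr_gt0// !mulr_gt0// exprn_gt0.
set e := eta k in hq etap etaE *.
set t := s k.+1 in t0 st stB k1E etaE hv *; set u := s k in s0 st stB kE hv hq hT hs *.
have Te : T / u <= 1 / 8 by rewrite ler_pdivrMr//; lra.
have DE0 : 0 <= D k / e by rewrite divr_ge0// ltW.
have EE0 : 0 <= e * E k by rewrite mulr_ge0// ltW.
set g := 9 / (64 * L * rho).
have gp : 0 < g by rewrite divr_gt0// !mulr_gt0.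
have h1 : g * t * (16 * (L ^+ 2 * (rho * u) ^+ 2) * D k) <= 1 / 4 * (D k / e).
  have -> : D k / e = 9 * L * rho * t ^+ 3 * D k by rewrite etaE; field; rewrite !gt_eqF ?exprn_gt0.
  have -> : g * t * (16 * (L ^+ 2 * (rho * u) ^+ 2) * D k) = 9 / 4 * (L * rho * D k) * (t * u ^+ 2).
    by rewrite /g; field; rewrite !gt_eqF.
  have -> : 1 / 4 * (9 * L * rho * t ^+ 3 * D k) = 9 / 4 * (L * rho * D k) * (t * t ^+ 2) by field.
  rewrite ler_wpM2l//; first by rewrite mulr_ge0// mulr_ge0// mulr_ge0// ltW.
  by rewrite ler_pM2l// lerXn2r ?nnegrE// ltW.
have h2 : g * t * (8 / (9 * t ^+ 4)) = 9 / 8 * e.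
  by rewrite /g etaE; field; rewrite !gt_eqF.
(* Growth of the weight c_k; it equals at most 81/64 e / t, which explains the threshold 81/8 on
   s_k. *)
have h3 : g * (t - u) <= e / 8.
  apply: (@le_trans _ _ (g * (t ^+ 4)^-1)); first by rewrite ler_pM2l.
  have -> : g * (t ^+ 4)^-1 = 81 / 64 * e / t by rewrite /g etaE; field; rewrite !gt_eqF.
  rewrite ler_pdivrMr//; have : e * (81 / 8) <= e * t by rewrite ler_pM2l//; lra.
  by lra.
have h3E : g * t * E k <= g * u * E k + e / 8 * E k.
  by rewrite -mulrDl ler_wpM2r//; move: h3; rewrite mulrBr; lra.
have h4 : g * t * (N / t ^+ 6) <= g * N / k%:R.
  have -> : g * t * (N / t ^+ 6) = g * N / t ^+ 5 by field; rewrite gt_eqF.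
  rewrite ler_wpM2l//; first by rewrite mulr_ge0// ltW.
  by rewrite k1E lef_pV2 ?posrE ?ltr0n// ler_nat.
have hvt : g * t * E k.+1 <= g * t * E k - 9 / 8 * e * E k
   + g * t * (16 * (L ^+ 2 * (rho * u) ^+ 2) * D k) + g * t * (N / t ^+ 6).
  apply: (le_trans (ler_wpM2l _ hv)); first by rewrite mulr_ge0// ltW.
  by rewrite -h2 !mulrDr; lra.
have T1 : T / u * (D k / e) <= 1 / 8 * (D k / e) by rewrite ler_wpM2r.
have T2 : T / u * (e * E k) <= 1 / 8 * (e * E k) by rewrite ler_wpM2r.
move: hq; rewrite [(1 / 2 - _) * _]mulrBl [(1 / 2 + _) * _]mulrDl [(b + _) / _]mulrDl => hq.
lra.
Qed.

(** Telescoping beyond a threshold index; the harmonic sum of the b / k terms gives the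
    logarithm. *)
Lemma sum_potential : exists C : R, 0 <= C /\ forall K, (0 < K)%N ->
  \sum_(1 <= k < K.+1) (D k / eta k + eta k * E k) <= C * (1 + ln K%:R).
Proof.
have [k0 [k00 hk0]] := root5_unbounded (Num.max (8 * T) (81 / 8)).
pose S k := D k / eta k + eta k * E k.
(* The finitely many early indices, where the decrease is not guaranteed, are paid for by this
   amount, which is independent of K. *)
pose M k := `|S k| + 8 * `|Phi k - Phi k.+1|.
have B0 : 0 <= B.
  by rewrite addr_ge0// mulr_ge0// divr_ge0// !mulr_ge0// ltW.
have Phi0 k : (0 < k)%N -> 0 <= Phi k.
  move=> kp; rewrite addr_ge0 ?q0// mulr_ge0 ?E0// mulr_ge0 ?powR_ge0//.
  by rewrite divr_ge0// !mulr_ge0// ltW.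
have M0 k : 0 <= M k by rewrite addr_ge0// mulr_ge0.
have MS : 0 <= \sum_(1 <= k < k0) M k by apply: sumr_ge0.
exists (8 * Phi 1%N + 8 * B + \sum_(1 <= k < k0) M k); split.
  by rewrite !addr_ge0// mulr_ge0// Phi0.
move=> K K0.
have lnK0 : 0 <= ln K%:R :> R by rewrite ln_ge0// ler1n.
have hS k : (0 < k)%N -> S k <= 8 * (Phi k - Phi k.+1) + 8 * B * k%:R^-1 + (if (k < k0)%N then M k else 0).
  move=> kp; have kn : 0 <= k%:R^-1 :> R by rewrite invr_ge0.
  have [lt|ge] := ltnP k k0.
    rewrite /M; have := ler_norm (S k); have := ler_norm (- (Phi k - Phi k.+1)).
    have : 0 <= 8 * B * k%:R^-1 by rewrite !mulr_ge0.
    by rewrite normrN; lra.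
  have := hk0 k ge; rewrite ge_max => /andP[h1 h2].
  by have := potential_decrease kp h1 h2; rewrite addr0 /S; lra.
have : \sum_(1 <= k < K.+1) S k <= \sum_(1 <= k < K.+1)
   (8 * (Phi k - Phi k.+1) + 8 * B * k%:R^-1 + (if (k < k0)%N then M k else 0)).
  by rewrite big_nat_cond [leRHS]big_nat_cond; apply: ler_sum => k /andP[/andP[kp _] _]; exact: hS.
move=> /le_trans; apply; rewrite [leLHS]big_split/= [X in X + _ <= _]big_split/= -!mulr_sumr.
have -> : \sum_(1 <= k < K.+1) (Phi k - Phi k.+1) = Phi 1%N - Phi K.+1.
  rewrite -[RHS]opprB -(telescope_sumr Phi)// -sumrN.
  by apply: eq_bigr => k _; rewrite opprB.
have hM : \sum_(1 <= k < K.+1) (if (k < k0)%N then M k else 0) <= \sum_(1 <= k < k0) M k.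
  have [le|gt] := leqP k0 K.+1.
    rewrite (@big_cat_nat _ _ _ k0)//= [X in _ + X]big_nat_cond [X in _ + X]big1 ?addr0; last first.
      by move=> k /andP[/andP[h _] _]; rewrite ltnNge h.
    by rewrite big_nat_cond [leRHS]big_nat_cond; apply: ler_sum => k /andP[/andP[_ ->] _].
  rewrite [leRHS](@big_cat_nat _ _ _ K.+1)//=; last exact: ltnW.
  rewrite big_nat_cond [X in X + _]big_nat_cond.
  rewrite -[leLHS]addr0; apply: lerD; last exact: sumr_ge0.
  apply: ler_sum => k /andP[/andP[_ h] _].
  by rewrite (ltn_trans h gt).
have hH := sum_inv_le (R := R) K0.
have hP := Phi0 K.+1 isT; have hP1 := Phi0 1%N isT.
set H := \sum_(1 <= k < K.+1) k%:R^-1 in hH *; set MM := \sum_(_ <= _ < k0) _ in hM MS *.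
have BH : 8 * B * H <= 8 * B * (1 + ln K%:R) by rewrite ler_wpM2l//; lra.
have PK : 8 * Phi 1%N <= 8 * Phi 1%N * (1 + ln K%:R) by rewrite ler_peMr//; lra.
have MK : MM <= MM * (1 + ln K%:R) by rewrite ler_peMr//; lra.
lra.
Qed.

End lyapunov.

(** * The number of iterations *)

Section iteration_count.
Context {R : realType}.

(** With l = ln(1/eps), take K just above u^5 for u = A l / eps. Then ln K = O(l) because l >= 1/2,
    and C0 (1 + ln K) <= A l = eps u <= eps K^(1/5). *)
Lemma iteration_count (C0 : R) : 0 <= C0 -> exists C : R, 0 < C /\
  forall eps : R, 0 < eps -> eps <= 1 / 2 -> exists K : nat, [/\ (0 < K)%N,
    K%:R <= C * eps ^- 5 * ln (1 / eps) `^ 5 & C0 * (1 + ln K%:R) / root5 K <= eps].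
Proof.
(* The choice must satisfy C0 (14 + 20 b) <= A; as b >= 1, the left side is at most 34 C0 b <= b^2.
   Taking A a square gives ln A = 2 ln b <= 2 b, linear in b. *)
move=> C00; pose b := 34 * C0 + 1; pose A := b ^+ 2.
have b1 : 1 <= b by rewrite /b; lra.
have A1 : 1 <= A by rewrite expr_ge1//; lra.
have A0 : 0 < A by lra.
exists (2 * A ^+ 5); split; first by rewrite mulr_gt0// exprn_gt0.
move=> eps e0 e2; set l := ln (1 / eps).
have ie : 2 <= 1 / eps by rewrite ler_pdivlMr//; lra.
have l12 : 1 / 2 <= l.
  have := ln2_ge (R := R); have : ln 2 <= l by rewrite ler_ln ?posrE//; lra.
  by lra.
have lp : 0 < l by lra.
pose u := A * l / eps.
have u1 : 1 <= u.
  rewrite ler_pdivlMr// mul1r; nra.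
have up : 0 < u by lra.
pose K := (Num.truncn (u ^+ 5)).+1.
have u5 : 1 <= u ^+ 5 by rewrite expr_ge1// ltW.
have Kge : u ^+ 5 <= K%:R by rewrite ltW// Num.Theory.truncnS_gt.
have Kle : K%:R <= 2 * u ^+ 5.
  have : (Num.truncn (u ^+ 5))%:R <= u ^+ 5 by rewrite Num.Theory.truncn_le// ltW// (lt_le_trans ltr01).
  by rewrite /K -natr1; lra.
have sK : u <= root5 K.
  by rewrite -(@ler_pXn2r _ 5)// ?nnegrE ?powR_ge0// ?root5_5// ltW.
exists K; split => //.
  apply: (le_trans Kle); rewrite powR_mulrn; last exact: ltW.
  by rewrite /u !exprMn exprVn; lra.
have lnu : ln u <= ln A + 2 * l.
  have -> : u = A * (l * (1 / eps)) by rewrite /u; field; rewrite gt_eqF.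
  have ip : 0 < 1 / eps by lra.
  have lip : 0 < l * (1 / eps) by exact: mulr_gt0.
  rewrite (lnM A0 lip) (lnM lp ip) -/l.
  by have := ln_sublinear lp; lra.
have lnA : ln A <= 2 * b.
  rewrite /A lnXn; last lra.
  by have := @ln_sublinear R b; rewrite -mulr_natl; lra.
have lnK2 : ln K%:R <= 1 + 5 * ln A + 10 * l.
  have h : ln K%:R <= ln (2 * u ^+ 5) by rewrite ler_ln ?posrE// mulr_gt0// exprn_gt0.
  have u5p : 0 < u ^+ 5 by rewrite exprn_gt0.
  move: h; rewrite lnM ?posrE// lnXn// -[ln u *+ 5]mulr_natl => h.
  have ln21 : ln 2 <= 1 :> R.
    by have := @le_ln1Dx R 1; rewrite (_ : 1 + 1 = 2 :> R); [apply; lra|lra].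
  by clear -h lnu ln21; move: h lnu ln21; move: (ln K%:R) (ln u) (ln A) (ln 2) => x1 x2 x3 x4; lra.
have lnA0 : 0 <= ln A by rewrite ln_ge0.
have bound : 1 + ln K%:R <= (14 + 20 * b) * l.
  apply: (@le_trans _ _ (2 + 10 * b + 10 * l)); first by lra.
  have : b * 1 <= b * (2 * l) by rewrite ler_pM2l; lra.
  by lra.
have CA : C0 * (14 + 20 * b) <= A by rewrite /A expr2 /b; nra.
rewrite ler_pdivrMr; last by rewrite (lt_le_trans up).
apply: (@le_trans _ _ (C0 * ((14 + 20 * b) * l))); first by rewrite ler_wpM2l.
apply: (@le_trans _ _ (eps * u)); last by rewrite ler_pM2l.
rewrite mulrA (_ : eps * u = A * l); last by rewrite /u; field; rewrite gt_eqF.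
by rewrite ler_pM2r.
Qed.

End iteration_count.

(** * One projected step on the augmented Lagrangian *)

Section lagrangian_step.
Context {R : realType} {d m : nat} (X : set 'rV[R]_d) (f : 'rV[R]_d -> R)
  (F : 'rV[R]_d -> 'rV[R]_d) (c : 'rV[R]_d -> 'rV[R]_m) (J : 'rV[R]_d -> 'M[R]_(m, d))
  (Lf LJ Cgf Cgc Cc Lam : R).
Implicit Types (rho eta : R) (lam : 'rV[R]_m) (x y z g : 'rV[R]_d).
Hypotheses (clX : closed X) (cvX : convex_set X) (X0 : X !=set0).
Hypotheses (Lf0 : 0 <= Lf) (LJ0 : 0 <= LJ) (Cgc0 : 0 <= Cgc) (Cc0 : 0 <= Cc) (Lam0 : 0 <= Lam).
Hypotheses
  (f_exp : forall x y, `|f y - f x - dotp (F x) (y - x)| <= Lf * enorm (y - x) ^+ 2)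
  (c_exp : forall i x y, `|c y 0 i - c x 0 i - dotp (row i (J x)) (y - x)| <= LJ * enorm (y - x) ^+ 2)
  (c_lip : forall i x y, `|c y 0 i - c x 0 i| <= Cgc * enorm (y - x))
  (F_lip : forall x y, enorm (F x - F y) <= Lf * enorm (x - y))
  (J_lip : forall (l : 'rV[R]_m) x y, enorm (l *m (J x - J y)) <= LJ * enorm (x - y) * enorm l)
  (F_bd : forall x, enorm (F x) <= Cgf)
  (J_bd : forall (l : 'rV[R]_m) x, enorm (l *m J x) <= Cgc * enorm l)
  (c_bd : forall x, enorm (c x) <= Cc).

Definition aug_lagrangian rho lam x : R :=
  f x + \sum_(i < m) lam 0 i * c x 0 i + rho / 2 * \sum_(i < m) c x 0 i ^+ 2.

(** One constant for two uses: the quadratic remainder of the augmented Lagrangian and the Lipschitz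
    bound of its gradient, both per unit of rho. Each use leaves a nonnegative surplus term. *)
Definition lagrangian_lip : R :=
  Lf + m%:R * Lam * LJ + m%:R * (Cc * LJ + Cgc ^+ 2) + Cc * LJ.

Lemma lagrangian_lip_ge0 : 0 <= lagrangian_lip.
Proof. by rewrite /lagrangian_lip !addr_ge0 ?mulr_ge0 ?addr_ge0 ?mulr_ge0 ?sqr_ge0. Qed.

Lemma sum_le_card (a : 'I_m -> R) (A : R) : (forall i, a i <= A) -> \sum_(i < m) a i <= m%:R * A.
Proof.
move=> h; apply: (le_trans (ler_sum _ (fun i _ => h i))).
by rewrite sumr_const card_ord mulr_natl.
Qed.

Lemma dotp_mean_Qgrad rho x lam v :
  dotp (mean_Qgrad F c J rho x lam) v =
  dotp (F x) v + \sum_(i < m) lam 0 i * dotp (row i (J x)) v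
  + rho * \sum_(i < m) c x 0 i * dotp (row i (J x)) v.
Proof.
have dsum (a : 'rV[R]_m) : dotp (a *m J x) v = \sum_(i < m) a 0 i * dotp (row i (J x)) v.
  rewrite mulmx_sum_row; elim/big_ind2: _ => [|u p w q up wq|i _].
  - exact: dotp0l.
  - by rewrite dotpDl up wq.
  - exact: dotpZl.
rewrite /mean_Qgrad dotpDl mulmxDl dotpDl -scalemxAl dotpZl !dsum.
by rewrite addrA.
Qed.

Lemma aug_lagrangian_expansion rho lam x y : 1 <= rho -> (forall i, `|lam 0 i| <= Lam) ->
  aug_lagrangian rho lam y <= aug_lagrangian rho lam x
    + dotp (mean_Qgrad F c J rho x lam) (y - x) + lagrangian_lip * rho * enorm (y - x) ^+ 2.
Proof.
move=> r1 lL; set v := y - x; set S := enorm v ^+ 2.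
have S0 : 0 <= S by exact: sqr_ge0.
have r0 : 0 <= rho by lra.
have hf : f y - f x <= dotp (F x) v + Lf * S.
  by have := f_exp x y; rewrite ler_norml => /andP[_]; rewrite -/v -/S; lra.
have hl : \sum_(i < m) (lam 0 i * c y 0 i) - \sum_(i < m) (lam 0 i * c x 0 i)
    <= \sum_(i < m) lam 0 i * dotp (row i (J x)) v + m%:R * (Lam * (LJ * S)).
  rewrite -sumrB -lerBlDl -sumrB; apply: sum_le_card => i.
  rewrite -mulrBr -mulrBr; apply: (le_trans (ler_norm _)).
  by rewrite normrM; apply: ler_pM => //; exact: c_exp.
have hq : 1 / 2 * \sum_(i < m) c y 0 i ^+ 2 - 1 / 2 * \sum_(i < m) c x 0 i ^+ 2
    <= \sum_(i < m) c x 0 i * dotp (row i (J x)) v + m%:R * ((Cc * LJ + Cgc ^+ 2) * S).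
  rewrite !mulr_sumr -sumrB -lerBlDl -sumrB; apply: sum_le_card => i.
  have hc : `|c x 0 i| <= Cc := le_trans (coord_le_enorm _ _) (c_bd x).
  have h1 := c_exp i x y; have h2 := c_lip i x y; rewrite -/v -/S in h1 h2.
  set a := c x 0 i in hc h1 h2 *; set b := c y 0 i in h1 h2 *; set t := dotp _ v in h1 *.
  (* Half of b^2 - a^2 is a (b - a) + (b - a)^2 / 2: the first part is expanded to first order, the
     second is already quadratic in the step. *)
  have h3 : a * (b - a - t) <= Cc * (LJ * S).
    by apply: (le_trans (ler_norm _)); rewrite normrM; apply: ler_pM.
  have h4 : (b - a) ^+ 2 <= Cgc ^+ 2 * S.
    by rewrite -real_normK ?num_real// -exprMn lerXn2r ?nnegrE// mulr_ge0 ?enorm_ge0.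
  have h5 : 0 <= Cgc ^+ 2 * S by rewrite mulr_ge0 ?sqr_ge0.
  nra.
have hq' := ler_wpM2l r0 hq.
have mm : 0 <= m%:R :> R by [].
have e1 : Lf * S <= Lf * rho * S by rewrite ler_wpM2r// ler_peMr.
have e2 : m%:R * (Lam * (LJ * S)) <= m%:R * Lam * LJ * rho * S.
  have -> : m%:R * Lam * LJ * rho * S = rho * (m%:R * (Lam * (LJ * S))) by ring.
  by rewrite ler_peMl// mulr_ge0// mulr_ge0// mulr_ge0.
have e3 : 0 <= Cc * LJ * rho * S by rewrite mulr_ge0// mulr_ge0// mulr_ge0.
rewrite /aug_lagrangian dotp_mean_Qgrad /lagrangian_lip.
move: hf hl hq' e1 e2 e3; rewrite -/v.
move: (\sum_(i < m) lam 0 i * c y 0 i) (\sum_(i < m) lam 0 i * c x 0 i)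
  (\sum_(i < m) c y 0 i ^+ 2) (\sum_(i < m) c x 0 i ^+ 2)
  (\sum_(i < m) lam 0 i * dotp (row i (J x)) v)
  (\sum_(i < m) c x 0 i * dotp (row i (J x)) v) => s1 s2 s3 s4 s5 s6.
nra.
Qed.

Lemma mean_Qgrad_lip rho lam x y : 1 <= rho -> (forall i, `|lam 0 i| <= Lam) ->
  enorm (mean_Qgrad F c J rho y lam - mean_Qgrad F c J rho x lam) <=
  lagrangian_lip * rho * enorm (y - x).
Proof.
move=> r1 lL; set v := enorm (y - x).
have v0 : 0 <= v by exact: enorm_ge0.
have r0 : 0 <= rho by lra.
have -> : mean_Qgrad F c J rho y lam - mean_Qgrad F c J rho x lam =
  (F y - F x) + (lam *m (J y - J x)
  + rho *: ((c y - c x) *m J x + c y *m (J y - J x))).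
  rewrite /mean_Qgrad !mulmxBr !mulmxBl !mulmxDl -!scalemxAl.
  by apply/rowP => j; rewrite !mxE; ring.
have nl : enorm lam <= m%:R * Lam.
  by apply: (le_trans (enorm_le_sum _)); exact: sum_le_card.
have nc : enorm (c y - c x) <= m%:R * (Cgc * v).
  by apply: (le_trans (enorm_le_sum _)); apply: sum_le_card => i; rewrite !mxE; exact: c_lip.
have h1 := F_lip y x.
have h2 : enorm (lam *m (J y - J x)) <= m%:R * Lam * LJ * v.
  apply: (le_trans (J_lip _ _ _)); rewrite mulrC -!mulrA.
  by rewrite [leRHS]mulrA ler_wpM2r ?mulr_ge0.
have h3 : enorm ((c y - c x) *m J x) <= m%:R * Cgc ^+ 2 * v.
  apply: (le_trans (J_bd _ _)); apply: (le_trans (ler_wpM2l Cgc0 nc)).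
  by rewrite le_eqVlt; apply/orP; left; apply/eqP; ring.
have h4 : enorm (c y *m (J y - J x)) <= Cc * LJ * v.
  apply: (le_trans (J_lip _ _ _)); rewrite mulrC -mulrA.
  by rewrite ler_wpM2r ?mulr_ge0.
apply: (le_trans (enormD _ _)).
apply: (le_trans (lerD h1 (enormD _ _))).
rewrite enormZ ger0_norm//.
have h5 := le_trans (enormD ((c y - c x) *m J x) (c y *m (J y - J x))) (lerD h3 h4).
apply: (le_trans (lerD (lexx _) (lerD h2 (ler_wpM2l r0 h5)))).
rewrite -/v.
have e1 : Lf * v <= Lf * rho * v by rewrite ler_wpM2r// ler_peMr.
have e2 : m%:R * Lam * LJ * v <= m%:R * Lam * LJ * rho * v.
  by rewrite ler_wpM2r// ler_peMr// !mulr_ge0.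
have e3 : 0 <= m%:R * (Cc * LJ) * rho * v by rewrite !mulr_ge0.
rewrite /lagrangian_lip.
by move: e1 e2 e3; lra.
Qed.

Section step.
Variables (rho eta : R) (lam : 'rV[R]_m) (x g : 'rV[R]_d).
Hypotheses (r1 : 1 <= rho) (lL : forall i, `|lam 0 i| <= Lam) (eta0 : 0 < eta) (Xx : X x).
Let xp := euclid_proj X (x - eta *: g).
Let D := enorm (xp - x).
Let e := enorm (g - mean_Qgrad F c J rho x lam).

(** The obtuse angle criterion at x gives eta (g, xp - x) <= -D^2; the gradient error is split off
    by Young's inequality with weight eta. *)
Lemma step_descent :
  aug_lagrangian rho lam xp <=
  aug_lagrangian rho lam x - (1 / (2 * eta) - lagrangian_lip * rho) * D ^+ 2 + eta / 2 * e ^+ 2.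
Proof.
apply: (le_trans (aug_lagrangian_expansion x xp r1 lL)).
have hp := euclid_proj_normal clX cvX X0 (x - eta *: g) Xx; rewrite -/xp in hp.
have hg : eta * dotp g (xp - x) <= - D ^+ 2.
  move: hp; rewrite -(opprB xp x) dotpNr.
  have -> : x - eta *: g - xp = - (xp - x) - eta *: g by rewrite opprB addrAC.
  by rewrite dotpBl dotpNl dotpZl -sqr_enorm -/D; lra.
have he : dotp (mean_Qgrad F c J rho x lam - g) (xp - x) <= e * D.
  by apply: (le_trans (CauchySchwarz_dotp _ _)); rewrite enormBC.
rewrite dotpBl in he.
have hg' : dotp g (xp - x) <= - (D ^+ 2 / eta).
  by rewrite -mulNr ler_pdivlMr// mulrC.
have am : e * D <= eta / 2 * e ^+ 2 + D ^+ 2 / (2 * eta).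
  rewrite -subr_ge0; have -> : eta / 2 * e ^+ 2 + D ^+ 2 / (2 * eta) - e * D = (eta * e - D) ^+ 2 / (2 * eta).
    by field; rewrite gt_eqF.
  by rewrite divr_ge0 ?sqr_ge0// mulr_ge0// ltW.
have -> : 1 / (2 * eta) = 1 / eta - 1 / (2 * eta) by field; rewrite gt_eqF.
rewrite -[lagrangian_lip * rho * _ ^+ 2]/(lagrangian_lip * rho * D ^+ 2).
have t1 : 1 / eta * D ^+ 2 = D ^+ 2 / eta by rewrite mulrAC mul1r.
have t2 : 1 / (2 * eta) * D ^+ 2 = D ^+ 2 / (2 * eta) by rewrite mulrAC mul1r.
by rewrite !mulrBl t1 t2; lra.
Qed.

(** The projection leaves the normal vector (x - eta g - xp) / eta at xp; comparing it with the
    gradient at xp gives the three terms. *)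
Lemma step_stationarity :
  euclid_dist_to (mean_Qgrad F c J rho xp lam) (neg_normal_cone X xp) <=
  D / eta + e + lagrangian_lip * rho * D.
Proof.
pose nv := eta^-1 *: (x - eta *: g - xp).
have Nn : normal_cone X xp nv.
  move=> u Xu; rewrite dotpZl; apply: mulr_ge0_le0; first by rewrite invr_ge0 ltW.
  exact: euclid_proj_normal.
apply: (@le_trans _ _ (enorm (mean_Qgrad F c J rho xp lam - - nv))).
  by apply: euclid_dist_to_le; exists nv.
have -> : mean_Qgrad F c J rho xp lam - - nv =
  (mean_Qgrad F c J rho xp lam - mean_Qgrad F c J rho x lam)
  + (eta^-1 *: (x - xp) - (g - mean_Qgrad F c J rho x lam)).
  have -> : nv = eta^-1 *: (x - xp) - g.
    rewrite /nv addrAC scalerBr scalerA mulVf ?scale1r//; by rewrite gt_eqF.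
  by apply/rowP => j; rewrite !mxE; ring.
apply: (le_trans (enormD _ _)).
rewrite addrC; apply: lerD; last exact: mean_Qgrad_lip.
apply: (le_trans (enormB _ _)).
by rewrite enormZ gtr0_norm ?invr_gt0// enormBC mulrC.
Qed.

(** The penalty gradient is rho times c J, so regularity forces rho delta |c| below the stationarity
    residual plus the bounded part F + lam J. *)
Lemma step_constraint (delta : R) :
  delta * enorm (c xp) <= euclid_dist_to (c xp *m J xp) (neg_normal_cone X xp) ->
  delta * rho * enorm (c xp) <=
  D / eta + e + lagrangian_lip * rho * D + (Cgf + Cgc * (m%:R * Lam)).
Proof.
move=> h; have r0 : 0 < rho := lt_le_trans ltr01 r1.
rewrite [delta * rho]mulrC -[rho * delta * _]mulrA.
apply: (le_trans (ler_wpM2l (ltW r0) h)).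
apply: (le_trans (dist_neg_normal_coneZ _ _ _ (F xp + lam *m J xp) r0)).
apply: lerD.
  apply: le_trans step_stationarity.
  by rewrite /mean_Qgrad mulmxDl -scalemxAl addrA.
apply: (le_trans (enormD _ _)); apply: lerD => //.
apply: (le_trans (J_bd _ _)); rewrite ler_wpM2l//.
by apply: (le_trans (enorm_le_sum _)); exact: sum_le_card.
Qed.

(** As x is its own projection, nonexpansiveness applies. This serves to prove the steps square
    integrable. *)
Lemma step_length : D <= eta * e + eta * enorm (mean_Qgrad F c J rho x lam).
Proof.
rewrite /D -[X in enorm (_ - X)](euclid_proj_id clX X0 Xx).
apply: (le_trans (euclid_proj_nonexpansive clX cvX X0 _ _)).
have -> : x - eta *: g - x = - (eta *: g) by rewrite addrAC subrr add0r.
rewrite enormN enormZ gtr0_norm// -mulrDr ler_pM2l//.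
by have := enormD (g - mean_Qgrad F c J rho x lam) (mean_Qgrad F c J rho x lam); rewrite subrK.
Qed.

End step.

Lemma mean_Qgrad_bd rho lam x : 1 <= rho -> (forall i, `|lam 0 i| <= Lam) ->
  enorm (mean_Qgrad F c J rho x lam) <= (Cgf + Cgc * (m%:R * Lam) + Cgc * Cc) * rho.
Proof.
move=> r1 lL; have r0 : 0 <= rho by lra.
rewrite /mean_Qgrad mulmxDl -scalemxAl addrA.
apply: (le_trans (enormD _ _)); rewrite enormZ ger0_norm// [leRHS]mulrDl; apply: lerD.
  apply: (@le_trans _ _ (Cgf + Cgc * (m%:R * Lam))).
    apply: (le_trans (enormD _ _)); apply: lerD => //.
    apply: (le_trans (J_bd _ _)); rewrite ler_wpM2l//.
    by apply: (le_trans (enorm_le_sum _)); exact: sum_le_card.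
  by rewrite ler_peMr// addr_ge0 ?mulr_ge0// (le_trans (enorm_ge0 _) (F_bd x)).
rewrite mulrC ler_wpM2r// (le_trans (J_bd _ _))// ler_wpM2l//.
Qed.

End lagrangian_step.

(** * Schedule arithmetic of one step, with u = s_k, t = s_{k+1} and C = |c(x_{k+1})| *)

Section step_arithmetic.
Context {R : realType} (L rho delta u t Lq M D e C : R).
Hypotheses (L0 : 0 < L) (rho1 : 1 <= rho) (delta0 : 0 < delta) (u1 : 1 <= u) (ut : u <= t)
  (Lq0 : 0 <= Lq) (M0 : 0 <= M) (D0 : 0 <= D) (e0 : 0 <= e) (C0 : 0 <= C).
Let eta := 1 / (9 * L * rho * t ^+ 3).
Let a := Lq / (9 * L).

Let u0 : 0 < u. Proof. exact: lt_le_trans u1. Qed.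
Let t1 : 1 <= t. Proof. exact: le_trans ut. Qed.
Let t0 : 0 < t. Proof. exact: lt_le_trans t1. Qed.
Let rho0 : 0 < rho. Proof. exact: lt_le_trans rho1. Qed.
Let nz : [/\ u != 0, t != 0, rho != 0, L != 0 & delta != 0].
Proof. by split; apply: lt0r_neq0. Qed.
Let a0 : 0 <= a. Proof. by rewrite /a divr_ge0// mulr_ge0// ltW. Qed.

Let u2t3 : u ^+ 2 <= t ^+ 3.
Proof.
apply: (@le_trans _ _ (t ^+ 2)); first by rewrite lerXn2r ?nnegrE// ltW.
by rewrite ler_weXn2l.
Qed.

Let u_t3 : u <= t ^+ 3.
Proof. by apply: le_trans u2t3; rewrite expr2 ler_peMl// ltW. Qed.

Let etaV : eta^-1 = 9 * L * rho * t ^+ 3.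
Proof. by rewrite /eta div1r invrK. Qed.

Let eta0 : 0 < eta.
Proof.
rewrite -invr_gt0 etaV; apply: mulr_gt0; last exact: exprn_gt0.
by apply: mulr_gt0 => //; apply: mulr_gt0.
Qed.

Lemma lip_step_le : Lq * (rho * u) * D <= a * (D / eta).
Proof.
rewrite etaV.
have -> : Lq * (rho * u) * D = Lq * rho * D * u by ring.
have -> : a * (D * (9 * L * rho * t ^+ 3)) = Lq * rho * D * t ^+ 3.
  by have [_ _ _ hL _] := nz; rewrite /a; field.
by apply: ler_wpM2l => //; apply: mulr_ge0 => //; apply: mulr_ge0 => //; exact: ltW.
Qed.

(** The gap between u^2 and t^3 supplies the factor 1 / u that makes the curvature term negligible
    for large k. *)
Lemma lip_sqr_step_le : Lq * (rho * u) * D ^+ 2 <= a / u * (D ^+ 2 / eta).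
Proof.
have [hu _ _ hL _] := nz; rewrite etaV.
have -> : Lq * (rho * u) * D ^+ 2 = Lq * rho * D ^+ 2 / u * u ^+ 2 by field.
have -> : a / u * (D ^+ 2 * (9 * L * rho * t ^+ 3)) = Lq * rho * D ^+ 2 / u * t ^+ 3.
  by rewrite /a; field; rewrite hu.
apply: ler_wpM2l u2t3; apply: divr_ge0; last exact: ltW.
by apply: mulr_ge0; [apply: mulr_ge0 => //; exact: ltW|exact: sqr_ge0].
Qed.

Hypothesis constraint : delta * (rho * u) * C <= D / eta + e + Lq * (rho * u) * D + M.

(** The left side majorises the cost of the penalty increase. Squaring the constraint bound brings 1
    / (rho u)^2 against 1 / eta of order rho t^3; with the prefactor rho / t^4 this leaves 1 / (t
    u^2) <= 1 / u, and the bounded part M leaves 1 / u^5 = 1 / k. *)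
Lemma sqr_constraint_le : rho / (2 * t ^+ 4) * C ^+ 2 <=
  27 * L / (2 * delta ^+ 2) * (1 + a) ^+ 2 / u * (D ^+ 2 / eta)
  + 27 * L / (2 * delta ^+ 2) * (1 + a) ^+ 2 / u * (eta * e ^+ 2)
  + 3 / (2 * delta ^+ 2) * M ^+ 2 / u ^+ 5.
Proof.
have [hu ht hr hL hd] := nz.
set p := D / eta.
have p0 : 0 <= p by rewrite /p divr_ge0// ltW.
have h1 : delta * (rho * u) * C <= (1 + a) * p + e + M.
  by have := lip_step_le; rewrite -/p => h; move: constraint; rewrite -/p; lra.
have h2 : (delta * (rho * u) * C) ^+ 2 <= 3 * (((1 + a) * p) ^+ 2 + e ^+ 2 + M ^+ 2).
  have h0 : 0 <= delta * (rho * u) * C.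
    by apply: mulr_ge0 => //; apply: mulr_ge0; [exact: ltW|apply: mulr_ge0; exact: ltW].
  apply: (@le_trans _ _ (((1 + a) * p + e + M) ^+ 2)).
    by rewrite lerXn2r ?nnegrE// (le_trans h0).
  set P := (1 + a) * p.
  have := sqr_ge0 (P - e); have := sqr_ge0 (P - M); have := sqr_ge0 (e - M).
  by rewrite !expr2; lra.
have tu2 : (t * u ^+ 2)^-1 <= u^-1.
  rewrite lef_pV2 ?posrE//; last by apply: mulr_gt0 => //; exact: exprn_gt0.
  by have := u1; have := t1; nra.
have tu6 : (rho * t ^+ 4 * u ^+ 2)^-1 <= (u ^+ 5)^-1.
  have u5 : 0 < u ^+ 5 by exact: exprn_gt0.
  have t4 : 0 < t ^+ 4 by exact: exprn_gt0.
  have u2 : 0 < u ^+ 2 by exact: exprn_gt0.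
  rewrite lef_pV2 ?posrE//; last by apply: mulr_gt0 => //; exact: mulr_gt0.
  apply: (@le_trans _ _ (u ^+ 6)); first by rewrite ler_weXn2l.
  rewrite (_ : 6%N = (4 + 2)%N)// exprD ler_pM2r//.
  apply: (@le_trans _ _ (t ^+ 4)); first by rewrite lerXn2r ?nnegrE// ltW.
  by rewrite ler_peMl// ltW.
have k0 : 0 <= 27 * L / (2 * delta ^+ 2).
  by apply: divr_ge0; apply: mulr_ge0 => //; [exact: ltW|exact: sqr_ge0].
have -> : rho / (2 * t ^+ 4) * C ^+ 2 =
   (2 * t ^+ 4 * rho * u ^+ 2 * delta ^+ 2)^-1 * (delta * (rho * u) * C) ^+ 2.
  by field; rewrite hu ht hr hd.
have c0 : 0 <= (2 * t ^+ 4 * rho * u ^+ 2 * delta ^+ 2)^-1.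
  rewrite invr_ge0; apply: mulr_ge0; last exact: sqr_ge0.
  apply: mulr_ge0; last exact: sqr_ge0.
  by apply: mulr_ge0; [apply: mulr_ge0 => //; apply: exprn_ge0|]; exact: ltW.
apply: (le_trans (ler_wpM2l c0 h2)).
set q := D ^+ 2 / eta; set r := eta * e ^+ 2.
have q0 : 0 <= q by apply: divr_ge0; [exact: sqr_ge0|exact: ltW].
have r0 : 0 <= r by apply: mulr_ge0; [exact: ltW|exact: sqr_ge0].
have pE : p ^+ 2 = 9 * L * rho * t ^+ 3 * q by rewrite /p /q etaV; ring.
have eE : e ^+ 2 = 9 * L * rho * t ^+ 3 * r.
  by rewrite /r -etaV mulrA mulVf ?mul1r// gt_eqF.
rewrite exprMn pE eE.
have -> : (2 * t ^+ 4 * rho * u ^+ 2 * delta ^+ 2)^-1 *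
  (3 * ((1 + a) ^+ 2 * (9 * L * rho * t ^+ 3 * q) + 9 * L * rho * t ^+ 3 * r + M ^+ 2)) =
  27 * L / (2 * delta ^+ 2) * (1 + a) ^+ 2 * q * (t * u ^+ 2)^-1 +
  27 * L / (2 * delta ^+ 2) * r * (t * u ^+ 2)^-1 +
  3 / (2 * delta ^+ 2) * M ^+ 2 * (rho * t ^+ 4 * u ^+ 2)^-1.
  by field; rewrite hu ht hr hd.
have sa : 1 <= (1 + a) ^+ 2 by rewrite expr_ge1//; have := a0; lra.
apply: lerD; first apply: lerD.
- rewrite [leRHS]mulrAC; apply: ler_wpM2l => //.
  by apply: mulr_ge0 => //; apply: mulr_ge0 => //; exact: sqr_ge0.
- rewrite [leRHS]mulrAC; apply: ler_pM => //.
  + exact: mulr_ge0.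
  + by rewrite invr_ge0; apply: mulr_ge0; [exact: ltW|exact: sqr_ge0].
  + by apply: ler_wpM2r => //; exact: ler_peMr.
- apply: ler_wpM2l => //; apply: mulr_ge0; last exact: sqr_ge0.
  by apply: divr_ge0 => //; apply: mulr_ge0 => //; exact: sqr_ge0.
Qed.

End step_arithmetic.

(** * The filtration generated by the samples *)

Section history.
Context {dO dT} {Omega : measurableType dO} {T : measurableType dT} {R : realType}
  (P : probability Omega R) (B : nat -> {RV P >-> T}).

(** Cylinder events of the samples 1, ..., k: an intersection-stable generating family, on which
    independence can be checked directly. For k = 0 only the whole space remains. *)
Definition history k : set (set Omega) :=
  [set A | exists2 D : nat -> set T, (forall j, measurable (D j)) &
    A = \bigcap_(j in [set j | (0 < j <= k)%N]) (B j @^-1` D j)].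

Local Notation Omega_ k := (g_sigma_algebraType (history k)).

Lemma measurable_preimage_RV j D : measurable D -> measurable (B j @^-1` D).
Proof. by move=> mD; rewrite -[X in measurable X]setTI; exact: measurable_funPT. Qed.

Lemma history_measurable k : history k `<=` measurable.
Proof.
move=> _ [D mD ->]; apply: fin_bigcap_measurable.
  apply: (@sub_finite_set _ _ `I_k.+1); last exact: finite_II.
  by move=> j /= /andP[].
by move=> j _; exact: measurable_preimage_RV.
Qed.

Lemma history_setI k : setI_closed (history k).
Proof.
move=> _ _ [D mD ->] [D' mD' ->]; exists (fun j => D j `&` D' j).
  by move=> j; exact: measurableI.
by rewrite -bigcapI; apply: eq_bigcapr => j _; rewrite preimage_setI.
Qed.

Lemma historyT k : history k setT.
Proof.
exists (fun=> setT) => //.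
by apply/esym; rewrite -subTset => w _ j _.
Qed.

Lemma history_le k : history k `<=` history k.+1.
Proof.
move=> _ [D mD ->]; exists (fun j => if j == k.+1 then setT else D j).
  by move=> j; case: ifP.
apply/seteqP; split => w h j /= /andP[j0 jk].
  case: ifPn => // jk1; apply: h => /=.
  by rewrite j0 -ltnS ltn_neqAle jk1.
have := h j; rewrite /= j0 (leqW jk) => /(_ isT).
by rewrite ltn_eqF.
Qed.

Lemma measurable_history_RV j k : (0 < j <= k)%N ->
  measurable_fun [set: Omega_ k] (B j : Omega_ k -> T).
Proof.
move=> jk _ E mE; rewrite setTI; apply: sub_sigma_algebra.
exists (fun i => if i == j then E else setT); first by move=> i; case: ifP.
apply/seteqP; split => w h.
  by move=> i /= _; case: eqP => // ->.
by have := h j jk; rewrite /= eqxx.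
Qed.

Lemma measurable_history_le k d' (S : measurableType d') (h : Omega -> S) :
  measurable_fun [set: Omega_ k] (h : Omega_ k -> S) ->
  measurable_fun [set: Omega_ k.+1] (h : Omega_ k.+1 -> S).
Proof.
move=> mh _ E mE; apply: (sub_sigma_algebra2 _ (mh measurableT E mE)).
exact: history_le.
Qed.

Lemma measurable_history k d' (S : measurableType d') (h : Omega -> S) :
  measurable_fun [set: Omega_ k] (h : Omega_ k -> S) -> measurable_fun setT h.
Proof.
move=> mh _ E mE; have := mh measurableT E mE.
exact: (smallest_sub (sigma_algebra_measurable Omega) (@history_measurable k)).
Qed.

Hypothesis indB : mutually_independent [set k | (0 < k)%N] B.

Lemma history_indep k A E : history k A -> measurable E ->
  P (A `&` B k.+1 @^-1` E) = (P A * P (B k.+1 @^-1` E))%E.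
Proof.
move=> [D mD ->] mE.
pose J0 := [fset j in iota 1 k]%fset.
have J0E j : (j \in J0) = (0 < j <= k)%N.
  by rewrite !inE mem_iota add1n ltnS.
have kJ0 : k.+1 \notin J0 by rewrite J0E ltnn andbF.
(* The event of the new sample is appended to the cylinder, so mutual independence applies to a
   single finite family. *)
pose D' j := if j == k.+1 then E else D j.
have D'E j : j \in J0 -> D' j = D j.
  by rewrite J0E /D' => /andP[_ jk]; rewrite ltn_eqF.
have mD' j : measurable (D' j) by rewrite /D'; case: ifP.
have ind1 := indB (J := (k.+1 |` J0)%fset) (A := D').
have ind0 := indB (J := J0) (A := D).
rewrite big_fsetU1//= in ind1.
have -> : [set j | (0 < j <= k)%N] = [set` J0].
  by apply/seteqP; split => j /=; rewrite J0E.
have -> : \bigcap_(j in [set` J0]) B j @^-1` D j `&` B k.+1 @^-1` E =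
          \bigcap_(j in [set` (k.+1 |` J0)%fset]) B j @^-1` D' j.
  apply/seteqP; split => w /=.
    move=> [h hE] j /=; rewrite in_fset1U => /orP[/eqP ->|jJ].
      by rewrite /D' eqxx.
    by rewrite D'E//; apply: h.
  move=> h; split.
    by move=> j /= jJ; rewrite -(D'E j jJ); apply: h => /=; rewrite in_fset1U jJ orbT.
  by have := h k.+1; rewrite /= in_fset1U eqxx => /(_ isT); rewrite /D' eqxx.
rewrite ind1//; last first.
  by move=> j /=; rewrite in_fset1U J0E => /orP[/eqP ->//|/andP[]].
rewrite ind0//; last by move=> j /=; rewrite J0E => /andP[].
rewrite {1}/D' eqxx muleC; congr (_ * _)%E.
by rewrite [LHS]big_seq [RHS]big_seq; apply: eq_bigr => j jJ; rewrite D'E.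
Qed.

End history.

(** * The run of the algorithm *)

Section measurable_oracle.
Context {R : realType} {d m : nat} {dXi dZ : measure_display}
  {Xi : measurableType dXi} {Z : measurableType dZ}
  (F : 'rV[R]_d -> 'rV[R]_d) (c : 'rV[R]_d -> 'rV[R]_m) (J : 'rV[R]_d -> 'M[R]_(m, d))
  (gft : 'rV[R]_d -> Xi -> 'rV[R]_d) (ct : 'rV[R]_d -> Z -> 'rV[R]_m)
  (gct : 'rV[R]_d -> Z -> 'M[R]_(m, d)).
Hypotheses
  (mct : forall i, jointly_measurable (fun y z => ct y z 0 i))
  (mgft : forall j, jointly_measurable (fun y xi => gft y xi 0 j))
  (mgct : forall i j, jointly_measurable (fun y z => gct y z i j))
  (cF : continuous F) (cc : continuous c) (cJ : forall i j, continuous (fun y => J y i j)).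
Context {dT} {T : measurableType dT} (u : T -> 'rV[R]_d) (l : T -> 'rV[R]_m)
  (b : T -> Xi * Z * Z).
Hypotheses (mu : coord_measurable u) (ml : coord_measurable l).

Lemma coord_measurable_Qgrad (rho : R) : measurable_fun setT b ->
  coord_measurable (fun t => Qgrad gft ct gct rho (u t) (l t) (b t)).
Proof.
move=> mb.
have m1 : measurable_fun setT (fun t => (b t).1) := measurableT_comp measurable_fst mb.
have mxi : measurable_fun setT (fun t => (b t).1.1) := measurableT_comp measurable_fst m1.
have mz1 : measurable_fun setT (fun t => (b t).1.2) := measurableT_comp measurable_snd m1.
have mz2 : measurable_fun setT (fun t => (b t).2) := measurableT_comp measurable_snd mb.
have mrow i : coord_measurable (fun t => row i (gct (u t) (b t).1.2)).
  move=> j; under eq_fun do rewrite mxE.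
  exact: (jointly_measurable_comp (mgct i j) mu mz1).
apply: coord_measurableD.
  apply: coord_measurableD.
    by move=> j; exact: (jointly_measurable_comp (mgft j) mu mxi).
  by apply: coord_measurable_sum => i; apply: coord_measurableZ.
apply: coord_measurableZ => //; apply: coord_measurable_sum => i.
by apply: coord_measurableZ => //; exact: (jointly_measurable_comp (mct i) mu mz2).
Qed.

Lemma coord_measurable_mean_Qgrad (rho : R) :
  coord_measurable (fun t => mean_Qgrad F c J rho (u t) (l t)).
Proof.
have mc := coord_measurable_continuous cc mu.
apply: coord_measurableD; first exact: coord_measurable_continuous.
have -> : (fun t => (l t + rho *: c (u t)) *m J (u t)) =
    (fun t => \sum_(i < m) (l t + rho *: c (u t)) 0 i *: row i (J (u t))).
  by apply/funext => t; rewrite mulmx_sum_row.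
apply: coord_measurable_sum => i; apply: coord_measurableZ.
  by apply: coord_measurableD => //; exact: coord_measurableZ.
move=> j; under eq_fun do rewrite mxE.
exact: (measurable_comp_continuous (h := fun y => J y i j)).
Qed.

End measurable_oracle.

(** * The dual increment *)

Section dual_step.
Context {R : realType}.
Implicit Types (gamma t : R) (k : nat).

(** Normalisation by |t| turns the increment into a deterministic magnitude times a sign, also at t
    = 0; boundedness and measurability of the multipliers follow from this form. *)
Lemma gamma_schedE gamma k t :
  gamma_sched gamma k t * t = gamma / (k%:R * ln k.+1%:R ^+ 2) * Num.sg t.
Proof.
rewrite /gamma_sched invfM mulrA -mulrA; congr (_ * _).
have [->|t0] := eqVneq t 0; first by rewrite sgr0 mulr0.
by rewrite {2}[t]numEsg mulrCA mulVf ?mulr1// normr_eq0.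
Qed.

Lemma gamma_sched_bd gamma k t : 0 <= gamma ->
  `|gamma_sched gamma k t * t| <= gamma * (k%:R * ln k.+1%:R ^+ 2)^-1.
Proof.
move=> g0; rewrite gamma_schedE normrM.
have h : 0 <= gamma / (k%:R * ln k.+1%:R ^+ 2) by rewrite divr_ge0// mulr_ge0// sqr_ge0.
by rewrite ger0_norm// ler_piMr// normr_sg; case: (t != 0).
Qed.

Lemma measurable_sg d (T : measurableType d) (h : T -> R) :
  measurable_fun setT h -> measurable_fun setT (fun w => Num.sg (h w)).
Proof.
move=> mh.
have -> : (fun w => Num.sg (h w)) = (fun w => if 0 < h w then 1 else if h w < 0 then -1 else 0).
  apply/funext => w; case: ltP => [/gtr0_sg//|]; case: ltP => [/ltr0_sg//|h1 h2].
  have -> : h w = 0 by apply/eqP; rewrite eq_le h1 h2.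
  by rewrite sgr0.
apply: measurable_fun_ifT => //; first exact: measurable_fun_ltr.
by apply: measurable_fun_ifT => //; exact: measurable_fun_ltr.
Qed.

End dual_step.

(** * Analysis of a run *)

Section run.
Context {R : realType} {d m : nat} {dXi dZ dO : measure_display}
  {Xi : measurableType dXi} {Z : measurableType dZ} {Omega : measurableType dO}
  (Pxi : probability Xi R) (Pzeta : probability Z R) (P : probability Omega R)
  (X : set 'rV[R]_d) (f : 'rV[R]_d -> R)
  (F : 'rV[R]_d -> 'rV[R]_d) (c : 'rV[R]_d -> 'rV[R]_m) (J : 'rV[R]_d -> 'M[R]_(m, d))
  (gft : 'rV[R]_d -> Xi -> 'rV[R]_d) (ct : 'rV[R]_d -> Z -> 'rV[R]_m)
  (gct : 'rV[R]_d -> Z -> 'M[R]_(m, d))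
  (Lgf Lgc Lc sigma_f Cgct Cct Lf LJ Cgf Cgc Cc delta Qlow rho gamma : R)
  (x1 : 'rV[R]_d) (lam1 : 'rV[R]_m)
  (B : nat -> {RV P >-> (Xi * Z * Z)%type})
  (x : nat -> Omega -> 'rV[R]_d) (lam : nat -> Omega -> 'rV[R]_m)
  (g : nat -> Omega -> 'rV[R]_d).
Hypotheses (clX : closed X) (cvX : convex_set X) (Xx1 : X x1).
Hypotheses (Lgf0 : 0 < Lgf) (Cgct0 : 0 <= Cgct) (Cct0 : 0 <= Cct)
  (Lf0 : 0 <= Lf) (LJ0 : 0 <= LJ) (Cgc0 : 0 <= Cgc) (Cc0 : 0 <= Cc) (delta0 : 0 < delta)
  (rho1 : 1 < rho) (gamma0 : 0 < gamma).
Hypotheses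
  (law_xi : forall k A, (0 < k)%N -> measurable A -> P [set w | A (B k w).1.1] = Pxi A)
  (law_zeta : forall k A1 A2, (0 < k)%N -> measurable A1 -> measurable A2 ->
     P [set w | A1 (B k w).1.2 /\ A2 (B k w).2] = (Pzeta A1 * Pzeta A2)%E)
  (indB : mutually_independent [set k | (0 < k)%N] B)
  (mct : forall i, jointly_measurable (fun y z => ct y z 0 i))
  (mgft : forall j, jointly_measurable (fun y xi => gft y xi 0 j))
  (mgct : forall i j, jointly_measurable (fun y z => gct y z i j))
  (Ect : forall y i, (\int[Pzeta]_z (ct y z 0 i)%:E = (c y 0 i)%:E)%E)
  (Egft : forall y j, (\int[Pxi]_xi (gft y xi 0 j)%:E = (F y 0 j)%:E)%E)
  (Egct : forall y i j, (\int[Pzeta]_z (gct y z i j)%:E = (J y i j)%:E)%E)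
  (gft_lip : forall y z, (\int[Pxi]_xi (enorm (gft y xi - gft z xi) ^+ 2)%:E
     <= (Lgf ^+ 2 * enorm (y - z) ^+ 2)%:E)%E)
  (gct_lip : forall i y z, (\int[Pzeta]_t (enorm (row i (gct y t) - row i (gct z t)) ^+ 2)%:E
     <= (Lgc ^+ 2 * enorm (y - z) ^+ 2)%:E)%E)
  (ct_lip : forall i y z, (\int[Pzeta]_t ((ct y t 0 i - ct z t 0 i) ^+ 2)%:E
     <= (Lc ^+ 2 * enorm (y - z) ^+ 2)%:E)%E)
  (gft_var : forall y, (\int[Pxi]_xi (enorm (gft y xi - F y) ^+ 2)%:E <= (sigma_f ^+ 2)%:E)%E)
  (gct_bd : forall i y, {ae Pzeta, forall t, enorm (row i (gct y t)) <= Cgct})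
  (ct_bd : forall i y, {ae Pzeta, forall t, `|ct y t 0 i| <= Cct}).
Hypotheses
  (f_exp : forall x y, `|f y - f x - dotp (F x) (y - x)| <= Lf * enorm (y - x) ^+ 2)
  (c_exp : forall i x y, `|c y 0 i - c x 0 i - dotp (row i (J x)) (y - x)| <= LJ * enorm (y - x) ^+ 2)
  (c_lip : forall i x y, `|c y 0 i - c x 0 i| <= Cgc * enorm (y - x))
  (F_lip : forall x y, enorm (F x - F y) <= Lf * enorm (x - y))
  (J_lip : forall (l : 'rV[R]_m) x y, enorm (l *m (J x - J y)) <= LJ * enorm (x - y) * enorm l)
  (F_bd : forall x, enorm (F x) <= Cgf)
  (J_bd : forall (l : 'rV[R]_m) x, enorm (l *m J x) <= Cgc * enorm l)
  (c_bd : forall x, enorm (c x) <= Cc)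
  (cf : continuous f) (cF : continuous F) (cc : continuous c) (cJ : forall i j, continuous (fun y => J y i j))
  (Q_bd : forall (r : R) y, 0 < r -> Qlow <= f y + r / 2 * \sum_(i < m) c y 0 i ^+ 2)
  (regular : forall k, (0 < k)%N -> {ae P, forall w,
     delta * enorm (c (x k w)) <= euclid_dist_to (c (x k w) *m J (x k w)) (neg_normal_cone X (x k w))}).

Let L := Ltilde m Lgf Lgc Lc Cgct Cct gamma (enorm lam1).
Let eta := eta_sched L rho.
Let rhok := rho_sched rho.
Let Lam := enorm lam1 + 4 * gamma.
Let Lq := @lagrangian_lip R m Lf LJ Cgc Cc Lam.

Hypothesis run : algorithm_run gft ct gct X eta rhok alpha_sched (gamma_sched gamma) x1 lam1 B x lam g.

Local Notation s := (@root5 R).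
Let e k w := g k w - mean_Qgrad F c J (rhok k) (x k w) (lam k w).
Let Dx k w := x k.+1 w - x k w.

Let L2E : L ^+ 2 = 3 / 4 * Lgf ^+ 2 + 3 / 4 * m%:R ^+ 2 * Lam ^+ 2 * Lgc ^+ 2
  + 3 / 2 * m%:R ^+ 2 * (Cct ^+ 2 * Lgc ^+ 2 + Cgct ^+ 2 * Lc ^+ 2).
Proof.
rewrite /L /Ltilde sqr_sqrtr//.
by repeat (exact: sqr_ge0 || apply: divr_ge0 || apply: mulr_ge0 || apply: addr_ge0).
Qed.

Let L0 : 0 < L.
Proof.
rewrite lt_def sqrtr_ge0 andbT -sqrf_eq0 gt_eqF// L2E.
have : 0 < Lgf ^+ 2 by rewrite exprn_gt0.
have : 0 <= 3 / 4 * m%:R ^+ 2 * Lam ^+ 2 * Lgc ^+ 2.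
  by repeat (exact: sqr_ge0 || apply: divr_ge0 || apply: mulr_ge0).
have : 0 <= 3 / 2 * m%:R ^+ 2 * (Cct ^+ 2 * Lgc ^+ 2 + Cgct ^+ 2 * Lc ^+ 2).
  by repeat (exact: sqr_ge0 || apply: divr_ge0 || apply: mulr_ge0 || apply: addr_ge0).
lra.
Qed.

Let rho_gt0 : 0 < rho. Proof. exact: lt_trans ltr01 rho1. Qed.

Let Lam0 : 0 <= Lam.
Proof. by rewrite addr_ge0 ?enorm_ge0// mulr_ge0// ltW. Qed.

Let etaE k : eta k = 1 / (9 * L * rho * s k.+1 ^+ 3).
Proof. by rewrite /eta /eta_sched root5X. Qed.

Let rhokE k : rhok k = rho * s k. Proof. by []. Qed.

Let alphaE k : alpha_sched k = 8 / (9 * s k ^+ 4) :> R.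
Proof.
rewrite /alpha_sched -[k%:R `^ (4 / 5)]/(k%:R `^ (4%:R / 5)) -root5X !invfM !mulrA.
by congr (_ * _); lra.
Qed.

Let eta_gt0 k : 0 < eta k.
Proof. rewrite etaE divr_gt0//; apply: mulr_gt0; last by rewrite exprn_gt0// root5_gt0.
by apply: mulr_gt0 => //; apply: mulr_gt0. Qed.

Let rhok_ge1 k : (0 < k)%N -> 1 <= rhok k.
Proof. by move=> k0; rewrite rhokE; have := root5_ge1 (R := R) k0; have := rho1; nra. Qed.

Let rhok_ge0 k : 0 <= rhok k.
Proof. by rewrite rhokE mulr_ge0 ?powR_ge0// ltW. Qed.

Let alpha01 k : (0 < k)%N -> 0 <= alpha_sched k :> R /\ alpha_sched k <= 1 :> R.
Proof.
move=> k0; rewrite alphaE; have h := root5_ge1 (R := R) k0.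
have h4 : 1 <= s k ^+ 4 by rewrite expr_ge1// (le_trans ler01).
split; first by rewrite divr_ge0// mulr_ge0//; lra.
by rewrite ler_pdivrMr; lra.
Qed.

Let X_nonempty : X !=set0. Proof. by exists x1. Qed.

Let x_in k w : (0 < k)%N -> X (x k w).
Proof.
case: k => // -[_|k _]; first by rewrite (run_x1 run).
by rewrite (run_x run)//; exact: euclid_proj_in.
Qed.

Let lam_step k w i : (0 < k)%N ->
  `|lam k.+1 w 0 i - lam k w 0 i| <= gamma * (k%:R * ln k.+1%:R ^+ 2)^-1.
Proof.
by move=> k0; rewrite (run_lam run)// addrC addKr; apply: gamma_sched_bd; exact: ltW.
Qed.

(** The logarithm is dropped: ln(k+1)^2 >= 4/9 > 1/4. *)
Let lam_step4 k w i : (0 < k)%N -> `|lam k.+1 w 0 i - lam k w 0 i| <= 4 * gamma / k%:R.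
Proof.
move=> k0; apply: (le_trans (lam_step w i k0)).
rewrite [4 * _]mulrC -mulrA ler_pM2l// invfM mulrC ler_wpM2r ?invr_ge0//.
have l2 : 2 / 3 <= ln k.+1%:R :> R.
  by apply: (le_trans ln2_ge); rewrite ler_ln ?posrE// ler_nat ltnS.
have h : 4 / 9 <= ln k.+1%:R ^+ 2 :> R by rewrite expr2; move: l2; nra.
by rewrite -[leRHS]invrK lef_pV2 ?posrE; lra.
Qed.

Let lam_bd k w i : (0 < k)%N -> `|lam k w 0 i| <= Lam.
Proof.
move=> k0.
have h n : `|lam n.+1 w 0 i| <= enorm lam1 + gamma * \sum_(1 <= j < n.+1) (j%:R * ln j.+1%:R ^+ 2)^-1.
  elim: n => [|n ih].
    by rewrite big_geq// mulr0 addr0 (run_lam1 run) coord_le_enorm.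
  rewrite big_nat_recr//= mulrDr addrA.
  have := lerD ih (lam_step w i (ltn0Sn n)); apply: le_trans.
  by rewrite -[X in `|X|](subrK (lam n.+1 w 0 i)) addrC ler_normD.
case: k k0 => // n _; apply: (le_trans (h n)).
rewrite /Lam lerD2l [4 * _]mulrC ler_pM2l//.
exact: sum_inv_log2_le.
Qed.

Local Notation Omega_ k := (g_sigma_algebraType (history B k)).

(** The step from k to k+1 computes x and lam from sample k, while g at k+1 already uses sample k+1.
    This shift by one is what makes sample k+1 fresh relative to x_{k+1} and lam_{k+1}. *)
Let adapted k :
  [/\ @coord_measurable R _ (Omega_ k) d (x k.+1), @coord_measurable R _ (Omega_ k) m (lam k.+1)
    & @coord_measurable R _ (Omega_ k.+1) d (g k.+1)].
Proof.
elim: k => [|k [mx ml mg]].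
  have mx : @coord_measurable R _ (Omega_ 0) d (x 1%N).
    have -> : x 1%N = fun=> x1 by apply/funext => w; exact: (run_x1 run).
    exact: coord_measurable_cst.
  have ml : @coord_measurable R _ (Omega_ 0) m (lam 1%N).
    have -> : lam 1%N = fun=> lam1 by apply/funext => w; exact: (run_lam1 run).
    exact: coord_measurable_cst.
  split => //.
  have -> : g 1%N = fun w => Qgrad gft ct gct (rhok 1%N) x1 lam1 (B 1%N w).
    by apply/funext => w; exact: (run_g1 run).
  apply: (@coord_measurable_Qgrad _ _ _ _ _ _ _ _ _ _ mct mgft mgct _ (Omega_ 1) (fun=> x1) (fun=> lam1)).
  - exact: coord_measurable_cst.
  - exact: coord_measurable_cst.
  - exact: measurable_history_RV.
have mx' : @coord_measurable R _ (Omega_ k.+1) d (x k.+1).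
  by move=> j; exact: measurable_history_le (mx j).
have ml' : @coord_measurable R _ (Omega_ k.+1) m (lam k.+1).
  by move=> j; exact: measurable_history_le (ml j).
have mB : measurable_fun [set: Omega_ k.+1] (B k.+1 : Omega_ k.+1 -> (Xi * Z * Z)%type).
  by apply: measurable_history_RV; rewrite ltnSn.
have mx2 : @coord_measurable R _ (Omega_ k.+1) d (x k.+2).
  have -> : x k.+2 = fun w => euclid_proj X (x k.+1 w - eta k.+1 *: g k.+1 w).
    by apply/funext => w; exact: (run_x run).
  apply: coord_measurable_continuous; first exact: continuous_euclid_proj.
  by apply: coord_measurableB => //; exact: coord_measurableZ.
have ml2 : @coord_measurable R _ (Omega_ k.+1) m (lam k.+2).
  move=> i.
  have -> : (fun w => lam k.+2 w 0 i) = (fun w => lam k.+1 w 0 i +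
      gamma / (k.+1%:R * ln k.+2%:R ^+ 2) * Num.sg (ct (x k.+1 w) (B k.+1 w).2 0 i)).
    by apply/funext => w; rewrite (run_lam run)// gamma_schedE.
  apply: measurable_funD => //; apply: measurable_funM => //; apply: measurable_sg.
  apply: (jointly_measurable_comp (mct i) mx').
  exact: (measurableT_comp measurable_snd mB).
split => //.
have -> : g k.+2 = fun w => Qgrad gft ct gct (rhok k.+2) (x k.+2 w) (lam k.+2 w) (B k.+2 w)
        + (1 - alpha_sched k.+2) *: (g k.+1 w - Qgrad gft ct gct (rhok k.+1) (x k.+1 w) (lam k.+1 w) (B k.+2 w)).
  by apply/funext => w; exact: (run_g run).
have mB2 : measurable_fun [set: Omega_ k.+2] (B k.+2 : Omega_ k.+2 -> (Xi * Z * Z)%type).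
  by apply: measurable_history_RV; rewrite ltnSn.
apply: coord_measurableD.
  apply: coord_measurable_Qgrad => // j.
    exact: measurable_history_le (mx2 j).
  exact: measurable_history_le (ml2 j).
apply: coord_measurableZ => //; apply: coord_measurableB.
  by move=> j; exact: measurable_history_le (mg j).
apply: coord_measurable_Qgrad => // j.
  exact: measurable_history_le (mx' j).
exact: measurable_history_le (ml' j).
Qed.

Let mx k : (0 < k)%N -> coord_measurable (x k).
Proof. by case: k => // k _ j; case: (adapted k) => h _ _; exact: measurable_history (h j). Qed.

Let mlam k : (0 < k)%N -> coord_measurable (lam k).
Proof. by case: k => // k _ j; case: (adapted k) => _ h _; exact: measurable_history (h j). Qed.

Let mg k : (0 < k)%N -> coord_measurable (g k).
Proof. by case: k => // k _ j; case: (adapted k) => _ _ h; exact: measurable_history (h j). Qed.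

Let me k : (0 < k)%N -> coord_measurable (e k).
Proof.
move=> k0; apply: coord_measurableB; first exact: mg.
by apply: coord_measurable_mean_Qgrad => //; [exact: mx|exact: mlam].
Qed.

Let mDx k : (0 < k)%N -> coord_measurable (Dx k).
Proof. by move=> k0; apply: coord_measurableB; [exact: mx|exact: mx]. Qed.

Let mu k : probability _ R := distribution P (B k).

Let law_xi_mu k : (0 < k)%N -> forall A, measurable A -> mu k [set b | A b.1.1] = Pxi A.
Proof. by move=> k0 A mA; exact: law_xi. Qed.

Let law_zeta_mu k : (0 < k)%N -> forall A1 A2, measurable A1 -> measurable A2 ->
  mu k [set b | A1 b.1.2 /\ A2 b.2] = (Pzeta A1 * Pzeta A2)%E.
Proof. by move=> k0 A1 A2 mA1 mA2; exact: law_zeta. Qed.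

Let sqL2_Q k r y l : (0 < k)%N -> 0 <= r -> sqL2 (mu k) (Qgrad gft ct gct r y l).
Proof.
move=> k0; exact: (sqL2_Qgrad Cgct0 Cct0 (law_xi_mu k0) (law_zeta_mu k0) mct mgft mgct gft_var gct_bd ct_bd).
Qed.

Let has_mean_Q k r y l : (0 < k)%N -> 0 <= r ->
  has_mean (mu k) (Qgrad gft ct gct r y l) (mean_Qgrad F c J r y l).
Proof.
move=> k0; exact: (has_mean_Qgrad Cgct0 Cct0 (law_xi_mu k0) (law_zeta_mu k0) mct mgft mgct Ect Egft Egct gft_var gct_bd ct_bd).
Qed.

Let N1 := 2 * (sigma_f ^+ 2 + (m%:R * ((Lam + Cct) * Cgct)) ^+ 2).
Let N := 2 * N1 * rho ^+ 2 + 4 * (m%:R * ((8 * gamma + rho * Cct) * Cgct)) ^+ 2.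

Let N0 : 0 <= N.
Proof.
by rewrite /N /N1; repeat (exact: sqr_ge0 || apply: divr_ge0 || apply: mulr_ge0 || apply: addr_ge0).
Qed.

Let inv_le_root4 k : (0 < k)%N -> k%:R^-1 <= 2 / s k.+1 ^+ 4.
Proof.
move=> k0; have t0 := root5_gt0 (R := R) (ltn0Sn k); have t1 := root5_ge1 (R := R) (ltn0Sn k).
have k0' : 0 < k%:R :> R by rewrite ltr0n.
rewrite -[leLHS]div1r ler_pdivrMr// mulrAC ler_pdivlMr ?exprn_gt0// mul1r.
have h5 := root5_5 (R := R) k.+1; rewrite exprS -natr1 in h5.
have : 1 <= k%:R :> R by rewrite ler1n.
have h4 : 0 < s k.+1 ^+ 4 by rewrite exprn_gt0.
have : s k.+1 ^+ 4 <= s k.+1 * s k.+1 ^+ 4 by rewrite ler_peMl// ltW.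
lra.
Qed.

(** Conditional variance with y = x_{k+1}, z = x_k and v = g_k frozen. The oracle difference splits
    into a parameter drift and a Lipschitz part, whence 16 = 2 * 2 * 4; noise, scaled by alpha^2
    rho_{k+1}^2, and drift are both O(s_{k+1}^-6). *)
Let step_variance k (y z : 'rV[R]_d) (l l' : 'rV[R]_m) (v : 'rV[R]_d) : (0 < k)%N ->
  (forall i, `|l 0 i| <= Lam) -> (forall i, `|l' 0 i| <= Lam) ->
  (forall i, `|l' 0 i - l 0 i| <= 4 * gamma / k%:R) ->
  let U b := Qgrad gft ct gct (rhok k.+1) y l' b
    + (1 - alpha_sched k.+1) *: (v - Qgrad gft ct gct (rhok k) z l b)
    - mean_Qgrad F c J (rhok k.+1) y l' in
  sqL2 (mu k.+1) U /\
  mean_sq (mu k.+1) U <= (1 - alpha_sched k.+1) * enorm (v - mean_Qgrad F c J (rhok k) z l) ^+ 2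
    + 16 * (L ^+ 2 * rhok k ^+ 2) * enorm (y - z) ^+ 2 + N / s k.+1 ^+ 6.
Proof.
move=> k0 lL lL' ll' U.
have k1 := ltn0Sn k.
have lU := sqL2_Q y l' k1 (rhok_ge0 k.+1); have lV := sqL2_Q z l k1 (rhok_ge0 k).
have lW := sqL2_Q y l k1 (rhok_ge0 k).
have hU := has_mean_Q y l' k1 (rhok_ge0 k.+1); have hV := has_mean_Q z l k1 (rhok_ge0 k).
split.
  apply: sqL2B; last exact: sqL2_cst.
  exact: (sqL2D lU (sqL2Z _ (sqL2B (sqL2_cst _ _) lV))).
have [a0 a1] := alpha01 k1.
apply: (le_trans (momentum_variance v a0 a1 lU lV hU hV)).
rewrite -!addrA lerD2l.
have t0 := root5_gt0 (R := R) k1; have t1 := root5_ge1 (R := R) k1.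
have noise := Qgrad_noise Cgct0 Cct0 (law_xi_mu k1) (law_zeta_mu k1) mct mgft mgct Ect Egct gft_var
  gct_bd ct_bd y (rhok_ge1 k1) lL' Lam0.
have lip := Qgrad_lipschitz Cgct0 Cct0 (law_xi_mu k1) (law_zeta_mu k1) mct mgft mgct gft_lip gct_lip
  ct_lip gct_bd ct_bd y z (rhok_ge1 k0) lL Lam0.
rewrite -L2E in lip.
have dl0 : 0 <= 8 * gamma / s k.+1 ^+ 4 by rewrite divr_ge0 ?mulr_ge0 ?exprn_ge0// ltW.
have dr0 : 0 <= rhok k.+1 - rhok k.
  by rewrite subr_ge0 !rhokE ler_wpM2l ?root5_le// ltW.
have hl i : `|l' 0 i - l 0 i| <= 8 * gamma / s k.+1 ^+ 4.
  apply: (le_trans (ll' i)); rewrite [leRHS](_ : _ = 4 * gamma * (2 / s k.+1 ^+ 4)); last by ring.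
  by rewrite ler_wpM2l ?inv_le_root4// mulr_ge0// ltW.
have drift := Qgrad_drift gft Cgct0 Cct0 (law_zeta_mu k1) mct mgct gct_bd ct_bd y (rhok_ge0 k) dl0 dr0
  (esym (subrKC _ _)) hl.
have split_ := mean_sqD (sqL2B lU lW) (sqL2B lW lV).
have eUV : (fun t => Qgrad gft ct gct (rhok k.+1) y l' t - Qgrad gft ct gct (rhok k) y l t
   + (Qgrad gft ct gct (rhok k) y l t - Qgrad gft ct gct (rhok k) z l t)) =
   (fun t => Qgrad gft ct gct (rhok k.+1) y l' t - Qgrad gft ct gct (rhok k) z l t).
  by apply/funext => t; rewrite addrA subrK.
rewrite eUV in split_.
have driftN : (m%:R * ((8 * gamma / s k.+1 ^+ 4 + (rhok k.+1 - rhok k) * Cct) * Cgct)) ^+ 2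
    <= (m%:R * ((8 * gamma + rho * Cct) * Cgct)) ^+ 2 / s k.+1 ^+ 6.
  have -> : (m%:R * ((8 * gamma + rho * Cct) * Cgct)) ^+ 2 / s k.+1 ^+ 6 =
    (m%:R * ((8 * gamma + rho * Cct) * Cgct) / s k.+1 ^+ 3) ^+ 2.
    by rewrite expr_div_n -exprM.
  have h3 : (s k.+1 ^+ 4)^-1 <= (s k.+1 ^+ 3)^-1.
    by rewrite lef_pV2 ?posrE ?exprn_gt0// ler_weXn2l.
  have hr : rhok k.+1 - rhok k <= rho / s k.+1 ^+ 3.
    rewrite !rhokE -mulrBr ler_wpM2l ?(ltW rho_gt0)//.
    exact: le_trans (root5_succB k0) h3.
  rewrite lerXn2r ?nnegrE//.
  - by apply: mulr_ge0 => //; apply: mulr_ge0 => //; apply: addr_ge0 => //; exact: mulr_ge0.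
  - rewrite divr_ge0 ?exprn_ge0 ?(ltW t0)//; apply: mulr_ge0 => //; apply: mulr_ge0 => //.
    by apply: addr_ge0; apply: mulr_ge0 => //; exact: ltW.
  have -> : m%:R * ((8 * gamma + rho * Cct) * Cgct) / s k.+1 ^+ 3 =
    m%:R * ((8 * gamma * (s k.+1 ^+ 3)^-1 + rho / s k.+1 ^+ 3 * Cct) * Cgct) by ring.
  apply: ler_wpM2l => //; apply: ler_wpM2r => //; apply: lerD; last exact: ler_wpM2r.
  by apply: ler_wpM2l => //; apply: mulr_ge0 => //; exact: ltW.
have al_noise : 2 * alpha_sched k.+1 ^+ 2 * mean_sq (mu k.+1)
    (fun b => Qgrad gft ct gct (rhok k.+1) y l' b - mean_Qgrad F c J (rhok k.+1) y l')
    <= 2 * N1 * rho ^+ 2 / s k.+1 ^+ 6.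
  have a2 : 0 <= 2 * alpha_sched k.+1 ^+ 2 :> R by rewrite mulr_ge0// sqr_ge0.
  apply: (le_trans (ler_wpM2l a2 noise)); rewrite alphaE rhokE -/N1.
  have -> : 2 * (8 / (9 * s k.+1 ^+ 4)) ^+ 2 * (N1 * (rho * s k.+1) ^+ 2) =
    64 / 81 * (2 * N1 * rho ^+ 2 / s k.+1 ^+ 6) by field; rewrite gt_eqF.
  apply: ler_piMl; last by rewrite ler_pdivrMr// mul1r ler_nat.
  apply: divr_ge0; last by rewrite exprn_ge0// ltW.
  apply: mulr_ge0; last exact: sqr_ge0.
  by apply: mulr_ge0 => //; apply: mulr_ge0 => //; apply: addr_ge0; exact: sqr_ge0.
rewrite /N mulrDl.
move: al_noise drift driftN lip split_; rewrite -mulrA.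
move: (mean_sq _ _) (mean_sq _ _) (mean_sq _ _) (mean_sq _ _) => M1 M2 M3 M4.
lra.
Qed.

(** Integrates [step_variance] over the past. It is stated for extended integrals because the
    integrability of e_{k+1} is deduced from it. *)
Let variance_integral k : (0 < k)%N ->
  (\int[P]_w (enorm (e k.+1 w) ^+ 2)%:E <= \int[P]_w
    ((1 - alpha_sched k.+1) * enorm (e k w) ^+ 2 + 16 * (L ^+ 2 * rhok k ^+ 2) * enorm (Dx k w) ^+ 2
     + N / s k.+1 ^+ 6)%:E)%E.
Proof.
move=> k0.
pose U (p : Omega_ k * (Xi * Z * Z)) :=
  Qgrad gft ct gct (rhok k.+1) (x k.+1 p.1) (lam k.+1 p.1) p.2
    + (1 - alpha_sched k.+1) *: (g k p.1 - Qgrad gft ct gct (rhok k) (x k p.1) (lam k p.1) p.2)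
    - mean_Qgrad F c J (rhok k.+1) (x k.+1 p.1) (lam k.+1 p.1).
have [mx1 ml1 _] := adapted k.
have [mxk mlk mgk] : [/\ @coord_measurable R _ (Omega_ k) d (x k), @coord_measurable R _ (Omega_ k) m (lam k)
    & @coord_measurable R _ (Omega_ k) d (g k)].
  have [j kE] : exists j, k = j.+1 by exists k.-1; rewrite prednK.
  rewrite kE; have [a b c'] := adapted j.
  by split => // i; [exact: measurable_history_le (a i)|exact: measurable_history_le (b i)].
have m1 n (u : Omega -> 'rV[R]_n) : @coord_measurable R _ (Omega_ k) n u ->
    @coord_measurable R _ (Omega_ k * (Xi * Z * Z))%type n (fun p => u p.1).
  by move=> mu' i; exact: (measurableT_comp (mu' i) measurable_fst).
have mU : coord_measurable U.
  apply: coord_measurableB; last first.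
    by apply: coord_measurable_mean_Qgrad => //; exact: m1.
  apply: coord_measurableD.
    by apply: coord_measurable_Qgrad => //; exact: m1.
  apply: coord_measurableZ => //; apply: coord_measurableB; first exact: m1.
  by apply: coord_measurable_Qgrad => //; exact: m1.
have eE w : e k.+1 w = U (w, B k.+1 w) by rewrite /e (run_g run).
under eq_integral do rewrite eE.
have Gm : history B k `<=` measurable by exact: history_measurable.
rewrite (independent_fubini (Y := B k.+1) (h := fun p => (enorm (U p) ^+ 2)%:E) Gm
  (@history_setI _ _ _ _ _ _ _ _) (@historyT _ _ _ _ _ _ _ _) (@history_indep _ _ _ _ _ _ _ indB k)); last 2 first.
- exact/measurable_EFinP/measurable_sqr_enorm.
- by move=> p; rewrite lee_fin sqr_ge0.
apply: ge0_le_lower_integral => w.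
  by apply: integral_ge0 => b _; rewrite lee_fin sqr_ge0.
have [lU hU] := step_variance (x k.+1 w) (x k w) (g k w) k0 (fun i => lam_bd w i k0)
  (fun i => lam_bd w i (ltn0Sn k)) (fun i => lam_step4 w i k0).
have [_ nU] := lU.
by rewrite (meanE nU) lee_fin.
Qed.

Let sqL2_e1 : sqL2 P (e 1%N).
Proof.
have lU := sqL2_Q x1 lam1 (ltn0Sn 0) (rhok_ge0 1).
have [mU nU] := sqL2B lU (sqL2_cst (mu 1) (mean_Qgrad F c J (rhok 1%N) x1 lam1)).
split; first exact: me.
have -> : (fun w => enorm (e 1%N w) ^+ 2) =
  (fun b => enorm (Qgrad gft ct gct (rhok 1%N) x1 lam1 b - mean_Qgrad F c J (rhok 1%N) x1 lam1) ^+ 2) \o B 1%N.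
  by apply/funext => w; rewrite /e (run_x1 run) (run_lam1 run) (run_g1 run).
apply: (nnL1_law (nu := mu 1)) nU => //.
Qed.

Let Dx_bd k w : (0 < k)%N -> enorm (Dx k w) <=
  eta k * enorm (e k w) + eta k * ((Cgf + Cgc * (m%:R * Lam) + Cgc * Cc) * rhok k).
Proof.
move=> k0; rewrite /Dx (run_x run)//.
apply: (le_trans (step_length F c J clX cvX X_nonempty (rhok k) (lam k w) (g k w) (eta_gt0 k) (x_in w k0))).
rewrite lerD2l ler_wpM2l ?(ltW (eta_gt0 k))//.
exact: (mean_Qgrad_bd Cgc0 Lam0 F_bd J_bd c_bd (x k w) (rhok_ge1 k0) (fun i => lam_bd w i k0)).
Qed.

Let sqL2_Dx k : (0 < k)%N -> sqL2 P (e k) -> sqL2 P (Dx k).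
Proof.
move=> k0 [_ ne].
apply: (sqL2_dom (h := fun w => 2 * eta k ^+ 2 * enorm (e k w) ^+ 2
  + 2 * (eta k * ((Cgf + Cgc * (m%:R * Lam) + Cgc * Cc) * rhok k)) ^+ 2)); first exact: mDx.
- apply: aeW => w; have := Dx_bd w k0.
  set a := eta k * enorm _; set b := eta k * (_ * _); set D := enorm _ => h.
  have D0 : 0 <= D by exact: enorm_ge0.
  have : D ^+ 2 <= (a + b) ^+ 2 by rewrite lerXn2r ?nnegrE// (le_trans D0).
  have -> : 2 * eta k ^+ 2 * enorm (e k w) ^+ 2 = 2 * a ^+ 2 by rewrite /a; ring.
  by have := sqr_ge0 (a - b); nra.
- apply: nnL1D; first by apply: nnL1Z => //; rewrite mulr_ge0// sqr_ge0.
  by apply: nnL1_cst; rewrite mulr_ge0// sqr_ge0.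
Qed.

Let Ebound k w := (1 - alpha_sched k.+1) * enorm (e k w) ^+ 2
  + 16 * (L ^+ 2 * rhok k ^+ 2) * enorm (Dx k w) ^+ 2 + N / s k.+1 ^+ 6.

Let coef_al k : 0 <= 1 - alpha_sched k.+1 :> R.
Proof. by have [_ h] := alpha01 (ltn0Sn k); rewrite subr_ge0. Qed.

Let coef_D k : 0 <= 16 * (L ^+ 2 * rhok k ^+ 2).
Proof. by rewrite mulr_ge0// mulr_ge0// sqr_ge0. Qed.

Let coef_N k : 0 <= N / s k.+1 ^+ 6.
Proof. by rewrite divr_ge0// exprn_ge0// powR_ge0. Qed.

Let nnL1_Ebound k : (0 < k)%N -> sqL2 P (e k) -> nnL1 P (Ebound k).
Proof.
move=> k0 le; have [_ nD] := sqL2_Dx k0 le; have [_ ne] := le.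
apply: nnL1D; last exact: nnL1_cst.
by apply: nnL1D; exact: nnL1Z.
Qed.

(** Induction: a square integrable error gives a square integrable step, and the two bound the next
    error. *)
Let sqL2_e k : (0 < k)%N -> sqL2 P (e k).
Proof.
case: k => [h|k _]; first by exfalso; move: h; rewrite ltnn.
elim: k => [|k ih]; [exact: sqL2_e1|split]; first exact: (me (ltn0Sn k.+1)).
apply: (nnL1_le (r := mean P (Ebound k.+1))).
- exact: (measurable_sqr_enorm (me (ltn0Sn k.+1))).
- by move=> w; exact: sqr_ge0.
- rewrite -(meanE (nnL1_Ebound (ltn0Sn k) ih)).
  exact: (variance_integral (ltn0Sn k)).
Qed.

Let sqL2_D k : (0 < k)%N -> sqL2 P (Dx k).
Proof. by move=> k0; exact: (sqL2_Dx k0 (sqL2_e k0)). Qed.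

Let variance k : (0 < k)%N ->
  mean_sq P (e k.+1) <= (1 - 8 / (9 * s k.+1 ^+ 4)) * mean_sq P (e k)
    + 16 * (L ^+ 2 * (rho * s k) ^+ 2) * mean_sq P (Dx k) + N / s k.+1 ^+ 6.
Proof.
move=> k0; have [_ ne] := sqL2_e k0; have [_ ne1] := sqL2_e (ltn0Sn k); have [_ nD] := sqL2_D k0.
have nb := nnL1_Ebound k0 (sqL2_e k0).
have h : mean_sq P (e k.+1) <= mean P (Ebound k).
  by apply: mean_le => //; rewrite -meanE//; exact: variance_integral.
apply: (le_trans h); rewrite /Ebound meanD; last 2 first.
- by apply: nnL1D; exact: nnL1Z.
- exact: nnL1_cst.
rewrite meanD; [|exact: nnL1Z..].
by rewrite mean_cst meanZ// meanZ// alphaE.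
Qed.

Let M := Cgf + Cgc * (m%:R * Lam).
Let a := Lq / (9 * L).
Let T0 := 27 * L / (2 * delta ^+ 2) * (1 + a) ^+ 2.
Let T := a + T0.
Let b := 4 * gamma * m%:R * Cc + 3 / (2 * delta ^+ 2) * M ^+ 2.

Let Lq0 : 0 <= Lq. Proof. exact: lagrangian_lip_ge0. Qed.

Let Cgf0 : 0 <= Cgf. Proof. exact: le_trans (enorm_ge0 (F x1)) (F_bd x1). Qed.

Let M0 : 0 <= M. Proof. by apply: addr_ge0 => //; apply: mulr_ge0 => //; exact: mulr_ge0. Qed.

Let a0 : 0 <= a. Proof. by apply: divr_ge0 => //; apply: mulr_ge0 => //; exact: ltW. Qed.

Let T00 : 0 <= T0.
Proof.
apply: mulr_ge0; last exact: sqr_ge0.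
by apply: divr_ge0; [apply: mulr_ge0 => //; exact: ltW|apply: mulr_ge0 => //; exact: sqr_ge0].
Qed.

Let b_ge0 : 0 <= b.
Proof.
apply: addr_ge0; first by apply: mulr_ge0 => //; apply: mulr_ge0 => //; apply: mulr_ge0 => //; exact: ltW.
by apply: mulr_ge0; [apply: divr_ge0 => //; apply: mulr_ge0 => //; exact: sqr_ge0|exact: sqr_ge0].
Qed.

(** The shift makes q nonnegative: [Qlow] bounds the part without multiplier, and the multiplier
    term is at least -m Lam Cc. *)
Let q k w := aug_lagrangian f c (rhok k) (lam k w) (x k w) - (Qlow - m%:R * (Lam * Cc)).

Let dual_sum_le (l l' : 'rV[R]_m) (r : R) y : 0 <= r -> (forall i, `|l' 0 i - l 0 i| <= r) ->
  \sum_(i < m) l' 0 i * c y 0 i <= \sum_(i < m) l 0 i * c y 0 i + m%:R * (r * Cc).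
Proof.
move=> r0 hl; rewrite -lerBlDl -sumrB; apply: sum_le_card => i.
rewrite -mulrBl; apply: (le_trans (ler_norm _)); rewrite normrM.
by apply: ler_pM => //; exact: le_trans (coord_le_enorm _ _) (c_bd y).
Qed.

Let aug_ge (r : R) (l : 'rV[R]_m) (y : 'rV[R]_d) : 0 < r -> (forall i, `|l 0 i| <= Lam) ->
  0 <= aug_lagrangian f c r l y - (Qlow - m%:R * (Lam * Cc)).
Proof.
move=> r0 lL; rewrite /aug_lagrangian.
have h1 := Q_bd y r0.
(* Comparison with the zero multiplier bounds the dual term from below. *)
have h2 := dual_sum_le (l := l) (l' := 0) (r := Lam) y Lam0.
have {}h2 := h2 (fun i => _).
have : 0 <= \sum_(i < m) l 0 i * c y 0 i + m%:R * (Lam * Cc).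
  rewrite (le_trans _ (h2 _))//; last by move=> i; rewrite mxE sub0r normrN.
  by rewrite big1// => i _; rewrite mxE mul0r.
clear h2; set s2 := \sum_(i < m) l 0 i * c y 0 i.
move: h1; move: (\sum_(i < m) c y 0 i ^+ 2) s2 => s1 s2.
lra.
Qed.

Let q_ge0 k w : (0 < k)%N -> 0 <= q k w.
Proof.
move=> k0; apply: aug_ge; last by move=> i; exact: lam_bd.
exact: lt_le_trans (rhok_ge1 k0).
Qed.

Let mq k : (0 < k)%N -> measurable_fun setT (q k).
Proof.
move=> k0; have mxk := mx k0; have mc := coord_measurable_continuous cc mxk.
apply: measurable_funB => //; apply: measurable_funD; first apply: measurable_funD.
- exact: measurable_comp_continuous.
- by apply: measurable_sum => i; apply: measurable_funM; [exact: (mlam k0)|exact: mc].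
- apply: measurable_funM => //; apply: measurable_sum => i; apply: measurable_funX.
  exact: mc.
Qed.

(** Adds the three changes from Q_k to Q_{k+1}: the primal step, the multiplier update ([hl]) and
    the penalty increase ([hrho], then [hb]). The negative step term is kept on the left, so that
    both sides are nonnegative and can be integrated. *)
Let descent_pt k w : (0 < k)%N ->
  delta * enorm (c (x k.+1 w)) <= euclid_dist_to (c (x k.+1 w) *m J (x k.+1 w)) (neg_normal_cone X (x k.+1 w)) ->
  q k.+1 w + 1 / 2 / eta k * enorm (Dx k w) ^+ 2 <=
  q k w + T / s k / eta k * enorm (Dx k w) ^+ 2 + (1 / 2 + T / s k) * eta k * enorm (e k w) ^+ 2 + b / k%:R.
Proof.
move=> k0 reg.
have k1 := ltn0Sn k.
have u1 := root5_ge1 (R := R) k0; have ut := root5_le (R := R) (leqnSn k).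
have kE := root5_5 (R := R) k.
have xE := run_x run w k0.
have lL i := lam_bd w i k0.
have hd := step_descent clX cvX X_nonempty Lf0 LJ0 Cgc0 Cc0 Lam0 f_exp c_exp c_lip c_bd
  (g k w) (rhok_ge1 k0) lL (eta_gt0 k) (x_in w k0).
rewrite -xE in hd.
have hc := step_constraint clX cvX X_nonempty Lf0 LJ0 Cgc0 Cc0 Lam0 c_lip F_lip J_lip F_bd J_bd c_bd
  (rhok_ge1 k0) lL (eta_gt0 k) (x := x k w) (g := g k w) (delta := delta).
rewrite -xE in hc; have {}hc := hc reg.
have D0 := enorm_ge0 (Dx k w); have e0 := enorm_ge0 (e k w).
have C0 := enorm_ge0 (c (x k.+1 w)).
have ha := lip_sqr_step_le (enorm (Dx k w)) L0 (ltW rho1) delta0 u1 ut Lq0.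
rewrite -/(Dx k w) -/(e k w) -/M -/Lq rhokE in hc hd.
rewrite etaE in hc; have hb := sqr_constraint_le L0 (ltW rho1) delta0 u1 ut Lq0 D0 C0 hc.
rewrite -etaE -/a in ha hb; rewrite -/T0 kE in hb.
have hl := dual_sum_le (x k.+1 w) (_ : 0 <= 4 * gamma / k%:R) (fun i => lam_step4 w i k0).
have {}hl := hl (divr_ge0 (mulr_ge0 (ler0n _ 4) (ltW gamma0)) (ler0n _ k)).
have hrho : (rhok k.+1 - rhok k) / 2 * enorm (c (x k.+1 w)) ^+ 2 <=
    rho / (2 * s k.+1 ^+ 4) * enorm (c (x k.+1 w)) ^+ 2.
  apply: ler_wpM2r; first exact: sqr_ge0.
  rewrite !rhokE -mulrBr (_ : rho / (2 * s k.+1 ^+ 4) = rho * (s k.+1 ^+ 4)^-1 / 2); last by rewrite invfM; ring.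
  by apply: ler_wpM2r => //; apply: ler_wpM2l; [exact: ltW|exact: root5_succB].
have qE : q k.+1 w = aug_lagrangian f c (rhok k) (lam k w) (x k.+1 w) - (Qlow - m%:R * (Lam * Cc))
   + (\sum_(i < m) lam k.+1 w 0 i * c (x k.+1 w) 0 i - \sum_(i < m) lam k w 0 i * c (x k.+1 w) 0 i)
   + (rhok k.+1 - rhok k) / 2 * enorm (c (x k.+1 w)) ^+ 2.
  rewrite /q /aug_lagrangian sqr_enorm_sum; ring.
rewrite qE /q.
set D := enorm (Dx k w) in ha hb hc hd *; set ee := enorm (e k w) in hb hc hd *.
set et := eta k in ha hb hd *.
have etp : 0 < et by exact: eta_gt0.
set r := et * ee ^+ 2 in hb *; set p := D ^+ 2 / et in ha hb *.
have p0 : 0 <= p by apply: divr_ge0; [exact: sqr_ge0|exact: ltW].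
have r0 : 0 <= r by apply: mulr_ge0; [exact: ltW|exact: sqr_ge0].
have -> : 1 / 2 / et * D ^+ 2 = p / 2 by rewrite /p; ring.
have -> : T / s k / et * D ^+ 2 = T / s k * p by rewrite /p; ring.
have -> : (1 / 2 + T / s k) * et * ee ^+ 2 = r / 2 + a / s k * r + T0 / s k * r.
  by rewrite /r /T; ring.
have ar : 0 <= a / s k * r.
  by apply: mulr_ge0 => //; apply: divr_ge0 => //; exact: le_trans u1.
have hd' : (1 / (2 * et) - Lq * (rho * s k)) * D ^+ 2 = p / 2 - Lq * (rho * s k) * D ^+ 2.
  by rewrite /p; field; exact: lt0r_neq0.
rewrite hd' in hd.
have er : et / 2 * ee ^+ 2 = r / 2 by rewrite /r; ring.
rewrite er in hd.
have -> : T / s k * p = a / s k * p + T0 / s k * p by rewrite /T; ring.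
have -> : b / k%:R = m%:R * (4 * gamma / k%:R * Cc) + 3 / (2 * delta ^+ 2) * M ^+ 2 / k%:R by rewrite /b; ring.
move: hd hl hrho hb ha ar; rewrite -rhokE.
move: (aug_lagrangian _ _ _ _ _) (aug_lagrangian _ _ _ _ _) (\sum_(i < m) _) (\sum_(i < m) _).
move: (rho / (2 * _) * _) (_ / 2 * enorm _ ^+ 2) (m%:R * (4 * _ / _ * _)) (3 / _ * _ / _).
move: (a / s k * r) (T0 / s k * r) (a / s k * p) (T0 / s k * p) (Lq * _ * _) (m%:R * (Lam * Cc)).
move=> v1 v2 v3 v4 v5 v6 v7 v8 v9 v10 v11 v12 v13 v14 h1 h2 h3 h4 h5 h6.
clearbody p r; lra.
Qed.

Let etai_ge0 k : 0 <= 1 / 2 / eta k.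
Proof. by apply: divr_ge0; [exact: divr_ge0|exact: ltW]. Qed.

Let T_ge0 : 0 <= T. Proof. exact: addr_ge0. Qed.

Let Ts_ge0 k : 0 <= T / s k. Proof. by apply: divr_ge0 => //; exact: powR_ge0. Qed.

Let qbound k w := q k w + T / s k / eta k * enorm (Dx k w) ^+ 2
  + (1 / 2 + T / s k) * eta k * enorm (e k w) ^+ 2 + b / k%:R.

Let cD_ge0 k : 0 <= T / s k / eta k.
Proof. by apply: divr_ge0; [exact: Ts_ge0|exact: ltW]. Qed.

Let ce_ge0 k : 0 <= (1 / 2 + T / s k) * eta k.
Proof. by apply: mulr_ge0; [apply: addr_ge0; [exact: divr_ge0|exact: Ts_ge0]|exact: ltW]. Qed.

Let cb_ge0 k : 0 <= b / k%:R. Proof. exact: divr_ge0. Qed.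

Let nnL1_qbound k : (0 < k)%N -> nnL1 P (q k) -> nnL1 P (qbound k).
Proof.
move=> k0 nq; have [_ ne] := sqL2_e k0; have [_ nD] := sqL2_D k0.
apply: nnL1D; last exact: (nnL1_cst P (cb_ge0 k)).
apply: nnL1D; last exact: (nnL1Z (ce_ge0 k) ne).
exact: (nnL1D nq (nnL1Z (cD_ge0 k) nD)).
Qed.

Let descent_ae k : (0 < k)%N ->
  {ae P, forall w, q k.+1 w + 1 / 2 / eta k * enorm (Dx k w) ^+ 2 <= qbound k w}.
Proof.
by move=> k0; apply: filterS (regular (ltn0Sn k)) => w; exact: descent_pt.
Qed.

(** Induction along the descent inequality, which dominates q_{k+1} almost surely by integrable
    quantities of step k. *)
Let nnL1_q k : (0 < k)%N -> nnL1 P (q k).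
Proof.
case: k => [h|k _]; first by exfalso; move: h; rewrite ltnn.
elim: k => [|k ih].
  have -> : q 1%N = fun=> aug_lagrangian f c (rhok 1%N) lam1 x1 - (Qlow - m%:R * (Lam * Cc)).
    by apply/funext => w; rewrite /q (run_lam1 run) (run_x1 run).
  apply: nnL1_cst; apply: aug_ge; first exact: lt_le_trans (rhok_ge1 (ltn0Sn 0)).
  move=> i; rewrite /Lam (le_trans (coord_le_enorm _ _))// lerDl.
  by apply: mulr_ge0 => //; exact: ltW.
apply: (nnL1_mono (k := qbound k.+1)).
- exact: (mq (ltn0Sn k.+1)).
- by move=> w; exact: (q_ge0 w (ltn0Sn k.+1)).
- apply: filterS (descent_ae (ltn0Sn k)) => w; apply: le_trans.
  by rewrite lerDl; apply: mulr_ge0; [exact: etai_ge0|exact: sqr_ge0].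
- exact: (nnL1_qbound (ltn0Sn k) ih).
Qed.

Let descent_mean k : (0 < k)%N ->
  mean P (q k.+1) <= mean P (q k)
  - (1 / 2 - T / s k) * (mean_sq P (Dx k) / (1 / (9 * L * rho * s k.+1 ^+ 3)))
  + (1 / 2 + T / s k) * (1 / (9 * L * rho * s k.+1 ^+ 3) * mean_sq P (e k)) + b / k%:R.
Proof.
move=> k0; rewrite -etaE.
have nq := nnL1_q k0; have nq1 := nnL1_q (ltn0Sn k).
have [_ ne] := sqL2_e k0; have [_ nD] := sqL2_D k0.
have n1 := nnL1Z (etai_ge0 k) nD; have n2 := nnL1Z (cD_ge0 k) nD; have n3 := nnL1Z (ce_ge0 k) ne.
have := ae_le_mean (nnL1D nq1 n1) (nnL1_qbound k0 nq) (descent_ae k0).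
have nc := nnL1_cst P (cb_ge0 k).
rewrite (meanD nq1 n1) (meanD (nnL1D (nnL1D nq n2) n3) nc) (meanD (nnL1D nq n2) n3) (meanD nq n2).
rewrite mean_cst (meanZ _ nD) (meanZ _ nD) (meanZ _ ne) -!/(mean_sq _ _).
move: (mean_sq P (e k)) (mean_sq P (Dx k)) (mean P (q k)) (mean P (q k.+1)) => z1 z2 z3 z4 h.
have -> : (1 / 2 - T / s k) * (z2 / eta k) = 1 / 2 / eta k * z2 - T / s k / eta k * z2 by ring.
have -> : (1 / 2 + T / s k) * (eta k * z1) = (1 / 2 + T / s k) * eta k * z1 by ring.
move: h; lra.
Qed.

Let potential_sum : exists C : R, 0 <= C /\ forall K, (0 < K)%N ->
  \sum_(1 <= k < K.+1) (mean_sq P (Dx k) / eta k + eta k * mean_sq P (e k)) <= C * (1 + ln K%:R).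
Proof.
have [C [C0 hC]] := sum_potential (q := fun k => mean P (q k)) (E := fun k => mean_sq P (e k))
  (D := fun k => mean_sq P (Dx k)) L0 rho_gt0 N0 b_ge0
  (fun k k0 => mean_ge0 P (fun w => q_ge0 w k0)) (fun k _ => mean_sq_ge0 P (e k))
  (fun k _ => mean_sq_ge0 P (Dx k)) descent_mean variance.
exists C; split => // K K0; apply: le_trans (hC K K0).
by rewrite le_eqVlt; apply/orP; left; apply/eqP; apply: eq_bigr => k _; rewrite etaE.
Qed.

Let A := (1 + delta^-1) * (1 + a).
(** A common majorant of the stationarity residual and the constraint violation, so that both
    conclusions come from a single summation. *)
Let residual_bd k w := A * (enorm (Dx k w) / eta k + enorm (e k w)) + M / delta / rhok k.

Let A_ge0 : 0 <= A.
Proof. by apply: mulr_ge0; apply: addr_ge0 => //; rewrite invr_ge0 ltW. Qed.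

Let tail_ge0 k : 0 <= M / delta / rhok k.
Proof. by apply: divr_ge0; [apply: divr_ge0 => //; exact: ltW|exact: rhok_ge0]. Qed.

Let Deta_ge0 k w : 0 <= enorm (Dx k w) / eta k.
Proof. by apply: divr_ge0; [exact: enorm_ge0|exact: ltW]. Qed.

Let step_residual k w : (0 < k)%N ->
  enorm (Dx k w) / eta k + enorm (e k w) + Lq * rhok k * enorm (Dx k w)
  <= (1 + a) * (enorm (Dx k w) / eta k + enorm (e k w)).
Proof.
move=> k0; have u1 := root5_ge1 (R := R) k0; have ut := root5_le (R := R) (leqnSn k).
have := lip_step_le L0 (ltW rho1) delta0 u1 ut Lq0 (enorm_ge0 (Dx k w)).
rewrite -etaE -/a -rhokE => h.
have := mulr_ge0 a0 (enorm_ge0 (e k w)).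
move: h; rewrite [(1 + a) * _]mulrDl mul1r [a * (_ + _)]mulrDr.
move: (Lq * _ * _) (a * (enorm (Dx k w) / eta k)) (a * enorm (e k w)) (enorm (Dx k w) / eta k) (enorm (e k w)).
move=> v1 v2 v3 v4 v5.
lra.
Qed.

Let stationarity_bd k w : (0 < k)%N ->
  euclid_dist_to (F (x k.+1 w) + (lam k w + rhok k *: c (x k.+1 w)) *m J (x k.+1 w))
    (neg_normal_cone X (x k.+1 w)) <= residual_bd k w.
Proof.
move=> k0; have xE := run_x run w k0.
have := step_stationarity clX cvX X_nonempty Lf0 LJ0 Cgc0 Cc0 Lam0 c_lip F_lip J_lip J_bd c_bd
  (x k w) (g k w) (rhok_ge1 k0) (fun i => lam_bd w i k0) (eta_gt0 k).
rewrite -xE -/(Dx k w) -/(e k w) -/Lq -/(mean_Qgrad F c J (rhok k) (x k.+1 w) (lam k w)) => h.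
apply: (le_trans h); apply: (le_trans (step_residual w k0)).
rewrite /residual_bd; set S := _ + enorm (e k w).
have S0 : 0 <= S by apply: addr_ge0; [exact: Deta_ge0|exact: enorm_ge0].
apply: ler_wpDr; first exact: tail_ge0.
apply: ler_wpM2r => //; apply: ler_peMl; first exact: addr_ge0.
by rewrite lerDl invr_ge0 ltW.
Qed.

Let constraint_bd k w : (0 < k)%N ->
  delta * enorm (c (x k.+1 w)) <= euclid_dist_to (c (x k.+1 w) *m J (x k.+1 w)) (neg_normal_cone X (x k.+1 w)) ->
  enorm (c (x k.+1 w)) <= residual_bd k w.
Proof.
move=> k0 reg; have xE := run_x run w k0.
have hc := step_constraint clX cvX X_nonempty Lf0 LJ0 Cgc0 Cc0 Lam0 c_lip F_lip J_lip F_bd J_bd c_bd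
  (rhok_ge1 k0) (fun i => lam_bd w i k0) (eta_gt0 k) (x := x k w) (g := g k w) (delta := delta).
rewrite -xE in hc; have {}hc := hc reg.
rewrite -/(Dx k w) -/(e k w) -/M -/Lq in hc.
have {}hc := le_trans hc (lerD (step_residual w k0) (lexx M)).
have r1 := rhok_ge1 k0; have r0 : 0 < rhok k by exact: lt_le_trans r1.
have dr : 0 < delta * rhok k by exact: mulr_gt0.
rewrite mulrC -ler_pdivlMr// in hc; apply: (le_trans hc).
rewrite /residual_bd mulrDl; set S := _ + enorm (e k w).
have S0 : 0 <= S by apply: addr_ge0; [exact: Deta_ge0|exact: enorm_ge0].
apply: lerD; last by rewrite invfM mulrA.
have -> : (1 + a) * S / (delta * rhok k) = delta^-1 * (1 + a) * S / rhok k by rewrite invfM; ring.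
have h0 : 0 <= delta^-1 * (1 + a) * S.
  by apply: mulr_ge0 => //; apply: mulr_ge0; [rewrite invr_ge0 ltW|exact: addr_ge0].
apply: (@le_trans _ _ (delta^-1 * (1 + a) * S)).
  by rewrite ler_pdivrMr// ler_peMr.
apply: ler_wpM2r => //; apply: ler_wpM2r; first exact: addr_ge0.
by rewrite lerDr.
Qed.

Let nnL1_enorm n (U : Omega -> 'rV[R]_n) : sqL2 P U -> nnL1 P (fun w => enorm (U w)).
Proof.
move=> [mU nU]; have n1 := nnL1D (nnL1_cst P (@ler01 R)) nU.
apply: (nnL1_mono _ _ _ n1); first exact: measurable_enorm.
  by move=> w; exact: enorm_ge0.
apply: aeW => w; set v := enorm (U w).
by have := sqr_ge0 (v - 1); have := enorm_ge0 (U w); rewrite -/v expr2; nra.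
Qed.

Let nnL1_residual_bd k : (0 < k)%N -> nnL1 P (residual_bd k).
Proof.
move=> k0; apply: nnL1D; last exact: (nnL1_cst P (tail_ge0 k)).
apply: (nnL1Z A_ge0); apply: nnL1D; last exact: (nnL1_enorm (sqL2_e k0)).
have -> : (fun w => enorm (Dx k w) / eta k) = (fun w => (eta k)^-1 * enorm (Dx k w)).
  by apply/funext => w; rewrite mulrC.
apply: nnL1Z; first by rewrite invr_ge0 ltW.
exact: (nnL1_enorm (sqL2_D k0)).
Qed.

(* AM-GM with a weight [o] that balances the two resulting sums. *)
Let residual_bd_le k (o : R) w : 0 < o ->
  residual_bd k w <= A / 2 * o * ((eta k)^-1 * enorm (Dx k w) ^+ 2 + eta k * enorm (e k w) ^+ 2)
    + (A / (o * eta k) + M / delta / rhok k).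
Proof.
move=> o0; rewrite /residual_bd addrA lerD2r.
have e0 := eta_gt0 k; set et := eta k in e0 *.
set D := enorm (Dx k w); set ee := enorm (e k w).
have oe : 0 < o * et by exact: mulr_gt0.
have -> : A / 2 * o * (et^-1 * D ^+ 2 + et * ee ^+ 2) + A / (o * et) =
  A * (o / 2 * (et^-1 * D ^+ 2 + et * ee ^+ 2) + (o * et)^-1) by ring.
apply: ler_wpM2l => //.
have h v : v <= o / 2 * (et * v ^+ 2) + (2 * (o * et))^-1.
  have -> : o / 2 * (et * v ^+ 2) + (2 * (o * et))^-1 = v + (o * et * v - 1) ^+ 2 * (2 * (o * et))^-1.
    by field; rewrite !gt_eqF.
  by rewrite lerDl; apply: mulr_ge0; [exact: sqr_ge0|rewrite invr_ge0 mulr_ge0// ltW].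
have h1 := h (D / et); have h2 := h ee.
have E1 : et * (D / et) ^+ 2 = et^-1 * D ^+ 2 by field; rewrite gt_eqF.
have E2 : (2 * (o * et))^-1 = (o * et)^-1 / 2 by rewrite invfM mulrC.
rewrite E1 E2 in h1; rewrite E2 in h2.
move: h1 h2; rewrite mulrDr.
move: (D / et) (o / 2 * _) (o / 2 * _) ((o * et)^-1) => v1 v2 v3 v4.
lra.
Qed.

Let mean_residual_bd_le k (o : R) : (0 < k)%N -> 0 < o ->
  mean P (residual_bd k) <= A / 2 * o * (mean_sq P (Dx k) / eta k + eta k * mean_sq P (e k))
    + (A / (o * eta k) + M / delta / rhok k).
Proof.
move=> k0 o0; have [_ ne] := sqL2_e k0; have [_ nD] := sqL2_D k0.
have ei : 0 <= (eta k)^-1 by rewrite invr_ge0 ltW.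
have eg : 0 <= eta k by exact: ltW.
have n1 := nnL1Z ei nD; have n2 := nnL1Z eg ne; have n12 := nnL1D n1 n2.
have Ao : 0 <= A / 2 * o by apply: mulr_ge0; [exact: divr_ge0|exact: ltW].
have n3 := nnL1Z Ao n12.
have cc0 : 0 <= A / (o * eta k) + M / delta / rhok k.
  by apply: addr_ge0; [apply: divr_ge0 => //; apply: mulr_ge0; exact: ltW|exact: tail_ge0].
have n4 := nnL1_cst P cc0.
have := le_mean (nnL1_residual_bd k0) (nnL1D n3 n4) (fun w => residual_bd_le k w o0).
rewrite (meanD n3 n4) mean_cst (meanZ _ n12) (meanD n1 n2) (meanZ _ nD) (meanZ _ ne) -!/(mean_sq _ _).
by rewrite [(eta k)^-1 * _]mulrC.
Qed.

(** The AM-GM weight o = s_K^4 equalises the orders: the potential part gives o ln K, and the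
    remainder, a sum of 1 / (o eta_k), is of order K s_K^3 / s_K^4 = o. *)
Lemma run_residual_bound : exists C0 : R, 0 <= C0 /\ exists h : nat -> Omega -> R,
  (forall k, (0 < k)%N -> [/\ nnL1 P (h k),
    forall w, euclid_dist_to (F (x k.+1 w) + (lam k w + rhok k *: c (x k.+1 w)) *m J (x k.+1 w))
      (neg_normal_cone X (x k.+1 w)) <= h k w
    & {ae P, forall w, enorm (c (x k.+1 w)) <= h k w}]) /\
  forall K, (0 < K)%N -> \sum_(1 <= k < K.+1) mean P (h k) <= C0 * s K ^+ 4 * (1 + ln K%:R).
Proof.
have [C [C0 hC]] := potential_sum.
have Lr : 0 <= L * rho by apply: mulr_ge0; exact: ltW.
have Md : 0 <= M / delta / rho by apply: divr_ge0; [apply: divr_ge0 => //|]; exact: ltW.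
exists (A / 2 * C + A * (72 * (L * rho)) + M / delta / rho); split.
  apply: addr_ge0 => //; apply: addr_ge0; first by apply: mulr_ge0 => //; exact: divr_ge0.
  by apply: mulr_ge0 => //; exact: mulr_ge0.
exists residual_bd; split.
  move=> k k0; split; [exact: nnL1_residual_bd|by move=> w; exact: stationarity_bd|].
  by apply: filterS (regular (ltn0Sn k)) => w; exact: constraint_bd.
move=> K K0; set o := s K ^+ 4; set l := 1 + ln K%:R.
have sK := root5_gt0 (R := R) K0.
have o0 : 0 < o by exact: exprn_gt0.
have K0' : 0 < K%:R :> R by rewrite ltr0n.
have l1 : 1 <= l by rewrite lerDl ln_ge0// ler1n.
(* The factor 72 is the 9 of 1 / eta_k times the 8 from s_{k+1}^3 <= (2 s_K)^3; the tail uses 1 /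
   s_k = s_k^4 / k <= o / k. *)
have term k : (1 <= k < K.+1)%N -> mean P (residual_bd k) <=
   A / 2 * o * (mean_sq P (Dx k) / eta k + eta k * mean_sq P (e k))
   + A * (72 * (L * rho)) * o / K%:R + M / delta / rho * o * k%:R^-1.
  move=> /andP[k0 kK]; rewrite ltnS in kK.
  apply: (le_trans (mean_residual_bd_le k0 o0)); rewrite -addrA lerD2l.
  have sk := root5_gt0 (R := R) k0.
  have sk1 : s k.+1 <= 2 * s K.
    by apply: (le_trans (root5_succ_le2 k0)); rewrite ler_pM2l// root5_le.
  apply: lerD.
    have -> : A * (72 * (L * rho)) * o / K%:R = A * (72 * (L * (rho * (o / K%:R)))) by ring.
    apply: ler_wpM2l => //.
    have -> : (o * eta k)^-1 = 9 * (L * rho) * (s k.+1 ^+ 3 * o^-1).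
      by rewrite invfM etaE div1r invrK; ring.
    have -> : 72 * (L * (rho * (o / K%:R))) = 9 * (L * rho) * (8 * (o / K%:R)) by ring.
    apply: ler_wpM2l; first exact: mulr_ge0.
    have -> : 8 * (o / K%:R) = (2 * s K) ^+ 3 * o^-1.
      by rewrite -(root5_5 K) /o; field; exact: lt0r_neq0.
    apply: ler_wpM2r; first by rewrite invr_ge0 ltW.
    by rewrite lerXn2r ?nnegrE// ?mulr_ge0 ?powR_ge0.
  have -> : M / delta / rhok k = M / delta / rho * (s k)^-1 by rewrite rhokE invfM mulrA.
  rewrite -[leRHS]mulrA; apply: ler_wpM2l => //.
  have -> : (s k)^-1 = s k ^+ 4 * k%:R^-1.
    by rewrite -[in RHS](root5_5 k); field; exact: lt0r_neq0.
  apply: ler_wpM2r => //; rewrite lerXn2r ?nnegrE ?powR_ge0//; exact: root5_le.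
rewrite big_nat_cond; apply: (@le_trans _ _ (\sum_(1 <= k < K.+1 | (1 <= k < K.+1)%N && true)
   (A / 2 * o * (mean_sq P (Dx k) / eta k + eta k * mean_sq P (e k))
   + A * (72 * (L * rho)) * o / K%:R + M / delta / rho * o * k%:R^-1))).
  by apply: ler_sum => k /andP[hk _]; exact: term.
rewrite -big_nat_cond !big_split/= -!mulr_sumr.
have h1 := hC K K0; have h2 := sum_inv_le (R := R) K0.
have -> : \sum_(1 <= i < K.+1) K%:R^-1 = 1 :> R.
  by rewrite big_const_nat subSS subn0 iter_addr_0 -[LHS]mulr_natr mulVf// gt_eqF.
rewrite mulr1.
have Ao : 0 <= A / 2 * o by apply: mulr_ge0; [exact: divr_ge0|exact: ltW].
have Mo : 0 <= M / delta / rho * o by apply: mulr_ge0 => //; exact: ltW.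
have Lo : 0 <= A * (72 * (L * rho)) * o.
  by apply: mulr_ge0; [apply: mulr_ge0 => //; exact: mulr_ge0|exact: ltW].
have := ler_wpM2l Ao h1; have := ler_wpM2l Mo h2; have := ler_peMr Lo l1.
rewrite -/l.
have -> : (A / 2 * C + A * (72 * (L * rho)) + M / delta / rho) * o * l =
  A / 2 * o * (C * l) + A * (72 * (L * rho)) * o * l + M / delta / rho * o * l by ring.
by move=> h3 h4 h5; apply: lerD h4; exact: lerD h5 h3.
Qed.

Lemma run_measurable k : (0 < k)%N -> coord_measurable (x k) /\ coord_measurable (lam k).
Proof. by move=> k0; split; [exact: mx|exact: mlam]. Qed.

End run.

(** * A uniformly sampled iterate *)

Section discrete_product.
Context {d : measure_display} {Omega : measurableType d} {R : realType}.

Lemma measurable_nat_section d' (S : measurableType d') (h : Omega * nat -> S) :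
  (forall k, measurable_fun setT (fun w => h (w, k))) -> measurable_fun setT h.
Proof.
move=> mh _ A mA; rewrite setTI.
have -> : h @^-1` A = \bigcup_k ((fun w => h (w, k)) @^-1` A `*` [set k]).
  apply/seteqP; split => [[w k] hA|[w k] [j _] [/= hA ->]//].
  by exists k.
apply: bigcupT_measurable => k; apply: measurableX => //.
by rewrite -[X in measurable X]setTI; exact: mh.
Qed.

Variables (P : probability Omega R) (U : probability nat R) (K : nat).
Hypotheses (K0 : (0 < K)%N)
  (unifU : forall k, (1 <= k <= K)%N -> U [set k] = (K%:R^-1)%:E).

Let nnL1_atom k : nnL1 U (\1_[set k] : nat -> R).
Proof.
split; [exact: measurable_indic|by move=> n|].
by rewrite integral_indic// setIT (le_lt_trans (probability_le1 _ _))// ltry.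
Qed.

Let mean_atom k : (1 <= k <= K)%N -> mean U (\1_[set k] : nat -> R) = K%:R^-1.
Proof. by move=> hk; rewrite /mean integral_indic// setIT; exact: (congr1 fine (unifU hk)). Qed.

Let mean_atoms (a : nat -> R) : (forall k, 0 <= a k) ->
  let G n := \sum_(1 <= k < K.+1) a k * \1_[set k] n in
  nnL1 U G /\ mean U G = K%:R^-1 * \sum_(1 <= k < K.+1) a k.
Proof.
move=> a0 G; have na k : nnL1 U (fun n => a k * \1_[set k] n) by exact: nnL1Z.
split; first exact: nnL1_sum.
rewrite /G mean_sum// mulr_sumr; apply: eq_big_nat => k hk.
by rewrite meanZ// mean_atom// mulrC.
Qed.

Let sum_atoms (a : nat -> R) n : (1 <= n <= K)%N ->
  \sum_(1 <= k < K.+1) a k * \1_[set k] n = a n.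
Proof.
move=> /andP[n1 nK]; rewrite (bigD1_seq n) ?mem_index_iota ?n1 ?ltnS ?iota_uniq//=.
rewrite big1 ?addr0 => [|k kn]; first by rewrite indicE mem_set// mulr1.
by rewrite indicE memNset ?mulr0//= => /esym/eqP; apply/negP.
Qed.

(** U is prescribed on K atoms only; their masses add up to 1, so it charges nothing else. *)
Let unif_ae : {ae U, forall n, (1 <= n <= K)%N}.
Proof.
exists (~` [set n | (1 <= n <= K)%N]); split => //.
pose G (n : nat) : R := \sum_(1 <= k < K.+1) 1 * \1_[set k] n.
have [nG mG] : nnL1 U G /\ mean U G = K%:R^-1 * \sum_(1 <= k < K.+1) 1.
  exact: (mean_atoms (fun=> ler01)).
have -> : U (~` [set n | (1 <= n <= K)%N]) = (1 - U [set n | (1 <= n <= K)%N])%E.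
  exact: probability_setC.
suff -> : U [set n | (1 <= n <= K)%N] = 1%E by rewrite subee.
have GE : G = \1_[set n | (1 <= n <= K)%N].
  apply/funext => n; rewrite indicE; case: (boolP (1 <= n <= K)%N) => hn.
    by rewrite /G sum_atoms// mem_set.
  rewrite memNset/=; last exact/negP.
  rewrite /G big_nat_cond big1// => k /andP[hk _].
  by rewrite indicE memNset ?mulr0//= => nk; move/negP: hn; apply; rewrite nk -ltnS.
have := meanE nG; rewrite GE integral_indic// setIT => ->.
rewrite -GE mG sumr_const_nat subSS subn0 mulVf//.
by rewrite pnatr_eq0 -lt0n.
Qed.

(** Y is not assumed measurable, so it is dominated pointwise by a measurable H to which Tonelli
    applies, and the expectations are compared as suprema over simple functions. *)
Lemma expectation_uniform_le (Y : Omega * nat -> R) (h : nat -> Omega -> R) :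
  (forall q, 0 <= Y q) -> (forall k, nnL1 P (h k)) ->
  (forall k, (0 < k)%N -> {ae P, forall w, Y (w, k) <= h k w}) ->
  ('E_(P \x U)[Y] <= (K%:R^-1 * \sum_(1 <= k < K.+1) mean P (h k))%:E)%E.
Proof.
move=> Y0 nh Yh; rewrite unlock.
have /choice[N hN] : forall k, exists N : set Omega, [/\ measurable N, P N = 0%E &
    (0 < k)%N -> [set w | ~ Y (w, k) <= h k w] `<=` N].
  case=> [|k]; first by exists set0; split.
  by have [N [mN N0 sN]] := Yh k.+1 isT; exists N; split.
(* Infinite on the exceptional null sets and outside 1, ..., K, hence a majorant everywhere at no
   cost to the integral. *)
pose H (q : Omega * nat) : \bar R :=
  if (1 <= q.2 <= K)%N then if q.1 \in N q.2 then +oo%E else (h q.2 q.1)%:E else +oo%E.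
have H0 q : (0 <= H q)%E.
  rewrite /H; case: ifP => // _; case: ifP => // _; rewrite lee_fin.
  by have [_ + _] := nh q.2; apply.
have mH : measurable_fun setT H.
  apply: measurable_nat_section => k; rewrite /H/=.
  have [hk|hk] := boolP (0 < k <= K)%N; last exact: measurable_cst.
  apply: measurable_fun_ifT => //; last by have [+ _ _] := nh k; move/measurable_EFinP.
  apply: (measurable_fun_bool true) => /=.
  rewrite setTI (_ : _ @^-1` _ = N k); first by have [] := hN k.
  by apply/seteqP; split => w /=; [move/set_mem|move/mem_set].
apply: (@le_trans _ _ (\int[P \x U]_q H q)%E).
  apply: ge0_le_lower_integral => -[w k]; first by rewrite lee_fin.
  rewrite /H/=; case: ifP => [/andP[k0 _]|_]; last by rewrite leey.
  case: ifPn => [_|wN]; first by rewrite leey.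
  rewrite lee_fin; have [_ _ /(_ k0) sN] := hN k.
  by apply: contrapT => /sN wN'; move: wN; rewrite mem_set.
rewrite fubini_tonelli2//.
have [nG mG] := @mean_atoms (fun k => mean P (h k)) (fun k => mean_ge0 P (let: And3 _ h0 _ := nh k in h0)).
rewrite -mG -(meanE nG); have [mG' G0 _] := nG.
apply: ae_ge0_le_integral => //.
- by move=> n _; exact: integral_ge0.
- by move=> n _; rewrite lee_fin.
apply: filterS unif_ae => n hn _; rewrite sum_atoms// -(meanE (nh n)) /fubini_G.
have [mhn hn0 _] := nh n; have [mN N0 _] := hN n.
rewrite (ge0_ae_eq_integral (g := fun w => (h n w)%:E)) //.
- by apply: measurableT_comp => //; exact: measurable_fun_pair2.
- exact/measurable_EFinP.
- by move=> w _; rewrite lee_fin.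
exists (N n); split => // w /= hw; apply: contrapT => wN; apply: hw => _.
by rewrite /H/= hn memNset.
Qed.

End discrete_product.

Theorem theorem4p1 (R : realType) (d m : nat)
  (* sample spaces of xi and zeta, and the probability space of the run *)
  (dXi dZ dO : measure_display)
  (Xi : measurableType dXi) (Z : measurableType dZ) (Omega : measurableType dO)
  (Pxi : probability Xi R) (Pzeta : probability Z R) (P : probability Omega R)
  (* problem *)
  (X : set 'rV[R]_d) (f : 'rV[R]_d -> R) (c : 'rV[R]_d -> 'rV[R]_m)
  (* oracles *)
  (ft : 'rV[R]_d -> Xi -> R) (ct : 'rV[R]_d -> Z -> 'rV[R]_m)
  (gft : 'rV[R]_d -> Xi -> 'rV[R]_d) (gct : 'rV[R]_d -> Z -> 'M[R]_(m, d))
  (* constants *)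
  (Lgf Lgc Lc sigma_f sigma_gc sigma_c Cgc Cc Cgct Cct Cgf Bf delta Qlow : R)
  (rho gamma : R)
  (* run *)
  (x1 : 'rV[R]_d) (lam1 : 'rV[R]_m)
  (B : nat -> {RV P >-> (Xi * Z * Z)%type})
  (x : nat -> Omega -> 'rV[R]_d) (lam : nat -> Omega -> 'rV[R]_m)
  (g : nat -> Omega -> 'rV[R]_d) :
  closed X -> convex_set X ->
  (forall y, differentiable f y) ->
  (exists L : R, forall y z, enorm (grad f y - grad f z) <= L * enorm (y - z)) ->
  (forall y, differentiable c y) ->
  (exists L : R, forall y z, opnorm (Jac c y - Jac c z) <= L * enorm (y - z)) ->
  (* f and c are the expectations of ft and ct *)
  (forall y, Pxi.-integrable setT (fun xi => (ft y xi)%:E)) ->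
  (forall y, 'E_Pxi[fun xi => (ft y xi)%R] = (f y)%:E)%E ->
  (forall i, jointly_measurable (fun y z => ct y z 0 i)) ->
  (forall y i, 'E_Pzeta[fun z => (ct y z 0 i)%R] = (c y 0 i)%:E)%E ->
  (* unbiased gradient oracles *)
  (forall j, jointly_measurable (fun y xi => gft y xi 0 j)) ->
  (forall y j, 'E_Pxi[fun xi => (gft y xi 0 j)%R] = (grad f y 0 j)%:E)%E ->
  (forall i j, jointly_measurable (fun y z => gct y z i j)) ->
  (forall y i j, 'E_Pzeta[fun z => (gct y z i j)%R] = (Jac c y i j)%:E)%E ->
  [/\ 0 < Lgf, 0 < Lgc & 0 < Lc] ->
  [/\ 0 < sigma_f, 0 < sigma_gc & 0 < sigma_c] ->
  [/\ 0 < Cgc, 0 < Cc, 0 < Cgct & 0 < Cct] ->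
  [/\ 0 < Cgf, 0 < Bf & 0 < delta] ->
  (* (i) *)
  (forall y z, 'E_Pxi[fun xi => (enorm (gft y xi - gft z xi) ^+ 2)%R]
     <= (Lgf ^+ 2 * enorm (y - z) ^+ 2)%:E)%E ->
  (forall y z, 'E_Pzeta[fun t => (opnorm (gct y t - gct z t) ^+ 2)%R]
     <= (Lgc ^+ 2 * enorm (y - z) ^+ 2)%:E)%E ->
  (forall y z, 'E_Pzeta[fun t => (enorm (ct y t - ct z t) ^+ 2)%R]
     <= (Lc ^+ 2 * enorm (y - z) ^+ 2)%:E)%E ->
  (* (ii) *)
  (forall y, 'E_Pxi[fun xi => (enorm (gft y xi - grad f y) ^+ 2)%R]
     <= (sigma_f ^+ 2)%:E)%E ->
  (forall y, 'E_Pzeta[fun t => (opnorm (gct y t - Jac c y) ^+ 2)%R]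
     <= (sigma_gc ^+ 2)%:E)%E ->
  (forall y, 'E_Pzeta[fun t => (enorm (ct y t - c y) ^+ 2)%R]
     <= (sigma_c ^+ 2)%:E)%E ->
  (* (iii) *)
  (forall y, opnorm (Jac c y) <= Cgc) ->
  (forall y, enorm (c y) <= Cc) ->
  (forall y, {ae Pzeta, forall t, opnorm (gct y t) <= Cgct}) ->
  (forall y, {ae Pzeta, forall t, enorm (ct y t) <= Cct}) ->
  (forall y, enorm (grad f y) <= Cgf) ->
  (forall k, (0 < k)%N -> {ae P, forall w, `|f (x k w)| <= Bf}) ->
  (forall (r : R) y, 0 < r ->
     Qlow <= f y + r / 2 * \sum_(i < m) c y 0 i ^+ 2) ->
  (* (iv) *)
  (forall k, (0 < k)%N -> {ae P, forall w,
     delta * enorm (c (x k w))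
       <= euclid_dist_to (c (x k w) *m Jac c (x k w)) (neg_normal_cone X (x k w))}) ->
  (* sampling: xi0 ~ Pxi, (zeta1, zeta2) i.i.d. ~ Pzeta, fresh at every step *)
  (forall k A, (0 < k)%N -> measurable A ->
     P [set w | A (B k w).1.1] = Pxi A) ->
  (forall k A1 A2, (0 < k)%N -> measurable A1 -> measurable A2 ->
     P [set w | A1 (B k w).1.2 /\ A2 (B k w).2] = (Pzeta A1 * Pzeta A2)%E) ->
  mutually_independent [set k | (0 < k)%N] B ->
  (* algorithm *)
  X x1 -> 1 < rho -> 0 < gamma ->
  algorithm_run gft ct gct X
    (eta_sched (Ltilde m Lgf Lgc Lc Cgct Cct gamma (enorm lam1)) rho)
    (rho_sched rho) alpha_sched (gamma_sched gamma) x1 lam1 B x lam g ->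
  exists C p : R, 0 < C /\ 0 < p /\
    forall eps : R, 0 < eps -> eps <= 1 / 2 ->
    exists K : nat, (0 < K)%N /\
      K%:R <= C * eps ^- 5 * ln (1 / eps) `^ p /\
      (* U is the uniform law on {1, .., K}, and khat is the second projection
         of the product space Omega * nat *)
      forall U : probability nat R,
        (forall k : nat, (1 <= k <= K)%N -> U [set k] = (K%:R^-1)%:E) ->
        (exists lamhat : Omega * nat -> 'rV[R]_m,
          (forall i, measurable_fun setT (fun q => lamhat q 0 i)) /\
          ('E_(P \x U)[fun q : Omega * nat =>
             let xhat := x q.2.+1 q.1 in
             (euclid_dist_to (grad f xhat + lamhat q *m Jac c xhat)
               (neg_normal_cone X xhat))%R] <= eps%:E)%E) /\
        ('E_(P \x U)[fun q : Omega * nat =>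
           enorm (c (x q.2.+1 q.1))] <= eps%:E)%E.
Proof.
move=> clX cvX df [Lf' gradL] dc [LJ' jacL] _ _ mct Ect mgft Egft mgct Egct.
move=> [Lgf0 Lgc0 Lc0] _ [Cgc0 Cc0 Cgct0 Cct0] [_ _ delta0].
move=> gft_lip gct_lip ct_lip gft_var _ _ J_op c_bd gct_op ct_op F_bd _ Q_bd regular.
move=> law_xi law_zeta indB Xx1 rho1 gamma0 run.
rewrite unlock in Ect Egft Egct gft_lip gct_lip ct_lip gft_var.
pose F := grad f; pose J := Jac c.
(* The given Lipschitz constants carry no sign, so they are truncated at 0. *)
pose Lf := Num.max Lf' 0; pose LJ := Num.max LJ' 0.
have Lf0 : 0 <= Lf by rewrite le_max lexx orbT.
have LJ0 : 0 <= LJ by rewrite le_max lexx orbT.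
have F_lip y z : enorm (F y - F z) <= Lf * enorm (y - z).
  by apply: (le_trans (gradL y z)); rewrite ler_wpM2r ?enorm_ge0// le_max lexx.
have J_opL y z : opnorm (J y - J z) <= LJ * enorm (y - z).
  by apply: (le_trans (jacL y z)); rewrite ler_wpM2r ?enorm_ge0// le_max lexx.
have row_lip i y z : enorm (row i (J y) - row i (J z)) <= LJ * enorm (y - z).
  by rewrite -linearB (le_trans (enorm_row_le_opnorm _ _)).
have J_lip (l : 'rV[R]_m) y z : enorm (l *m (J y - J z)) <= LJ * enorm (y - z) * enorm l.
  by apply: (le_trans (enorm_mulmx _ _)); rewrite ler_wpM2r ?enorm_ge0.
have J_bd (l : 'rV[R]_m) y : enorm (l *m J y) <= Cgc * enorm l.
  by apply: (le_trans (enorm_mulmx _ _)); rewrite ler_wpM2r ?enorm_ge0//; exact: J_op.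
have dci i y : differentiable (fun y => c y 0 i) y.
  apply: (@differentiable_comp _ _ _ _ c (fun M : 'rV[R]_m => M 0 i)); first exact: dc.
  exact: differentiable_coord.
have f_exp y z : `|f z - f y - dotp (F y) (z - y)| <= Lf * enorm (z - y) ^+ 2.
  by apply: lipschitz_gradient_expansion => // u v; exact: derive_grad.
have c_exp i y z : `|c z 0 i - c y 0 i - dotp (row i (J y)) (z - y)| <= LJ * enorm (z - y) ^+ 2.
  apply: (lipschitz_gradient_expansion (h := fun y => c y 0 i) (G := fun y => row i (J y))) => //.
  by move=> u v; exact: derive_coord_Jac.
have c_lip i y z : `|c z 0 i - c y 0 i| <= Cgc * enorm (z - y).
  apply: (bounded_gradient_lipschitz (h := fun y => c y 0 i) (G := fun y => row i (J y))) => //.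
    by move=> u v; exact: derive_coord_Jac.
  by move=> u; apply: (le_trans (enorm_row_le_opnorm _ _)); exact: J_op.
have cf : continuous f by move=> y; exact: differentiable_continuous.
have cc : continuous c by move=> y; exact: differentiable_continuous.
have cF : continuous F by exact: lipschitz_enorm_continuous F_lip.
have cJ i j : continuous (fun y => J y i j).
  have -> : (fun y => J y i j) = (fun M : 'rV[R]_d => M 0 j) \o (fun y => row i (J y)).
    by apply/funext => y; rewrite [RHS]mxE.
  move=> y; apply: continuous_comp; last exact: coord_continuous.
  exact: (lipschitz_enorm_continuous (row_lip i)).
have gct_row i y z : (\int[Pzeta]_t (enorm (row i (gct y t) - row i (gct z t)) ^+ 2)%:E
    <= (Lgc ^+ 2 * enorm (y - z) ^+ 2)%:E)%E.
  apply: le_trans (gct_lip y z); apply: ge0_le_lower_integral => t; rewrite lee_fin ?sqr_ge0//.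
  by rewrite lerXn2r ?nnegrE ?enorm_ge0 ?opnorm_ge0// -linearB enorm_row_le_opnorm.
have ct_coord i y z : (\int[Pzeta]_t ((ct y t 0 i - ct z t 0 i) ^+ 2)%:E
    <= (Lc ^+ 2 * enorm (y - z) ^+ 2)%:E)%E.
  apply: le_trans (ct_lip y z); apply: ge0_le_lower_integral => t; rewrite lee_fin ?sqr_ge0//.
  rewrite -[leLHS]real_normK ?num_real// lerXn2r ?nnegrE ?enorm_ge0//.
  by have := coord_le_enorm (ct y t - ct z t) i; rewrite !mxE.
have gct_row_bd i y : {ae Pzeta, forall t, enorm (row i (gct y t)) <= Cgct}.
  by apply: filterS (gct_op y) => t; apply: le_trans; exact: enorm_row_le_opnorm.
have ct_coord_bd i y : {ae Pzeta, forall t, `|ct y t 0 i| <= Cct}.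
  by apply: filterS (ct_op y) => t; apply: le_trans; exact: coord_le_enorm.
have [C0 [C00 [h [hk hsum]]]] := run_residual_bound clX cvX Xx1 Lgf0 (ltW Cgct0) (ltW Cct0)
  Lf0 LJ0 (ltW Cgc0) (ltW Cc0) delta0 rho1 gamma0 law_xi law_zeta indB mct mgft mgct Ect Egft Egct
  gft_lip gct_row ct_coord gft_var gct_row_bd ct_coord_bd f_exp c_exp c_lip F_lip J_lip F_bd J_bd
  c_bd cf cF cc cJ Q_bd regular run.
have meas k : (0 < k)%N -> coord_measurable (x k) /\ coord_measurable (lam k).
  by move=> k0; apply: (run_measurable clX cvX Xx1 mct mgft mgct run).
have [C [Cp hC]] := iteration_count C00.
exists C, 5; do 2 split => //.
move=> eps e0 e2; have [K [K0 KC Keps]] := hC eps e0 e2.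
exists K; do 2 split => //.
move=> U unifU.
(* Index 0 lies outside the run; h is only controlled from index 1 on. *)
pose h' k := if k is 0%N then (fun=> 0) else h k.
have nh' k : nnL1 P (h' k) by case: k => [|k]; [exact: nnL1_cst|by have [] := hk k.+1 isT].
have mean_eps : K%:R^-1 * \sum_(1 <= k < K.+1) mean P (h' k) <= eps.
  rewrite (eq_big_nat _ _ (F2 := fun k => mean P (h k))); last by case.
  apply: le_trans Keps; rewrite mulrC ler_pdivrMr ?ltr0n//.
  apply: (le_trans (hsum K K0)); have sK := root5_gt0 (R := R) K0.
  rewrite -[X in _ <= _ * X](root5_5 K) le_eqVlt; apply/orP; left; apply/eqP.
  by field; exact: lt0r_neq0.
split; last first.
  apply: le_trans (_ : _ <= (K%:R^-1 * \sum_(1 <= k < K.+1) mean P (h' k))%:E)%E _; last by rewrite lee_fin.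
  apply: (expectation_uniform_le K0 unifU (Y := fun q => enorm (c (x q.2.+1 q.1)))) => //.
    by move=> q; exact: enorm_ge0.
  by case=> // k _; have [] := hk k.+1 isT.
(* With this multiplier the Lagrangian gradient at x_{k+1} is the gradient of the augmented
   Lagrangian of step k, for which stationarity was bounded. *)
exists (fun q => if q.2 == 0%N then 0 else lam q.2 q.1 + rho_sched rho q.2 *: c (x q.2.+1 q.1)); split.
  move=> i; apply: measurable_nat_section => -[|k] /=.
    by under eq_fun do rewrite mxE; exact: measurable_cst.
  have [_ ml] := meas k.+1 isT; have [mx _] := meas k.+2 isT.
  have : coord_measurable (fun w => lam k.+1 w + rho_sched rho k.+1 *: c (x k.+2 w)).
    apply: coord_measurableD => //; apply: coord_measurableZ => //.
    exact: coord_measurable_continuous.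
  exact.
apply: le_trans (_ : _ <= (K%:R^-1 * \sum_(1 <= k < K.+1) mean P (h' k))%:E)%E _; last by rewrite lee_fin.
apply: (expectation_uniform_le K0 unifU) => //.
  by move=> q; exact: euclid_dist_to_ge0.
by case=> // k _; apply: aeW => w; have [] := hk k.+1 isT.
Qed.
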